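(* Let $M_n$ be positive random weighted point measures on $\mathbb R$, and let $A_n\to\infty$. Suppose that: (i) $M_n$ converges vaguely in law to a stationary positive weighted point measure $M$ of intensity $K\in(0,\infty)$ for which there is a finite nonnegative measurable function $h_M$ on $[1,\infty)$ with $\mathbb E|N_M(x)-Kx|\le h_M(|x|)$ for $|x|\ge1$ and $\int_1^\infty h_M(r)r^{-2}\,dr<\infty$; (ii) $\displaystyle\lim_{\delta\downarrow0}\limsup_{n\to\infty}\mathbb P\bigl(M_n((-\delta,\delta))>0\bigr)=0$; (iii) there is a finite nonnegative measurable $h$ on $[1,\infty)$ with $h(x)=o(x)$ as $x\to\infty$ and $\int_1^\infty h(x)x^{-2}\,dx<\infty$, such that, uniformly for $1\le x\le A_n$, \[ \mathbb E|M_n((0,x])-M_n([-x,0))|\le h(x). \] Then \[ \frac1{\pi K}\int_{0<|x|\le A_n}\frac{dM_n(x)}x\ \Longrightarrow\ \mathrm{Cauchy}(0,1). \] In particular, condition (iii) is satisfied if its displayed bound holds with $h(x)=C(1+x^\alpha)$ for some $C<\infty$ and $\alpha<1$.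
   Context: A positive weighted point measure is a measure $\sum_{x\in X}w_x\delta_x$ on $\mathbb R$ with $X$ (its support) locally finite and $w_x>0$. Random measures are random elements of the space of such measures with its vague Borel sigma-algebra; vague convergence in law is convergence in distribution for the vague topology on locally finite measures. With $\theta_tM(B)=M(B+t)$, $M$ is stationary if $\theta_tM$ has the law of $M$ for every $t\in\mathbb R$; its intensity is $K=\mathbb E M((0,1])$. $N_M(x)=M((0,x])$ for $x\ge0$ and $N_M(x)=-M((x,0])$ for $x<0$. $\mathrm{Cauchy}(0,1)$ has density $[\pi(1+x^2)]^{-1}$; $\Longrightarrow$ is convergence in distribution as $n\to\infty$. The $A_n$ are deterministic. *)

(* Defs.v *)
From HB Require Import structures.
From mathcomp Require Import all_boot all_order all_algebra.
From mathcomp Require Import all_classical all_reals all_analysis.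
From mathcomp Require Import measurable_realfun.
Import Order.TTheory GRing.Theory Num.Theory.
Import numFieldNormedType.Exports.

Set Implicit Arguments.
Unset Strict Implicit.
Unset Printing Implicit Defensive.

Local Open Scope classical_set_scope.
Local Open Scope ring_scope.

Section locally_finite_measures.
Context {R : realType}.

Record lfmeasure := LFMeasure {
  lfmeasure_measure :> {measure set (measurableTypeR R) -> \bar R} ;
  lfmeasure_compact : forall A : set R,
    compact A -> (lfmeasure_measure A < +oo)%E }.

HB.instance Definition _ := gen_eqMixin lfmeasure.
HB.instance Definition _ := gen_choiceMixin lfmeasure.

Let mzero_compact (A : set R) :
  compact A -> ((@mzero _ (measurableTypeR R) R) A < +oo)%E.
Proof. by move=> _; rewrite /mzero ltry. Qed.

HB.instance Definition _ := isPointed.Build lfmeasure (LFMeasure mzero_compact).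

Record test_function := TestFunction {
  test_function_fun :> R -> R ;
  test_function_continuous : continuous test_function_fun ;
  test_function_compact : compact (closure [set x | test_function_fun x != 0]) }.

Definition test_integral (mu : lfmeasure) : {ptws test_function -> R} :=
  fun f => \int[mu]_x f x.

(* The vague topology: the coarsest topology for which [mu |-> \int f dmu] is
   continuous for every continuous compactly supported [f]. *)
HB.instance Definition _ :=
  Topological.copy lfmeasure (initial_topology test_integral).

HB.instance Definition _ :=
  Measurable.copy lfmeasure (g_sigma_algebraType (@open lfmeasure)).

Definition is_weighted_point_measure (mu : lfmeasure) : Prop :=
  exists (X : set R) (w : R -> R),
    [/\ forall A : set R, compact A -> finite_set (X `&` A),
        forall x, X x -> 0 < w x
      & forall B : set R, measurable B ->
          mu B = (\esum_(x in X) ((w x)%:E * \d_x B))%E].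

Section translation.
Variables (t : R) (mu : lfmeasure).

Definition translate (B : set (measurableTypeR R)) : \bar R :=
  mu [set x + t | x in B].

Let translateE : translate =
  pushforward mu ((fun x => x - t) : measurableTypeR R -> measurableTypeR R).
Proof.
apply/funext => B; rewrite /translate /pushforward; congr (mu _).
apply/seteqP; split => [_ [x Bx <-]|y /= By]; first by rewrite /= addrK.
by exists (y - t) => //; rewrite subrK.
Qed.

Let mshift : measurable_fun setT
  ((fun x => x - t) : measurableTypeR R -> measurableTypeR R).
Proof. exact: measurable_funB. Qed.

Let translate0 : translate set0 = 0%E.
Proof. by rewrite /translate image_set0 measure0. Qed.

Let translate_ge0 B : (0 <= translate B)%E.
Proof. exact: measure_ge0. Qed.

Let translate_sigma_additive : semi_sigma_additive translate.
Proof.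
rewrite translateE.
pose nu : {measure set (measurableTypeR R) -> \bar R} :=
  measure_function_pushforward__canonical__measure_function_Measure mu mshift.
exact: (@measure_semi_sigma_additive _ _ _ nu).
Qed.

HB.instance Definition _ := isMeasure.Build _ _ _ translate
  translate0 translate_ge0 translate_sigma_additive.

Let translate_compact (A : set R) : compact A -> (translate A < +oo)%E.
Proof.
move=> cA; apply: lfmeasure_compact.
apply: (continuous_compact _ cA); apply: continuous_subspaceT => x.
by apply: cvgD; [exact: cvg_id|exact: cvg_cst].
Qed.

Definition lf_translate : lfmeasure := LFMeasure translate_compact.

End translation.

(* [fine] is harmless here: bounded intervals have finite mass. *)
Definition counting_function (mu : lfmeasure) (x : R) : R :=
  if 0 <= x then fine (mu `]0, x]%classic) else - fine (mu `]x, 0]%classic).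

End locally_finite_measures.

Arguments lfmeasure R : clear implicits.
Arguments test_function R : clear implicits.

Section random_measures.
Context {R : realType}.

Definition stationary d (W : measurableType d) (P : probability W R)
    (M : {RV P >-> lfmeasure R}) : Prop :=
  forall (t : R) (B : set (lfmeasure R)), measurable B ->
    P ((fun w => lf_translate t (M w)) @^-1` B) = P (M @^-1` B).

Definition intensity d (W : measurableType d) (P : probability W R)
    (M : {RV P >-> lfmeasure R}) : \bar R :=
  (\int[P]_w M w `]0%R, 1%R]%classic)%E.

(* The variables may live on different probability spaces. *)
Definition cvg_in_law (T : topologicalType)
    (d : nat -> measure_display) (W : forall n, measurableType (d n))
    (P : forall n, probability (W n) R) (X : forall n, W n -> T)
    d' (W' : measurableType d') (P' : probability W' R) (Y : W' -> T) : Prop :=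
  forall f : T -> R, continuous f -> (exists C, forall x, `|f x| <= C) ->
    'E_(P n)[f \o X n]%E @[n --> \oo] --> 'E_P'[f \o Y]%E.

Definition balance_bound
    (d : nat -> measure_display) (W : forall n, measurableType (d n))
    (P : forall n, probability (W n) R)
    (M : forall n, {RV (P n) >-> lfmeasure R}) (A : nat -> R)
    (h : R -> R) : Prop :=
  forall (n : nat) (x : R), 1 <= x <= A n ->
    ('E_(P n)[fun w => (`|fine (M n w `]0%R, x]%classic)
                       - fine (M n w `[(- x)%R, 0%R[%classic)|)%R]
     <= (h x)%:E)%E.

Definition tail_integrable (h : R -> R) : Prop :=
  [/\ measurable_fun (`[1, +oo[%classic : set R) h,
      forall x, 1 <= x -> 0 <= h x
    & (\int[lebesgue_measure]_(x in `[1%R, +oo[) (h x / x ^+ 2)%:E < +oo)%E].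

Definition balance_condition
    (d : nat -> measure_display) (W : forall n, measurableType (d n))
    (P : forall n, probability (W n) R)
    (M : forall n, {RV (P n) >-> lfmeasure R}) (A : nat -> R) : Prop :=
  exists h : R -> R,
    [/\ tail_integrable h, h x / x @[x --> +oo] --> 0
      & @balance_bound d W P M A h].

Definition reciprocal_integral (A : R) (mu : lfmeasure R) : R :=
  \int[mu]_(x in [set x : R | 0 < `|x| <= A]) x^-1.

End random_measures.

Arguments stationary {R d W} P M.
Arguments intensity {R d W} P M.
Arguments cvg_in_law {R T d W} P X {d' W'} P' Y.
Arguments balance_bound {R d W} P M A h.
Arguments balance_condition {R d W} P M A.

Section cauchy_distribution.
Context {R : realType}.

Definition cauchy_pdf (x : R) : R := (pi * (1 + x ^+ 2))^-1.

Definition cauchy_prob (B : set (measurableTypeR R)) : \bar R :=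
  (\int[lebesgue_measure]_(x in B) (cauchy_pdf x)%:E)%E.

Lemma cauchy_pdf_ge0 x : 0 <= cauchy_pdf x.
Proof. by rewrite invr_ge0 mulr_ge0 ?pi_ge0// addr_ge0// sqr_ge0. Qed.

Lemma cauchy_pdfE x : cauchy_pdf x = pi^-1 * (oneDsqr x)^-1.
Proof. by rewrite /cauchy_pdf invfM. Qed.

Lemma continuous_cauchy_pdf : continuous cauchy_pdf.
Proof.
rewrite (_ : cauchy_pdf = (fun x => pi^-1 * (oneDsqr x)^-1)); last first.
  by apply/funext => x; rewrite cauchy_pdfE.
move=> x; apply: cvgM; first exact: cvg_cst.
exact: continuous_oneDsqrV.
Qed.

Lemma measurable_cauchy_pdf : measurable_fun [set: R] cauchy_pdf.
Proof. exact: continuous_measurable_fun continuous_cauchy_pdf. Qed.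

Let integral0y : (\int[lebesgue_measure]_(x in `[0%R, +oo[)
  (cauchy_pdf x)%:E = (2^-1)%:E)%E.
Proof.
under eq_integral do rewrite cauchy_pdfE EFinM.
rewrite ge0_integralZl_EFin//=.
- rewrite integral0y_oneDsqr -EFinM; congr EFin.
  by rewrite mulrA mulVf ?mul1r// gt_eqF// pi_gt0.
- apply/measurable_EFinP; apply: measurable_funTS.
  exact: continuous_measurable_fun continuous_oneDsqrV.
- by rewrite invr_ge0 pi_ge0.
Qed.

Let integral_cauchy_pdf :
  (\int[lebesgue_measure]_x (cauchy_pdf x)%:E = 1 :> \bar R)%E.
Proof.
have mf : measurable_fun [set: R] (EFin \o cauchy_pdf).
  by apply/measurable_EFinP; exact: measurable_cauchy_pdf.
rewrite -(setUv `]-oo, 0%R[%classic) ge0_integral_setU//=; last 4 first.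
- exact: measurableC.
- by rewrite setUv.
- by move=> x _; rewrite lee_fin cauchy_pdf_ge0.
- exact/disj_setPCl.
rewrite setCitvl integral0y integral_itv_bndo_bndc; last first.
  exact: measurable_funS mf.
rewrite (_ : (\int[lebesgue_measure]_(x in `]-oo, 0%R]) _)%E =
  (\int[lebesgue_measure]_(x in `]-oo, 0%R]) (cauchy_pdf (- x))%:E)%E); last first.
  by apply: eq_integral => x _; rewrite /cauchy_pdf sqrrN.
rewrite -(@ge0_integration_by_substitution0 _ (EFin \o cauchy_pdf))//; last first.
  by move=> x; rewrite lee_fin cauchy_pdf_ge0.
rewrite [X in (X + _)%E]integral0y -EFinD; congr EFin.
by rewrite -[X in X + _]mul1r -[X in _ + X]mul1r -splitr.
Qed.

Let cauchy0 : cauchy_prob set0 = 0%E.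
Proof. by rewrite /cauchy_prob integral_set0. Qed.

Let cauchy_ge0 A : (0 <= cauchy_prob A)%E.
Proof. by apply: integral_ge0 => x _; rewrite lee_fin cauchy_pdf_ge0. Qed.

Let cauchy_sigma_additive : semi_sigma_additive cauchy_prob.
Proof.
move=> /= F mF tF mUF; rewrite /cauchy_prob; apply: cvg_toP.
  apply: ereal_nondecreasing_is_cvgn => m n mn.
  apply: lee_sum_nneg_natr => // k _ _; apply: integral_ge0 => /= x Fkx.
  by rewrite lee_fin cauchy_pdf_ge0.
rewrite ge0_integral_bigcup//=.
- apply/measurable_funTS/measurableT_comp => //.
  exact: measurable_cauchy_pdf.
- by move=> x _; rewrite lee_fin cauchy_pdf_ge0.
Qed.

HB.instance Definition _ := isMeasure.Build _ _ _
  cauchy_prob cauchy0 cauchy_ge0 cauchy_sigma_additive.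

Let cauchy_setT : cauchy_prob [set: R] = 1%E.
Proof. exact: integral_cauchy_pdf. Qed.

HB.instance Definition _ :=
  @Measure_isProbability.Build _ _ R cauchy_prob cauchy_setT.

End cauchy_distribution.

(* Main.v *)
From HB Require Import structures.
Require Import Defs.
From mathcomp Require Import all_boot all_order all_algebra.
From mathcomp Require Import all_classical all_reals all_analysis.
From mathcomp Require Import measurable_realfun.
From mathcomp Require Import ring lra.
From mathcomp Require complex finmap.
Import Order.TTheory GRing.Theory Num.Theory.
Import numFieldNormedType.Exports.
Set Implicit Arguments.
Unset Strict Implicit.
Unset Printing Implicit Defensive.
Local Open Scope classical_set_scope.
Local Open Scope ring_scope.

(** Write F(z) for the integral of 1 / (x - z) against a positive measure cut off at
    a scale L. Im F >= 0 in the upper half-plane, so for a > 0 the resolvent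
    G = 1 / (F + b + i a) is bounded by 1 / a, whatever the measure. Put G = p - i q.

    For a stationary measure of intensity K, the mean of q at i y does not depend on
    y, up to errors that vanish as L grows. Indeed G is analytic, so a small vertical
    step changes q by as much as a horizontal step changes - p, up to second order
    ([resolvent_cauchy_riemann]); a horizontal step of the pole is a translation of
    the measure, which stationarity makes invisible in the mean
    ([expectation_pS_shift]); only the immobility of the cutoff costs O(1 / L). As y
    grows, F(i y) approaches i pi K in the mean: integration by parts expresses F
    through the deviations of the counting function from K x, and these are
    controlled by the integrable bound ([cutoff_parts], [parts_bound_cvg]). Hence at
    every fixed height the mean of q tends to its value at F = i pi K
    ([resolvent_expectation_cvg]).

    For fixed L and y the quantity q is a bounded vaguely continuous functional of the
    measure, so the convergence in law carries its mean over to the approximating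
    measures. It remains to compare F(i y) with the reciprocal integral: the absence
    of mass near the origin makes the pole at i y harmless for small y, and the balance
    of the two half-lines controls the part beyond L, again by parts ([tail_parts],
    [truncation_error]). So the means of 1 / (X_n + b + i a) have the
    right imaginary parts in the limit ([resolvent_reciprocal_cvg]), X_n being the
    reciprocal integral.

    After division by pi K this says that the means of all Poisson kernels converge to
    the ones of the Cauchy law, as the Poisson kernel of width a smoothed by the Cauchy
    law is the Poisson kernel of width 1 + a. Convolution with a narrow Poisson kernel
    hardly increases a continuous function of compact support, and this gives lower
    bounds for the means of such functions, then of bounded continuous functions; a
    lower bound for a function and its opposite is convergence in law
    ([poisson_cvg_in_law]). *)

(** * Resolvent of a finite Stieltjes transform *)

Section resolvent.
Import complex ComplexField ComplexField.Normc.
Variable R : rcfType.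
Implicit Types (a b u v t x y : R) (z w : R[i]) (s : seq (R * R)).

(** Real and imaginary parts of 1 / (t - i y). Up to a factor pi, [kerIm y] is the
    Poisson kernel of the half-plane at height y. *)
Definition kerRe y t : R := t / (t ^+ 2 + y ^+ 2).
Definition kerIm y t : R := y / (t ^+ 2 + y ^+ 2).
(** 1 / ((u + b) + i (v + a)) equals [resRe - i resIm]; with this sign [resIm] is
    nonnegative for a > 0 and v >= 0. *)
Definition resRe a b u v : R := (u + b) / ((u + b) ^+ 2 + (v + a) ^+ 2).
Definition resIm a b u v : R := (v + a) / ((u + b) ^+ 2 + (v + a) ^+ 2).

Lemma normr_Re_le z : `|complex.Re z| <= normc z.
Proof.
case: z => x y /=; rewrite -sqrtr_sqr ler_sqrt ?addr_ge0 ?sqr_ge0//.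
by rewrite lerDl sqr_ge0.
Qed.

Lemma normr_Im_le z : `|complex.Im z| <= normc z.
Proof.
case: z => x y /=; rewrite -sqrtr_sqr ler_sqrt ?addr_ge0 ?sqr_ge0//.
by rewrite lerDr sqr_ge0.
Qed.

Lemma normc_le_ReDIm x y : normc (Complex x y) <= `|x| + `|y|.
Proof.
have -> : Complex x y = Complex x 0 + Complex 0 y.
  by apply/eqP; rewrite eq_complex /= addr0 add0r !eqxx.
apply: (le_trans (le_normcD _ _)).
by rewrite /= !expr0n /= addr0 add0r !sqrtr_sqr.
Qed.

Lemma normc_ge0 z : 0 <= normc z.
Proof. exact: le_trans (normr_ge0 _) (normr_Re_le z). Qed.

Lemma normc_sum (I : Type) (r : seq I) (F : I -> R[i]) :
  normc (\sum_(i <- r) F i) <= \sum_(i <- r) normc (F i).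
Proof.
elim/big_ind2 : _ => [|x1 x2 y1 y2 h1 h2|//]; first by rewrite normc0.
by apply: (le_trans (le_normcD _ _)); exact: lerD.
Qed.

Lemma complexV_ReIm u v :
  (Complex u v)^-1 = Complex (u / (u ^+ 2 + v ^+ 2)) (- (v / (u ^+ 2 + v ^+ 2))).
Proof. by apply/eqP; rewrite eq_complex /= -mulNr !eqxx. Qed.

Lemma resE a b u v :
  (Complex (u + b) (v + a))^-1 = Complex (resRe a b u v) (- resIm a b u v).
Proof. by rewrite complexV_ReIm. Qed.

Lemma kerE y t : (Complex t (- y))^-1 = Complex (kerRe y t) (kerIm y t).
Proof. by rewrite complexV_ReIm sqrrN mulNr opprK. Qed.

Lemma normc_res_le a u v : 0 < a -> 0 <= v ->
  normc (Complex u (v + a))^-1 <= (v + a)^-1.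
Proof.
move=> a0 v0; rewrite normcV lef_pV2 ?posrE ?ltr_wpDl//.
  by apply: le_trans (normr_Im_le _); rewrite /= ler_norm.
by apply: lt_le_trans (normr_Im_le _); rewrite /= normr_gt0 gt_eqF// ltr_wpDl.
Qed.

Lemma complex_neq0_Im u v : 0 < v -> Complex u v != 0.
Proof. by move=> v0; rewrite eq_complex /= negb_and (gt_eqF v0) orbT. Qed.

(** From 1/w - 1/w' = (w' - w) / (w w'), where |w| and |w'| are at least a because
    their imaginary parts are. *)
Lemma resolvent_lipschitz a b u v u' v' : 0 < a -> 0 <= v -> 0 <= v' ->
  normc (Complex (resRe a b u v) (- resIm a b u v) -
         Complex (resRe a b u' v') (- resIm a b u' v'))
  <= (`|u - u'| + `|v - v'|) / a ^+ 2.
Proof.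
move=> a0 v0 v'0; rewrite -!resE.
set w := Complex (u + b) (v + a); set w' := Complex (u' + b) (v' + a).
have w0 : w != 0 by rewrite complex_neq0_Im ?ltr_wpDl.
have w'0 : w' != 0 by rewrite complex_neq0_Im ?ltr_wpDl.
have -> : w^-1 - w'^-1 = (w' - w) * (w^-1 * w'^-1) by field; rewrite w0 w'0.
rewrite !normcM ler_pM ?normc_ge0 ?mulr_ge0 ?normc_ge0//.
  have -> : w' - w = Complex (u' - u) (v' - v).
    by apply/eqP; rewrite eq_complex /=; apply/andP; split; apply/eqP; ring.
  by apply: (le_trans (normc_le_ReDIm _ _)); rewrite (distrC u) (distrC v).
have inva r : 0 <= r -> (r + a)^-1 <= a^-1.
  by move=> r0; rewrite lef_pV2 ?posrE ?ltr_wpDl// lerDr.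
rewrite expr2 invfM ler_pM ?normc_ge0//.
  by apply: le_trans (inva _ v0); exact: normc_res_le.
by apply: le_trans (inva _ v'0); exact: normc_res_le.
Qed.

Lemma resRe_lipschitz a b u v u' v' : 0 < a -> 0 <= v -> 0 <= v' ->
  `|resRe a b u v - resRe a b u' v'| <= (`|u - u'| + `|v - v'|) / a ^+ 2.
Proof.
move=> a0 v0 v'0; apply: le_trans (resolvent_lipschitz b u u' a0 v0 v'0).
exact: le_trans (normr_Re_le _).
Qed.

Lemma resIm_lipschitz a b u v u' v' : 0 < a -> 0 <= v -> 0 <= v' ->
  `|resIm a b u v - resIm a b u' v'| <= (`|u - u'| + `|v - v'|) / a ^+ 2.
Proof.
move=> a0 v0 v'0; apply: le_trans (resolvent_lipschitz b u u' a0 v0 v'0).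
apply: le_trans (normr_Im_le _).
by rewrite /= -opprD normrN.
Qed.

Lemma normr_resRe_le a b u v : 0 < a -> 0 <= v -> `|resRe a b u v| <= a^-1.
Proof.
move=> a0 v0; apply: (le_trans (normr_Re_le (Complex _ (- resIm a b u v)))).
rewrite -resE; apply: (le_trans (normc_res_le _ a0 v0)).
by rewrite lef_pV2 ?posrE ?ltr_wpDl// lerDr.
Qed.

Lemma resIm_ge0 a b u v : 0 < a -> 0 <= v -> 0 <= resIm a b u v.
Proof.
by move=> a0 v0; rewrite divr_ge0 ?addr_ge0 ?sqr_ge0// ltW.
Qed.

Lemma resIm_le a b u v : 0 < a -> 0 <= v -> resIm a b u v <= a^-1.
Proof.
move=> a0 v0; apply: le_trans (ler_norm _) _; rewrite -normrN.
apply: (le_trans (normr_Im_le (Complex (resRe a b u v) _))).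
rewrite -resE; apply: (le_trans (normc_res_le _ a0 v0)).
by rewrite lef_pV2 ?posrE ?ltr_wpDl// lerDr.
Qed.

(** The list [s] holds the (mass, position) pairs of a finite measure. *)
Definition stieltjes s z : R[i] :=
  \sum_(p <- s) (Complex p.1 0) * (Complex p.2 0 - z)^-1.

(** The derivative of [stieltjes s] at z. *)
Definition stieltjes1 s z : R[i] :=
  \sum_(p <- s) (Complex p.1 0) * (Complex p.2 0 - z)^-1 ^+ 2.

Definition resolvent s c z : R[i] := (stieltjes s z + c)^-1.

Lemma stieltjesE s t y : stieltjes s (Complex t y) =
  Complex (\sum_(p <- s) p.1 * kerRe y (p.2 - t))
          (\sum_(p <- s) p.1 * kerIm y (p.2 - t)).
Proof.
rewrite /stieltjes; elim: s => [|p s IH]; first by rewrite !big_nil.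
rewrite !big_cons IH.
have -> : Complex p.2 0 - Complex t y = Complex (p.2 - t) (- y).
  by apply/eqP; rewrite eq_complex /= add0r !eqxx.
rewrite kerE; apply/eqP; rewrite eq_complex /= !mul0r subr0 addr0.
by rewrite !eqxx.
Qed.

Lemma normc_realc x : 0 <= x -> normc (Complex x 0) = x.
Proof. by move=> x0 /=; rewrite expr0n addr0 sqrtr_sqr ger0_norm. Qed.

Lemma normc_shiftV x t y : 0 < y -> normc (Complex x 0 - Complex t y)^-1 <= y^-1.
Proof.
move=> y0; rewrite normcV.
have le : y <= normc (Complex x 0 - Complex t y).
  apply: le_trans (normr_Im_le _).
  by rewrite /= add0r normrN ler_norm.
by rewrite lef_pV2 ?posrE// (lt_le_trans y0).
Qed.

(** The squared modulus of a pole is its imaginary part over y. This lets the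
    derivative of a Stieltjes transform be controlled by the transform itself. *)
Lemma normc_kernel_sqr y x t : 0 < y ->
  normc (Complex x 0 - Complex t y)^-1 ^+ 2 = kerIm y (x - t) / y.
Proof.
move=> y0; rewrite normcV /= add0r exprVn sqr_sqrtr ?addr_ge0 ?sqr_ge0//.
by rewrite sqrrN /kerIm mulrAC divff ?gt_eqF// mul1r.
Qed.

(** Write F for the transform and G for the resolvent. Since |F'| <= Im F / y and
    |G| <= 1 / (Im F + a), the factors Im F cancel in the second order remainder,
    so its bound is uniform over all positive measures. *)
Lemma resolvent_taylor s a b t y h :
  (forall p, p \in s -> 0 <= p.1) -> 0 < a -> 0 < y -> normc h <= y ->
  0 <= complex.Im h ->
  normc (resolvent s (Complex b a) (Complex t y + h)
    - resolvent s (Complex b a) (Complex t y)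
    + h * stieltjes1 s (Complex t y) * resolvent s (Complex b a) (Complex t y) ^+ 2)
  <= 5 * normc h ^+ 2 / (a * y ^+ 2).
Proof.
move=> s0 a0 y0 hy Imh; rewrite /stieltjes1.
set z := Complex t y; set c := Complex b a.
set F' := \sum_(p <- s) _; pose G w := (stieltjes s w + c)^-1.
rewrite -[resolvent s c z]/(G z) -[resolvent s c (z + h)]/(G (z + h)).
pose z1 := z + h.
have z1E : z1 = Complex (t + complex.Re h) (y + complex.Im h).
  by rewrite /z1 /z; case: (h).
have y1 : 0 < y + complex.Im h by rewrite ltr_pwDl.
(* A and A1 are the poles at z and z + h; A1 = A + h A^2 + h^2 A^2 A1. *)
pose A (p : R * R) : R[i] := (Complex p.2 0 - z)^-1.
pose A1 (p : R * R) : R[i] := (Complex p.2 0 - z1)^-1.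
have nz (p : R * R) : Complex p.2 0 - z != 0.
  by rewrite eq_complex /= add0r oppr_eq0 (gt_eqF y0) andbF.
have nz1 (p : R * R) : Complex p.2 0 - z1 != 0.
  by rewrite z1E eq_complex /= add0r oppr_eq0 (gt_eqF y1) andbF.
pose Rm := \sum_(p <- s) Complex p.1 0 * (A p ^+ 2 * A1 p).
have FE : stieltjes s z1 = stieltjes s z + h * F' + h ^+ 2 * Rm.
  rewrite /stieltjes /F' /Rm 2!mulr_sumr -!big_split /=.
  apply: eq_bigr => p _; rewrite /A /A1.
  move: (nz p) (nz1 p); rewrite /z1; set q := Complex p.2 0.
  set m := Complex p.1 0 => n1 n2; field.
  by rewrite n2 n1.
pose v := \sum_(p <- s) p.1 * kerIm y (p.2 - t).
have kI0 r : 0 <= kerIm y r.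
  by rewrite /kerIm divr_ge0 ?addr_ge0 ?sqr_ge0// ltW.
have v0 : 0 <= v by rewrite /v big_seq sumr_ge0// => p /s0 p0; rewrite mulr_ge0.
pose S := v / y.
have S0 : 0 <= S by rewrite divr_ge0// ltW.
have SE : \sum_(p <- s) p.1 * normc (A p) ^+ 2 = S.
  rewrite /S /v mulr_suml; apply: eq_bigr => p _.
  by rewrite /A normc_kernel_sqr// mulrA.
have nF' : normc F' <= S.
  rewrite -SE; apply: le_trans (normc_sum _ _) _.
  rewrite !big_seq; apply: ler_sum => p /s0 p0.
  by rewrite normcM expr2 normcM normc_realc// expr2.
have nRm : normc Rm <= S / y.
  rewrite -SE mulr_suml; apply: le_trans (normc_sum _ _) _.
  rewrite !big_seq; apply: ler_sum => p /s0 p0.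
  rewrite normcM normc_realc// -mulrA ler_wpM2l// normcM expr2 normcM -expr2.
  rewrite ler_wpM2l ?sqr_ge0//.
  rewrite /A1 z1E; apply: (le_trans (normc_shiftV _ _ y1)).
  by rewrite lef_pV2 ?posrE// lerDl.
have FzE : stieltjes s z + c
   = Complex (\sum_(p <- s) p.1 * kerRe y (p.2 - t) + b) (v + a).
  by rewrite /z stieltjesE.
have nG : normc (G z) <= (v + a)^-1.
  by rewrite /G FzE normc_res_le.
pose v1 := \sum_(p <- s) p.1 * kerIm (y + complex.Im h) (p.2 - (t + complex.Re h)).
have v10 : 0 <= v1.
  rewrite /v1 big_seq sumr_ge0// => p /s0 p0; rewrite mulr_ge0//.
  by rewrite divr_ge0 ?addr_ge0 ?sqr_ge0// ltW.
have F1E : stieltjes s z1 + c = Complex (\sum_(p <- s) p.1 *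
    kerRe (y + complex.Im h) (p.2 - (t + complex.Re h)) + b) (v1 + a).
  by rewrite z1E stieltjesE.
have nG1 : normc (G z1) <= a^-1.
  rewrite /G F1E; apply: (le_trans (normc_res_le _ a0 v10)).
  by rewrite lef_pV2 ?posrE ?ltr_wpDl// lerDr.
have va0 : 0 < v + a by rewrite ltr_wpDl.
have Gz0 : stieltjes s z + c != 0 by rewrite FzE complex_neq0_Im.
have Gz10 : stieltjes s z1 + c != 0 by rewrite F1E complex_neq0_Im// ltr_wpDl.
pose D := h * F' + h ^+ 2 * Rm.
have -> : G z1 - G z + h * F' * G z ^+ 2
    = - (h ^+ 2 * Rm * G z ^+ 2) + D ^+ 2 * (G z ^+ 2 * G z1).
  have DE : D = stieltjes s z1 - stieltjes s z by rewrite FE /D; ring.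
  have -> : h * F' = D - h ^+ 2 * Rm by rewrite /D; ring.
  rewrite DE /G; move: Gz0 Gz10; set f := stieltjes s z; set f1 := stieltjes s z1.
  by move=> n1 n2; field; rewrite n1 n2.
have nD : normc D <= 2 * normc h * S.
  rewrite /D; apply: le_trans (le_normcD _ _) _; rewrite expr2 !normcM.
  have n0 := normc_ge0 h.
  have e1 : normc h * normc F' <= normc h * S by rewrite ler_wpM2l.
  have e2 : normc h * normc h * normc Rm <= normc h * S.
    rewrite -mulrA ler_wpM2l//.
    apply: (@le_trans _ _ (y * (S / y))); first by rewrite ler_pM ?normc_ge0.
    by rewrite mulrCA divff ?gt_eqF// mulr1.
  lra.
apply: le_trans (le_normcD _ _) _; rewrite normcN !expr2 !normcM.
have nv1 : v * (v + a)^-1 <= 1 by rewrite ler_pdivrMr// mul1r lerDl ltW.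
have nva : (v + a)^-1 <= a^-1 by rewrite lef_pV2 ?posrE// lerDr.
have vi0 : 0 <= (v + a)^-1 by rewrite invr_ge0 ltW.
have ai0 : 0 <= a^-1 by rewrite invr_ge0 ltW.
have n0 := normc_ge0 h.
have nG0 := normc_ge0 (G z).
have nG10 := normc_ge0 (G z1).
have nR0 := normc_ge0 Rm.
have nD0 := normc_ge0 D.
have T1 : normc h * normc h * normc Rm * (normc (G z) * normc (G z))
   <= normc h * normc h * (y^-2 * a^-1).
  rewrite -mulrA ler_wpM2l ?mulr_ge0//.
  apply: (@le_trans _ _ (S / y * ((v + a)^-1 * (v + a)^-1))).
    by rewrite ler_pM ?mulr_ge0// ler_pM.
  have -> : S / y * ((v + a)^-1 * (v + a)^-1)
     = y^-2 * ((v * (v + a)^-1) * (v + a)^-1).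
    by rewrite /S; field; rewrite (gt_eqF va0) (gt_eqF y0).
  rewrite ler_wpM2l ?invr_ge0 ?sqr_ge0//.
  by rewrite -[leRHS]mul1r ler_pM ?mulr_ge0.
have T2 : normc D * normc D * (normc (G z) * normc (G z) * normc (G z1))
   <= 4 * (normc h * normc h) * (y^-2 * a^-1).
  apply: (@le_trans _ _ ((2 * normc h * S) * (2 * normc h * S) *
     ((v + a)^-1 * (v + a)^-1 * a^-1))).
    by apply: ler_pM; rewrite ?mulr_ge0// ler_pM ?mulr_ge0// ler_pM.
  have -> : 2 * normc h * S * (2 * normc h * S) * ((v + a)^-1 / (v + a) / a)
    = 4 * (normc h * normc h) *
      (y^-2 * a^-1 * ((v * (v + a)^-1) * (v * (v + a)^-1))).
    by rewrite /S; field; rewrite (gt_eqF va0) (gt_eqF y0) (gt_eqF a0).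
  rewrite ler_wpM2l ?mulr_ge0//.
  rewrite -[leRHS]mulr1 ler_wpM2l ?mulr_ge0 ?invr_ge0 ?sqr_ge0//.
    exact: ltW.
  by rewrite -[leRHS]mulr1 ler_pM ?mulr_ge0.
have -> : 5 * (normc h * normc h) / (a * (y * y))
   = normc h * normc h * (y^-2 * a^-1) + 4 * (normc h * normc h) * (y^-2 * a^-1).
  by field; rewrite (gt_eqF y0) (gt_eqF a0).
exact: lerD.
Qed.

Definition sumRe s t y : R := \sum_(p <- s) p.1 * kerRe y (p.2 - t).
Definition sumIm s t y : R := \sum_(p <- s) p.1 * kerIm y (p.2 - t).

(** The resolvent is analytic, so its increments along i eta and along eta differ
    by a factor i up to second order; this compares their imaginary parts. *)
Lemma resolvent_cauchy_riemann s a b y eta :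
  (forall p, p \in s -> 0 <= p.1) -> 0 < a -> 0 < y -> 0 < eta <= y ->
  `|(resIm a b (sumRe s 0 (y + eta)) (sumIm s 0 (y + eta))
      - resIm a b (sumRe s 0 y) (sumIm s 0 y)) +
    (resRe a b (sumRe s eta y) (sumIm s eta y)
      - resRe a b (sumRe s 0 y) (sumIm s 0 y))| <= 10 * eta ^+ 2 / (a * y ^+ 2).
Proof.
move=> s0 a0 y0 /andP[e0 ey].
pose c := Complex b a.
pose G w := (stieltjes s w + c)^-1.
have GE t r : G (Complex t r) =
    Complex (resRe a b (sumRe s t r) (sumIm s t r))
       (- resIm a b (sumRe s t r) (sumIm s t r)).
  by rewrite /G stieltjesE -resE.
pose z := Complex 0 y.
pose h1 : R[i] := Complex 0 eta.
pose h2 : R[i] := Complex eta 0.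
have nh1 : normc h1 = eta.
  by rewrite /= expr0n add0r sqrtr_sqr ger0_norm// ltW.
have nh2 : normc h2 = eta by rewrite normc_realc// ltW.
have T1 := @resolvent_taylor s a b 0 y h1 s0 a0 y0.
have T2 := @resolvent_taylor s a b 0 y h2 s0 a0 y0.
move: T1 T2; rewrite nh1 nh2 => /(_ ey (ltW e0)) T1 /(_ ey (lexx _)) T2.
move: T1 T2; rewrite -/c -/z; set F' := stieltjes1 _ _.
rewrite -[resolvent s c z]/(G z) -[resolvent s c (z + h1)]/(G (z + h1)).
rewrite -[resolvent s c (z + h2)]/(G (z + h2)) => T1 T2.
pose E1 := G (z + h1) - G z + h1 * F' * G z ^+ 2.
pose E2 := G (z + h2) - G z + h2 * F' * G z ^+ 2.
have z1 : z + h1 = Complex 0 (y + eta).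
  by apply/eqP; rewrite eq_complex /= addr0 !eqxx.
have z2 : z + h2 = Complex eta y.
  by apply/eqP; rewrite eq_complex /= addr0 add0r !eqxx.
pose i0 : R[i] := Complex 0 1.
have key : (G (z + h1) - G z) - i0 * (G (z + h2) - G z) = E1 - i0 * E2.
  rewrite /E1 /E2.
  have -> : h1 = i0 * h2.
    by apply/eqP; rewrite eq_complex /= !mul0r !mul1r subr0 add0r !eqxx.
  by ring.
set X := (X in `|X|).
have -> : X = - complex.Im ((G (z + h1) - G z) - i0 * (G (z + h2) - G z)).
  rewrite z1 z2 /z !GE /X /=.
  ring.
rewrite normrN key; apply: le_trans (normr_Im_le _) _.
apply: le_trans (le_normcD _ _) _; rewrite normcN normcM.
have -> : normc i0 = 1 by rewrite /= expr0n add0r expr1n sqrtr1.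
rewrite mul1r.
have -> : 10 * eta ^+ 2 / (a * y ^+ 2)
   = 5 * eta ^+ 2 / (a * y ^+ 2) + 5 * eta ^+ 2 / (a * y ^+ 2).
  by field; rewrite (gt_eqF y0) (gt_eqF a0).
exact: lerD.
Qed.

End resolvent.

(** * Vague continuity and measurability *)

Section test_functions.
Variable R : realType.
Implicit Types (mu : lfmeasure R) (f : R -> R) (B : R).

Lemma cpt_support f B : (forall x, B < `|x| -> f x = 0) ->
  compact (closure [set x | f x != 0]).
Proof.
move=> f0; apply: (@subclosed_compact _ _ `[- B, B]%classic).
- exact: closed_closure.
- exact: segment_compact.
- rewrite [X in _ `<=` X](closure_id _).1//; first apply: closureS.
  move=> x /= fx; rewrite in_itv /= -ler_norml leNgt.
  by apply: contra_neqN fx => /f0.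
exact: itv_closed.
Qed.

Lemma test_integrable mu (f : test_function R) :
  mu.-integrable setT (EFin \o f).
Proof.
pose K := closure [set x | f x != 0].
have cK : compact K by exact: test_function_compact.
have mK : measurable K by apply: closed_measurable; exact: closed_closure.
have cf : continuous f by exact: test_function_continuous.
have mf : measurable_fun setT f by exact: continuous_measurable_fun.
have -> : EFin \o f = (EFin \o f) \_ K.
  apply/funext => x /=; rewrite patchE; case: ifPn => // /negP xK.
  have [->//|fx0] := eqVneq (f x) 0.
  by exfalso; apply: xK; rewrite inE; exact: subset_closure.
apply/integrable_restrict => //; rewrite setTI.
apply: measurable_bounded_integrable => //.
- exact: lfmeasure_compact.
- exact: measurable_funTS.
- have cfK : {within K, continuous f} by exact: continuous_subspaceT.
  have /compact_bounded[M [_ mrt]] := continuous_compact cfK cK.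
  by exists M; split; rewrite ?num_real // => ? ? ? ?; exact: mrt.
Qed.

Lemma test_integral_continuous (f : test_function R) :
  continuous (fun mu : lfmeasure R => \int[mu]_x f x).
Proof.
have -> : (fun mu : lfmeasure R => \int[mu]_x f x) =
  (fun g : {ptws test_function R -> R} => g f) \o (@test_integral R).
  by [].
move=> mu; apply: continuous_comp.
  exact: (@initial_continuous _ _ (@test_integral R)).
pose I : eqType := HB.pack (test_function R) (gen_eqMixin (test_function R)).
exact: (@proj_continuous I (fun _ => R) f).
Qed.

Lemma continuous_lf_measurable (F : lfmeasure R -> R) : continuous F ->
  measurable_fun setT F.
Proof.
move=> /continuousP cF.
apply: (measurability _ (RGenOpens.measurableE R)).
move=> _ [_ [a [b ->] <-]]; rewrite setTI.
by apply: sub_sigma_algebra; apply: cF; exact: interval_open.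
Qed.

Lemma test_integral_measurable (f : test_function R) :
  measurable_fun setT (fun mu : lfmeasure R => \int[mu]_x f x).
Proof. by apply: continuous_lf_measurable; exact: test_integral_continuous. Qed.

(** Dominated convergence extends measurability in the measure from continuous
    test functions to their bounded limits, such as indicators of intervals. *)
Lemma integral_cvg_measurable (f : (R -> R)^nat) (g : R -> R) B :
  (forall n, continuous (f n)) -> (forall n x, B < `|x| -> f n x = 0) ->
  (forall n x, `|f n x| <= 1) -> (forall x, f n x @[n --> \oo] --> g x) ->
  measurable_fun setT (fun mu : lfmeasure R => \int[mu]_x g x).
Proof.
move=> cf fB f1 fg.
pose tf n := TestFunction (cf n) (cpt_support (fB n)).
apply: (@measurable_fun_cvg _ _ _ _ (fun n (mu : lfmeasure R) => \int[mu]_x tf n x)).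
  by move=> n; exact: test_integral_measurable.
move=> mu _.
have mI : measurable (`[- B, B]%classic : set R) by [].
have mf n : measurable_fun setT (EFin \o f n).
  by apply/measurable_EFinP; exact: continuous_measurable_fun.
have [] := @dominated_convergence _ (measurableTypeR R) R mu setT measurableT
  (fun n => EFin \o f n) (EFin \o g) (EFin \o (\1_(`[- B, B]%classic : set R))).
- by [].
- apply/measurable_EFinP; apply: (@measurable_fun_cvg _ _ _ _ f).
    by move=> n; exact: continuous_measurable_fun.
  by move=> x _; exact: fg.
- by apply/aeW => x _; apply: cvg_EFin; [exact: nearW|exact: fg].
- apply/integrableP; split; first exact/measurable_EFinP.
  under eq_integral do rewrite /= ger0_norm//.
  rewrite integral_indic// setIT.
  exact/lfmeasure_compact/segment_compact.
- apply/aeW => x n _ /=; rewrite lee_fin indicE.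
  have [xB|xB] := lerP `|x| B; last by rewrite fB// normr0.
  by rewrite mem_set ?f1//= in_itv/= -ler_norml.
- move=> ig _ cg.
  rewrite /Rintegral; apply: fine_cvg; rewrite fineK//.
  exact: integrable_fin_num.
Qed.

End test_functions.

Section clamp.
Variable R : realType.
Implicit Types (t : R) (f : R -> R).

Definition clamp t : R := Num.max 0 (Num.min 1 t).

Lemma clamp_ge0 t : 0 <= clamp t.
Proof. by rewrite /clamp le_max lexx. Qed.

Lemma clamp_le1 t : clamp t <= 1.
Proof. by rewrite /clamp ge_max ler01 ge_min lexx. Qed.

Lemma clamp0 t : t <= 0 -> clamp t = 0.
Proof.
by move=> t0; apply/max_idPl; rewrite ge_min t0 orbT.
Qed.

Lemma clamp1 t : 1 <= t -> clamp t = 1.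
Proof. by move=> t1; rewrite /clamp min_l// max_r. Qed.

Lemma clampE t : 0 <= t <= 1 -> clamp t = t.
Proof. by move=> /andP[t0 t1]; rewrite /clamp min_r// max_r. Qed.

Lemma continuous_clamp f : continuous f -> continuous (fun x => clamp (f x)).
Proof.
move=> cf x.
apply: (@continuous_max _ _ (cst 0) (fun x => Num.min 1 (f x)) x).
  exact: cst_continuous.
apply: (@continuous_min _ _ (cst 1) f x); last exact: cf.
exact: cst_continuous.
Qed.

(** The Boolean selects between the strict and the weak inequality, so that open
    and closed ends of intervals are both limits of continuous ramps. *)
Lemma cvg_clamp (c : bool) t :
  clamp (n%:R * t + c%:R) @[n --> \oo] --> (((0 < t ?<= if c)%R)%:R : R).
Proof.
apply/cvgrPdist_lt => e e0; near=> n.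
have [t0|t0|<-] := ltrgtP 0 t.
- have -> : (0 < t ?<= if c)%R by apply: lteifS.
  rewrite clamp1 ?subrr ?normr0// -lerBlDr.
  have tn : t^-1 <= n%:R by near: n; exact: nbhs_infty_ger.
  apply: (@le_trans _ _ 1); first by rewrite gerBl ler0n.
  by rewrite -ler_pdivrMr// mul1r.
- have -> : (0 < t ?<= if c)%R = false.
    by case: (c) => /=; apply/negbTE; rewrite -?ltNge -?leNgt// ltW.
  rewrite clamp0 ?subrr ?normr0//.
  have tn : (- t)^-1 <= n%:R by near: n; exact: nbhs_infty_ger.
  have : 1 <= n%:R * (- t) by rewrite -ler_pdivrMr ?oppr_gt0// mul1r.
  have : c%:R <= 1 :> R by case: (c); rewrite /= ?lexx ?ler01.
  by rewrite mulrN; lra.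
- rewrite mulr0 add0r; case: (c) => /=; rewrite ?ltxx ?lexx/=.
    by rewrite clamp1// subrr normr0.
  by rewrite clamp0// subrr normr0.
Unshelve. all: by end_near. Qed.

End clamp.

Section masses.
Variable R : realType.
Implicit Types (mu : lfmeasure R).

Lemma lf_itv_lty mu (i j : bool) (a b : R) :
  (mu [set` Interval (BSide i a) (BSide j b)] < +oo)%E.
Proof.
apply: (@le_lt_trans _ _ (mu `[a, b]%classic)).
  apply: le_measure; rewrite ?inE//.
  apply: subset_itvScc => /=; by rewrite bnd_simp.
exact/lfmeasure_compact/segment_compact.
Qed.

Lemma lf_itv_fin mu (i j : bool) (a b : R) :
  (mu [set` Interval (BSide i a) (BSide j b)] \is a fin_num)%E.
Proof. by rewrite ge0_fin_numE// lf_itv_lty. Qed.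

(** The indicator of an interval is a limit of products of two ramps, one per end. *)
Lemma itv_mass_measurable (i j : bool) (a b : R) :
  measurable_fun setT
    (fun mu : lfmeasure R => fine (mu [set` Interval (BSide i a) (BSide j b)])).
Proof.
pose I : set R := [set` Interval (BSide i a) (BSide j b)].
have -> : (fun mu : lfmeasure R => fine (mu I)) =
    (fun mu : lfmeasure R => \int[mu]_x \1_I x).
  by apply/funext => mu; rewrite /Rintegral integral_indic ?setIT//; exact: measurable_itv.
pose f n x := clamp (n%:R * (x - a) + i%:R) * clamp (n%:R * (b - x) + (~~ j)%:R).
apply: (@integral_cvg_measurable _ (fun n => f n.+1) (\1_I) (`|a| + `|b| + 1)).
- move=> n x; apply: cvgM.
    apply: (@continuous_clamp _ (fun x => n.+1%:R * (x - a) + i%:R)) => {}x.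
    apply: cvgD; last exact: cvg_cst.
    apply: cvgM; first exact: cvg_cst.
    by apply: cvgB; [exact: cvg_id|exact: cvg_cst].
  apply: (@continuous_clamp _ (fun x => n.+1%:R * (b - x) + (~~ j)%:R)) => {}x.
  apply: cvgD; last exact: cvg_cst.
  apply: cvgM; first exact: cvg_cst.
  by apply: cvgB; [exact: cvg_cst|exact: cvg_id].
- move=> n x xB; rewrite /f.
  have n1 : 1 <= n.+1%:R :> R by rewrite ler1n.
  have iN (c : bool) : c%:R <= 1 :> R by case: c; rewrite /= ?lexx ?ler01.
  have [x0|x0] := leP 0 x.
    rewrite [X in _ * X]clamp0 ?mulr0//.
    rewrite (ger0_norm x0) in xB.
    have xb : 1 <= x - b by have := ler_norm b; have := normr_ge0 a; lra.
    have : 1 <= n.+1%:R * (x - b) by rewrite -[leLHS]mulr1 ler_pM.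
    by have := iN (~~ j); rewrite -[b - x]opprB mulrN; lra.
  rewrite [X in X * _]clamp0 ?mul0r//.
  rewrite (ltr0_norm x0) in xB.
  have xb : 1 <= a - x by have := ler_norm (- a); rewrite normrN; have := normr_ge0 b; lra.
  have : 1 <= n.+1%:R * (a - x) by rewrite -[leLHS]mulr1 ler_pM.
  by have := iN i; rewrite -[x - a]opprB mulrN; lra.
- move=> n x; rewrite ger0_norm ?mulr_ge0 ?clamp_ge0//.
  by rewrite -[leRHS]mulr1 ler_pM ?clamp_ge0 ?clamp_le1.
- move=> x; rewrite (cvg_shiftS (fun n => f n x)).
  have -> : \1_I x = ((0 < (x - a)%R ?<= if i)%R)%:R * ((0 < b - x ?<= if ~~ j)%R)%:R :> R.
    rewrite indicE -natrM mulnb; congr (_%:R : R); congr nat_of_bool.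
    rewrite mem_setE /I itv_boundlr /= /Order.le /=.
    by rewrite !lteifBrDl !addr0.
  by apply: cvgM; exact: cvg_clamp.
Qed.

Lemma lf_mass_measurable (i j : bool) (a b : R) :
  measurable_fun setT
    (fun mu : lfmeasure R => mu [set` Interval (BSide i a) (BSide j b)]).
Proof.
have -> : (fun mu : lfmeasure R => mu [set` Interval (BSide i a) (BSide j b)]) =
   EFin \o (fun mu : lfmeasure R => fine (mu [set` Interval (BSide i a) (BSide j b)])).
  by apply/funext => mu /=; rewrite fineK// lf_itv_fin.
by apply/measurable_EFinP; exact: itv_mass_measurable.
Qed.

End masses.

Section atoms.
Import finmap.
Variable R : realType.
Implicit Types (mu : lfmeasure R) (B : R) (s : seq (R * R)).

(** Inside the window [-B, B] a locally finite point measure is a finite list of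
    (mass, position) pairs, and integrals over the window become finite sums. *)
Definition atoms mu B s : Prop :=
  (forall p, p \in s -> 0 <= p.1 /\ `|p.2| <= B) /\
  forall D : set R, measurable D -> D `<=` `[- B, B] ->
    mu D = (\sum_(p <- s) p.1 * \1_D p.2)%:E.

Lemma point_measure_atoms mu B : is_weighted_point_measure mu ->
  exists s, atoms mu B s.
Proof.
move=> [X [w [finX w0 muE]]].
have fX : finite_set (X `&` `[- B, B]) by apply: finX; exact: segment_compact.
have [F FE] := finite_fsetP.1 fX.
have FP x : x \in F -> X x /\ `|x| <= B.
  move=> xF; have : (X `&` `[- B, B]) x by rewrite FE.
  by move=> [Xx]; rewrite /= in_itv/= -ler_norml.
exists [seq (w x, x) | x <- (F : seq R)]; split.
  by move=> p /mapP[x xF ->] /=; have [/w0/ltW] := FP _ xF.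
move=> D mD DB; rewrite muE// big_map; pose I : set R := `[- B, B]%classic.
rewrite (@esum_mkcond _ _ X) (_ : (\esum_(i in setT) _)%E =
   (\esum_(i in setT) (if i \in X `&` I then (w i)%:E * \d_i D else 0))%E);
   last first.
  apply: eq_esum => x _; rewrite in_setI.
  case: (boolP (x \in X)) => //= xX.
  case: ifPn => // /negP xB; rewrite diracE memNset ?mule0//.
  by move=> /DB xB'; apply: xB; exact/mem_set.
rewrite -esum_mkcond esum_fset; [|exact: fX|]; last first.
  by move=> x /set_mem [/w0/ltW wx _]; rewrite mule_ge0.
rewrite /I FE fsbig_finite//= set_fsetK -sumEFin.
by apply: eq_bigr => x _; rewrite diracE EFinM indicE.
Qed.

Lemma atoms_ge0_integral mu B s (D : set R) (f : R -> \bar R) :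
  atoms mu B s -> measurable D -> D `<=` `[- B, B] ->
  measurable_fun D f -> (forall x, D x -> 0 <= f x)%E ->
  (\int[mu]_(x in D) f x = \sum_(p <- s) (p.1 * \1_D p.2)%:E * f p.2)%E.
Proof.
move=> [s0 smu] mD DB mf f0.
pose w i : {nonneg R} := NngNum (normr_ge0 (nth (0, 0) s i).1).
have wE i : (i < size s)%N -> (w i)%:num = (nth (0, 0) s i).1.
  by move=> ls; rewrite /w/= ger0_norm//; have [] := s0 _ (mem_nth (0, 0) ls).
pose m i : {measure set (measurableTypeR R) -> \bar R} :=
  mscale (w i) (\d_((nth (0, 0) s i).2 : measurableTypeR R)).
have mE (i : 'I_(size s)) (A : set R) :
    m i A = ((nth (0, 0) s i).1 * \1_A (nth (0, 0) s i).2)%:E.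
  by rewrite EFinM -wE.
rewrite (@eq_measure_integral _ (measurableTypeR R) _ D (msum m (size s))); last first.
  move=> A mA AD; rewrite smu//; last exact: subset_trans DB.
  rewrite (big_nth (0, 0)) big_mkord /msum/= -sumEFin.
  by apply: eq_bigr => i _; rewrite mE.
rewrite ge0_integral_measure_sum// (big_nth (0, 0)) big_mkord.
apply: eq_bigr => i _; rewrite /m ge0_integral_mscale// integral_dirac//.
by rewrite muleA; congr (_ * _)%E; exact: mE.
Qed.

Lemma atoms_Rintegral mu B s (D : set R) (f : R -> R) :
  atoms mu B s -> measurable D -> D `<=` `[- B, B] -> measurable_fun D f ->
  \int[mu]_(x in D) f x = \sum_(p <- s) p.1 * \1_D p.2 * f p.2.
Proof.
move=> smu mD DB mf.
have mf' : measurable_fun D (EFin \o f) by exact/measurable_EFinP.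
have -> : \int[mu]_(x in D) f x =
    fine (\int[mu]_(x in D) (EFin \o f)^\+%E x -
          \int[mu]_(x in D) (EFin \o f)^\-%E x)%E.
  by rewrite /Rintegral -integralE.
rewrite !(atoms_ge0_integral smu)//; last 2 first.
- exact: measurable_funeneg.
- exact: measurable_funepos.
rewrite funerpos funerneg /=.
under eq_bigr do rewrite -EFinM.
under [X in (_ - X)%E]eq_bigr do rewrite -EFinM.
rewrite !sumEFin/= -sumrB; apply: eq_bigr => p _.
rewrite -mulrBr; congr (_ * _).
by rewrite -[in RHS](funrposBneg f).
Qed.

Lemma atoms_Rintegral_support mu B s (f : R -> R) :
  atoms mu B s -> measurable_fun setT f -> (forall x, B < `|x| -> f x = 0) ->
  \int[mu]_x f x = \sum_(p <- s) p.1 * f p.2.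
Proof.
move=> smu mf fB.
have -> : \int[mu]_x f x = \int[mu]_(x in `[- B, B]) f x.
  rewrite [RHS]Rintegral_mkcond; apply: eq_Rintegral => x _.
  rewrite patchE; case: ifPn => // /negP xB; apply: fB.
  by rewrite ltNge; apply/negP => xB'; apply: xB; apply: mem_set; rewrite /= in_itv/= -ler_norml.
rewrite (atoms_Rintegral smu)//; last exact: measurable_funTS.
rewrite !big_seq; apply: eq_bigr => p /(proj1 smu)[_ pB].
by rewrite indicE mem_set ?mulr1//= in_itv/= -ler_norml.
Qed.

End atoms.

(** * Cutoffs and integration by parts *)

Section cutoffs.
Variable R : realType.
Implicit Types (L x y r : R).

Lemma clamp_lipschitz x y : `|clamp x - clamp y| <= `|x - y|.
Proof.
wlog xy : x y / x <= y.
  move=> H; have [/H//|/ltW/H] := leP x y.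
  by rewrite distrC (distrC y).
rewrite (distrC x) (ger0_norm (_ : 0 <= y - x)) ?subr_ge0//.
have le : clamp x <= clamp y.
  have [x0|x0] := leP x 0; first by rewrite (clamp0 x0) clamp_ge0.
  have [y1|y1] := leP 1 y; first by rewrite (clamp1 y1) clamp_le1.
  rewrite !clampE//; first by rewrite (le_trans (ltW x0))//= ltW.
  by rewrite (ltW x0)/= ltW// (le_lt_trans xy).
rewrite distrC ger0_norm ?subr_ge0//.
have [y0|y0] := leP y 0; first by rewrite !clamp0 ?subrr ?subr_ge0// (le_trans xy).
have [x1|x1] := leP 1 x; first by rewrite !clamp1 ?subrr ?subr_ge0// (le_trans x1).
have yc : clamp y <= y by rewrite /clamp ge_max (ltW y0) ge_min lexx orbT.
have xc : x <= clamp x by rewrite /clamp le_max le_min lexx (ltW x1) orbT.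
lra.
Qed.

(** Quadratic, not linear, on L <= |x| <= 2 L: the slope is then continuous up to
    2 L, which is where the integrations by parts stop. *)
Definition cutoff L x : R := 1 - clamp (`|x| / L - 1) ^+ 2.

Lemma cutoff_ge0 L x : 0 <= cutoff L x.
Proof. by rewrite subr_ge0 expr_le1// ?clamp_ge0 ?clamp_le1. Qed.

Lemma cutoff_le1 L x : cutoff L x <= 1.
Proof. by rewrite gerBl sqr_ge0. Qed.

Lemma cutoff1 L x : 0 < L -> `|x| <= L -> cutoff L x = 1.
Proof.
move=> L0 xL; rewrite /cutoff clamp0 ?expr0n ?subr0//.
by rewrite subr_le0 ler_pdivrMr// mul1r.
Qed.

Lemma cutoff0 L x : 0 < L -> 2 * L <= `|x| -> cutoff L x = 0.
Proof.
move=> L0 xL; rewrite /cutoff clamp1 ?expr1n ?subrr//.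
by rewrite lerBrDr ler_pdivlMr// (le_trans _ xL)//; lra.
Qed.

Lemma cutoffN L x : cutoff L (- x) = cutoff L x.
Proof. by rewrite /cutoff normrN. Qed.

Lemma cutoff_mid L x : 0 < L -> L <= x <= 2 * L -> cutoff L x = 1 - (x / L - 1) ^+ 2.
Proof.
move=> L0 /andP[Lx x2L].
have x0 : 0 <= x by rewrite (le_trans _ Lx)// ltW.
rewrite /cutoff ger0_norm// clampE// subr_ge0 lerBlDr ler_pdivlMr// mul1r Lx/=.
by rewrite ler_pdivrMr// (le_trans x2L)//; lra.
Qed.

Lemma cutoff_lipschitz L x y : 0 < L -> `|cutoff L x - cutoff L y| <= 2 / L * `|x - y|.
Proof.
move=> L0; rewrite /cutoff.
have -> : 1 - clamp (`|x| / L - 1) ^+ 2 - (1 - clamp (`|y| / L - 1) ^+ 2) =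
  (clamp (`|y| / L - 1) + clamp (`|x| / L - 1)) *
  (clamp (`|y| / L - 1) - clamp (`|x| / L - 1)) by ring.
rewrite normrM -mulrA.
have h1 : `|clamp (`|y| / L - 1) + clamp (`|x| / L - 1)| <= 2.
  rewrite ger0_norm ?addr_ge0 ?clamp_ge0//.
  by have := clamp_le1 (`|y| / L - 1); have := clamp_le1 (`|x| / L - 1); lra.
have h2 : `|clamp (`|y| / L - 1) - clamp (`|x| / L - 1)| <= L^-1 * `|x - y|.
  apply: (le_trans (clamp_lipschitz _ _)).
  have -> : `|y| / L - 1 - (`|x| / L - 1) = L^-1 * (`|y| - `|x|) by ring.
  rewrite normrM ger0_norm ?invr_ge0 ?(ltW L0)// ler_wpM2l ?invr_ge0 ?(ltW L0)//.
  by rewrite (distrC x); exact: ler_dist_dist.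
exact: ler_pM.
Qed.

Lemma continuous_cutoff L : continuous (cutoff L).
Proof.
move=> x; apply: cvgB; first exact: cvg_cst.
have c : continuous (fun x => clamp (`|x| / L - 1)).
  apply: continuous_clamp => {}x; apply: cvgB; last exact: cvg_cst.
  by apply: cvgM; [exact: norm_continuous|exact: cvg_cst].
exact: (cvgM (c x) (c x)).
Qed.

End cutoffs.

Section calculus.
Variable R : realType.
Notation leb := (@lebesgue_measure R).
Implicit Types (L x y r Y : R).

Lemma FTC_closed_itv (f df : R -> R) (a b : R) : a <= b ->
  (forall x, a <= x <= b -> is_derive x 1 f (df x)) ->
  (forall x, a <= x <= b -> {for x, continuous df}) ->
  \int[leb]_(x in `[a, b]) df x = f b - f a.
Proof.
rewrite le_eqVlt => /predU1P[->|ab] fd cdf.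
  by rewrite set_itv1 Rintegral_set1 subrr.
have cf x : a <= x <= b -> {for x, continuous f}.
  move=> xab; apply: differentiable_continuous; apply/derivable1_diffP.
  by have [] := fd _ xab.
rewrite /Rintegral (continuous_FTC2 (F := f))//.
- apply: continuous_in_subspaceT => x; rewrite inE/= in_itv/=; exact: cdf.
- split.
  + move=> x; rewrite in_itv/= => /andP[ax xb].
    by have [] := fd x; rewrite ?(ltW ax) ?(ltW xb).
  + apply: cvg_at_right_filter; apply: cf; by rewrite lexx ltW.
  + apply: cvg_at_left_filter; apply: cf; by rewrite lexx ltW.
- move=> x; rewrite in_itv/= => /andP[ax xb].
  have xab : a <= x <= b by rewrite !ltW.
  by rewrite derive1E; have [_ ->] := fd _ xab.
Qed.

End calculus.

Section cutoff_primitive.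
Variable R : realType.
Notation leb := (@lebesgue_measure R).
Implicit Types (L x y r Y : R) (g dg f : R -> R).

Lemma continuous_itv_integrable f (a b : R) : continuous f ->
  leb.-integrable `[a, b] (EFin \o f).
Proof.
move=> cf; apply: continuous_compact_integrable; first exact: segment_compact.
exact: continuous_subspaceT.
Qed.

Lemma measurable_bool_ind (h : R -> bool) : measurable_fun setT h ->
  measurable_fun setT (fun r => (h r)%:R : R).
Proof.
move=> mh; have -> : (fun r => (h r)%:R : R) = \1_(h @^-1` [set true]).
  apply/funext => r; rewrite indicE; congr (nat_of_bool _)%:R.
  by case hr: (h r); [rewrite mem_set|rewrite memNset//= hr].
by apply: measurable_indic; rewrite -[X in measurable X]setTI; exact: mh.
Qed.

Lemma bounded_ind_integrable f (h : R -> bool) (a b : R) :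
  leb.-integrable `[a, b] (EFin \o f) -> measurable_fun setT h ->
  leb.-integrable `[a, b] (EFin \o (fun r => f r * (h r)%:R)).
Proof.
move=> fi mh; have mh' := measurable_bool_ind mh.
have mf : measurable_fun `[a, b] f.
  by apply/measurable_EFinP; case/integrableP : fi.
apply: (le_integrable _ _ _ fi) => //.
  by apply/measurable_EFinP; apply: measurable_funM => //; exact: measurable_funTS.
move=> r _ /=; rewrite lee_fin normrM; case: (h r) => /=; rewrite ?normr1 ?mulr1//.
by rewrite normr0 mulr0.
Qed.

(** Minus the derivative of the cutoff on [0, 2 L]. *)
Definition cutoff_slope L r : R := 2 * clamp (r / L - 1) / L.

(** Minus the derivative of [cutoff L * g] on [0, 2 L]. *)
Definition cutoff_phi L g dg r : R := cutoff_slope L r * g r - cutoff L r * dg r.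

Lemma continuous_cutoff_slope L : continuous (cutoff_slope L).
Proof.
move=> x; apply: cvgM; last exact: cvg_cst.
apply: cvgM; first exact: cvg_cst.
apply: (@continuous_clamp _ (fun r => r / L - 1)) => {}x.
apply: cvgB; last exact: cvg_cst.
by apply: cvgM; [exact: cvg_id|exact: cvg_cst].
Qed.

Lemma is_derive_continuous g dg : (forall x, is_derive x 1 g (dg x)) ->
  continuous g.
Proof.
move=> gd x; apply: differentiable_continuous; apply/derivable1_diffP.
by have [] := gd x.
Qed.

Lemma continuous_cutoff_phi L g dg : (forall x, is_derive x 1 g (dg x)) ->
  continuous dg -> continuous (cutoff_phi L g dg).
Proof.
move=> gd cdg x; apply: cvgB; apply: cvgM.
- exact: continuous_cutoff_slope.
- exact: (is_derive_continuous gd).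
- exact: continuous_cutoff.
- exact: cdg.
Qed.

Lemma cutoff_primitive_hi L g dg y : 0 < L -> (forall x, is_derive x 1 g (dg x)) ->
  continuous dg -> L <= y <= 2 * L ->
  \int[leb]_(r in `[y, 2 * L]) cutoff_phi L g dg r = cutoff L y * g y.
Proof.
move=> L0 gd cdg /andP[Ly y2L].
pose F x := - ((1 - (x / L - 1) ^+ 2) * g x).
pose dF x := 2 * (x / L - 1) / L * g x - (1 - (x / L - 1) ^+ 2) * dg x.
have dFP x : is_derive x 1 F (dF x).
  have gx := gd x.
  apply: is_derive_eq.
  rewrite /dF /GRing.scale/=.
  by ring.
have cg := is_derive_continuous gd.
have cdF : continuous dF.
  move=> x; rewrite /dF; apply: cvgB; apply: cvgM.
  - apply: cvgM; last exact: cvg_cst.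
    apply: cvgM; first exact: cvg_cst.
    apply: cvgB; last exact: cvg_cst.
    by apply: cvgM; [exact: cvg_id|exact: cvg_cst].
  - exact: cg.
  - apply: cvgB; first exact: cvg_cst.
    have c : (x0 / L - 1) @[x0 --> x] --> x / L - 1.
      apply: cvgB; last exact: cvg_cst.
      by apply: cvgM; [exact: cvg_id|exact: cvg_cst].
    exact: (cvgM c c).
  - exact: cdg.
transitivity (\int[leb]_(r in `[y, 2 * L]) dF r).
  apply: eq_Rintegral => r; rewrite inE/= in_itv/= => /andP[yr r2L].
  have Lr : L <= r by exact: le_trans yr.
  rewrite /cutoff_phi /dF cutoff_mid ?Lr// /cutoff_slope clampE//.
  by rewrite subr_ge0 lerBlDr ler_pdivlMr// mul1r Lr/= ler_pdivrMr// (le_trans r2L)//; lra.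
rewrite (FTC_closed_itv (f := F))//; last by move=> ? _; exact: cdF.
rewrite /F cutoff_mid ?Ly//.
by field; rewrite gt_eqF.
Qed.

Lemma cutoff_primitive_lo L g dg y : 0 < L -> (forall x, is_derive x 1 g (dg x)) ->
  continuous dg -> 0 <= y <= L ->
  \int[leb]_(r in `[y, L]) cutoff_phi L g dg r = g y - g L.
Proof.
move=> L0 gd cdg /andP[y0 yL].
transitivity (\int[leb]_(r in `[y, L]) (- dg r)).
  apply: eq_Rintegral => r; rewrite inE/= in_itv/= => /andP[yr rL].
  have r0 : 0 <= r by exact: le_trans yr.
  rewrite /cutoff_phi cutoff1 ?ger0_norm// /cutoff_slope clamp0.
    by rewrite mulr0 !mul0r add0r mul1r.
  by rewrite subr_le0 ler_pdivrMr// mul1r.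
rewrite (FTC_closed_itv (f := - g))//; first by rewrite opprK addrC.
by move=> x _; apply: cvgN; exact: cdg.
Qed.

Lemma cutoff_primitive L g dg y : 0 < L -> (forall x, is_derive x 1 g (dg x)) ->
  continuous dg -> 0 <= y <= 2 * L ->
  \int[leb]_(r in `[y, 2 * L]) cutoff_phi L g dg r = cutoff L y * g y.
Proof.
move=> L0 gd cdg /andP[y0 y2L].
have [Ly|yL] := leP L y; first by apply: cutoff_primitive_hi; rewrite ?Ly.
have cphi : continuous (cutoff_phi L g dg) by exact: continuous_cutoff_phi.
have L2L : L <= 2 * L by lra.
have := @Rintegral_itvB _ (cutoff_phi L g dg) (BLeft y) (BRight (2 * L)) L.
move=> /(_ (continuous_itv_integrable _ _ cphi)); rewrite !bnd_simp.
move=> /(_ (ltW yL) L2L) /eqP; rewrite subr_eq => /eqP ->.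
rewrite cutoff_primitive_lo// ?y0 ?ltW// Rintegral_itv_obnd_cbnd; last first.
  apply: integrableS (continuous_itv_integrable L (2 * L) cphi) => //.
  by apply: subset_itvr; rewrite bnd_simp.
rewrite cutoff_primitive_hi ?lexx// !cutoff1 ?ger0_norm ?(ltW L0)// ?(ltW yL)//.
by rewrite !mul1r addrC subrK.
Qed.

(** Summed over atoms at y, this turns sums of [cutoff L * g] into integrals against
    the counting function; [c] tells whether an atom at distance r belongs to the
    interval of radius r. *)
Lemma cutoff_primitive_ind L g dg (c : bool) y : 0 < L ->
  (forall x, is_derive x 1 g (dg x)) -> continuous dg -> 0 <= y ->
  \int[leb]_(r in `[0, 2 * L]) (cutoff_phi L g dg r * ((y < r ?<= if c)%R)%:R)
  = cutoff L y * g y.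
Proof.
move=> L0 gd cdg y0.
have cphi : continuous (cutoff_phi L g dg) by exact: continuous_cutoff_phi.
transitivity (\int[leb]_(r in [set` Interval (BSide c y) (BRight (2 * L))])
    cutoff_phi L g dg r).
  rewrite [LHS]Rintegral_mkcond [RHS]Rintegral_mkcond; apply: eq_Rintegral => r _.
  rewrite !patchE !mem_setE !itv_boundlr /= /Order.le /= .
  have [r0|r0] /= := leP 0 r; last first.
    case: ifPn => // /andP[h _]; exfalso; move: h.
    by case: (c) => /=; lra.
  rewrite andbC; case: (r <= 2 * L) => //=.
  by case: (y < r ?<= if c); rewrite ?mulr1 ?mulr0.
have [y2L|y2L] := leP y (2 * L); last first.
  rewrite cutoff0 ?mul0r//; last by rewrite ger0_norm// ltW.
  suff -> : [set` Interval (BSide c y) (BRight (2 * L))] = set0.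
    by rewrite Rintegral_set0.
  apply/seteqP; split => r //=.
  by case: (c); rewrite in_itv/= => /andP[? ?]; lra.
rewrite -(cutoff_primitive L0 gd cdg) ?y0//; case: (c) => //.
rewrite Rintegral_itv_obnd_cbnd//.
apply: integrableS (continuous_itv_integrable y (2 * L) cphi) => //.
by apply: subset_itvr; rewrite bnd_simp.
Qed.

End cutoff_primitive.

Section parts.
Variable R : realType.
Notation leb := (@lebesgue_measure R).
Implicit Types (mu : lfmeasure R) (L x y r Y B : R) (g dg f : R -> R)
  (s : seq (R * R)).

Lemma sum_ind_integral s f (ind : R -> R -> bool) (a b : R) :
  leb.-integrable `[a, b] (EFin \o f) ->
  (forall x, measurable_fun setT (ind x)) ->
  leb.-integrable `[a, b]
    (EFin \o (fun r => f r * \sum_(p <- s) p.1 * (ind p.2 r)%:R)) /\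
  \int[leb]_(r in `[a, b]) (f r * \sum_(p <- s) p.1 * (ind p.2 r)%:R) =
  \sum_(p <- s) p.1 * \int[leb]_(r in `[a, b]) (f r * (ind p.2 r)%:R).
Proof.
move=> cf mind; elim: s => [|p s [IH1 IH2]].
  have z : (fun r => f r * \sum_(p <- [::]) p.1 * (ind p.2 r)%:R) = cst 0.
    by apply/funext => r; rewrite big_nil mulr0.
  by rewrite z big_nil; split; [exact: integrable0|rewrite Rintegral_cst// mul0r].
have pE : (fun r => f r * \sum_(q <- p :: s) q.1 * (ind q.2 r)%:R) =
    (fun r => p.1 * (f r * (ind p.2 r)%:R) +
      f r * \sum_(q <- s) q.1 * (ind q.2 r)%:R).
  by apply/funext => r; rewrite big_cons mulrDr mulrCA.
have i0 := bounded_ind_integrable cf (mind p.2).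
have i1 : leb.-integrable `[a, b] (EFin \o (fun r => p.1 * (f r * (ind p.2 r)%:R))).
  by apply: eq_integrable (integrableZl _ p.1 i0) => //.
rewrite pE; split.
  by apply: eq_integrable (integrableD _ i1 IH1) => //.
by rewrite RintegralD// IH2 RintegralZl// big_cons.
Qed.

Definition mass_pos mu r : R := fine (mu `]0, r]%classic).
Definition mass_neg mu r : R := fine (mu `](- r), 0]%classic).

Lemma mass_pos_atoms mu B s r : atoms mu B s -> r <= B ->
  mass_pos mu r = \sum_(p <- s) p.1 * ((0 < p.2) && (p.2 <= r))%:R.
Proof.
move=> [_ smu] rB; rewrite /mass_pos smu//=.
  apply: eq_bigr => p _; rewrite indicE; congr (_ * (nat_of_bool _)%:R).
  by rewrite mem_setE in_itv.
move=> x /=; rewrite !in_itv/= => /andP[x0 xr]; apply/andP; split; lra.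
Qed.

Lemma mass_neg_atoms mu B s r : atoms mu B s -> r <= B ->
  mass_neg mu r = \sum_(p <- s) p.1 * ((- p.2 < r) && (p.2 <= 0))%:R.
Proof.
move=> [_ smu] rB; rewrite /mass_neg smu//=.
  apply: eq_bigr => p _; rewrite indicE; congr (_ * (nat_of_bool _)%:R).
  by rewrite mem_setE in_itv/= ltrNl.
move=> x /=; rewrite !in_itv/= => /andP[x0 xr]; apply/andP; split; lra.
Qed.

Lemma measurable_ind_pos x :
  measurable_fun setT (fun r : R => (0 < x) && (x <= r)).
Proof.
apply: measurable_and; first exact: measurable_cst.
exact: measurable_fun_ler.
Qed.

Lemma measurable_ind_neg x :
  measurable_fun setT (fun r : R => (- x < r) && (x <= 0)).
Proof.
apply: measurable_and; last exact: measurable_cst.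
exact: measurable_fun_ltr.
Qed.

(** Integration by parts: [cutoff_primitive_ind] summed over the atoms expresses the
    integral of [cutoff L * g] through the masses of ]0, r] and ]-r, 0]. The parity
    sign [e] of [g] combines the two half-lines, and the linear profile K r is
    subtracted on each of them. *)
Lemma cutoff_parts mu L g dg (e K : R) : is_weighted_point_measure mu ->
  0 < L -> (forall x, is_derive x 1 g (dg x)) -> continuous dg ->
  (forall x, g (- x) = e * g x) ->
  let N r := (mass_pos mu r - K * r) + e * (mass_neg mu r - K * r) in
  leb.-integrable `[0, 2 * L] (EFin \o (fun r => cutoff_phi L g dg r * N r)) /\
  \int[mu]_x (cutoff L x * g x)
    - (1 + e) * K * \int[leb]_(r in `[0, 2 * L]) (cutoff_phi L g dg r * r) =
  \int[leb]_(r in `[0, 2 * L]) (cutoff_phi L g dg r * N r).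
Proof.
move=> wmu L0 gd cdg gN N.
have [s smu] := point_measure_atoms (2 * L) wmu.
pose phi := cutoff_phi L g dg.
have cphi : continuous phi by exact: continuous_cutoff_phi.
have cg := is_derive_continuous gd.
have iphi := continuous_itv_integrable 0 (2 * L) cphi.
have [i1 I1] := sum_ind_integral s iphi measurable_ind_pos.
have [i2 I2] := sum_ind_integral s iphi measurable_ind_neg.
set S1 := (fun r => phi r * _) in i1 I1; set S2 := (fun r => phi r * _) in i2 I2.
have cphir : continuous (fun r => phi r * r).
  by move=> x; apply: cvgM; [exact: cphi|exact: cvg_id].
have i3 := continuous_itv_integrable 0 (2 * L) cphir.
pose T r := S1 r + e * S2 r - (1 + e) * K * (phi r * r).
have ie2 : leb.-integrable `[0, 2 * L] (EFin \o (fun r => e * S2 r)).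
  by apply: eq_integrable (integrableZl _ e i2) => //.
have i12 : leb.-integrable `[0, 2 * L] (EFin \o (fun r => S1 r + e * S2 r)).
  by apply: eq_integrable (integrableD _ i1 ie2) => //.
have ie3 : leb.-integrable `[0, 2 * L]
    (EFin \o (fun r => (1 + e) * K * (phi r * r))).
  by apply: eq_integrable (integrableZl _ ((1 + e) * K) i3) => //.
have iT : leb.-integrable `[0, 2 * L] (EFin \o T).
  by apply: eq_integrable (integrableB _ i12 ie3) => //.
have TE : {in `[0, 2 * L]%classic, (fun r => phi r * N r) =1 T}.
  move=> r; rewrite inE/= in_itv/= => /andP[r0 rL].
  rewrite /N (mass_pos_atoms smu rL) (mass_neg_atoms smu rL) /T /S1 /S2.
  ring.
split.
  by apply: eq_integrable iT => // r rI /=; rewrite TE.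
have -> : \int[leb]_(r in `[0, 2 * L]) (cutoff_phi L g dg r * N r) =
    \int[leb]_(r in `[0, 2 * L]) T r by apply: eq_Rintegral => r rI; exact: TE.
rewrite RintegralB// RintegralD//.
rewrite (RintegralZl _ _ i2)// (RintegralZl _ _ i3)//; congr (_ - _).
rewrite I1 I2 (atoms_Rintegral_support smu).
- rewrite mulr_sumr -big_split/=; apply: eq_bigr => p _.
  rewrite [e * _]mulrCA -mulrDr; congr (_ * _).
  have [x0|x0] := ltP 0 p.2.
    rewrite [X in _ + e * X](_ : _ = 0).
      under eq_Rintegral do rewrite andTb.
      by rewrite mulr0 addr0 (cutoff_primitive_ind true)// ltW.
    under eq_Rintegral do rewrite andbF mulr0.
    by rewrite Rintegral_cst// mul0r.
  rewrite [X in X + _](_ : _ = 0); last first.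
    under eq_Rintegral do rewrite andFb mulr0.
    by rewrite Rintegral_cst// mul0r.
  under eq_Rintegral do rewrite andbT.
  rewrite add0r (cutoff_primitive_ind false)//; last by rewrite oppr_ge0.
  by rewrite cutoffN mulrCA -gN opprK.
- apply: measurable_funM; first by apply: continuous_measurable_fun; exact: continuous_cutoff.
  exact: continuous_measurable_fun.
- by move=> x xL; rewrite cutoff0 ?mul0r// ltW.
Qed.

End parts.

(** * Regularized kernels against the counting function *)

Section kernels.
Variable R : realType.
Notation leb := (@lebesgue_measure R).
Implicit Types (mu : lfmeasure R) (L x y r Y K : R).

(** The Lorentzian, common factor of both kernels: [kerRe Y r] is r times it and
    [kerIm Y r] is Y times it. *)
Definition lor Y r : R := (r ^+ 2 + Y ^+ 2)^-1.
Definition dkerRe Y r : R := lor Y r - 2 * r ^+ 2 * lor Y r ^+ 2.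
Definition dkerIm Y r : R := - (2 * r * Y * lor Y r ^+ 2).

Lemma lor_den_gt0 Y r : 0 < Y -> 0 < r ^+ 2 + Y ^+ 2.
Proof. by move=> Y0; rewrite ltr_wpDl ?sqr_ge0// exprn_gt0. Qed.

Lemma lor_gt0 Y r : 0 < Y -> 0 < lor Y r.
Proof. by move=> Y0; rewrite invr_gt0 lor_den_gt0. Qed.

Lemma is_derive_lor Y r : 0 < Y ->
  is_derive r 1 (lor Y) (- (2 * r * lor Y r ^+ 2)).
Proof.
move=> Y0; have d0 : r ^+ 2 + Y ^+ 2 != 0 by rewrite gt_eqF// lor_den_gt0.
have H : is_derive r 1 (fun r : R => r ^+ 2 + Y ^+ 2) (2 * r).
  by apply: is_derive_eq; rewrite /GRing.scale/=; ring.
pose f (r : R) := r ^+ 2 + Y ^+ 2.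
have H2 : is_derive r 1 (lor Y) (- f r ^- 2 *: (2 * r)).
  exact: (@is_deriveV R f r (2 * r) 1).
by apply: is_derive_eq; rewrite /f /GRing.scale/= /lor exprVn; ring.
Qed.

Lemma is_derive_kerRe Y r : 0 < Y -> is_derive r 1 (kerRe Y) (dkerRe Y r).
Proof.
move=> Y0; have H := is_derive_lor r Y0.
have -> : kerRe Y = (fun r => r * lor Y r) by [].
by apply: is_derive_eq; rewrite /GRing.scale/= /dkerRe; ring.
Qed.

Lemma is_derive_kerIm Y r : 0 < Y -> is_derive r 1 (kerIm Y) (dkerIm Y r).
Proof.
move=> Y0; have H := is_derive_lor r Y0.
have -> : kerIm Y = (fun r => Y * lor Y r) by [].
by apply: is_derive_eq; rewrite /GRing.scale/= /dkerIm; ring.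
Qed.

Lemma continuous_lor Y : 0 < Y -> continuous (lor Y).
Proof. by move=> Y0; apply: is_derive_continuous => x; exact: is_derive_lor. Qed.

Lemma continuous_kerRe Y : 0 < Y -> continuous (kerRe Y).
Proof. by move=> Y0; apply: is_derive_continuous => x; exact: is_derive_kerRe. Qed.

Lemma continuous_kerIm Y : 0 < Y -> continuous (kerIm Y).
Proof. by move=> Y0; apply: is_derive_continuous => x; exact: is_derive_kerIm. Qed.

Lemma continuous_dkerRe Y : 0 < Y -> continuous (dkerRe Y).
Proof.
move=> Y0 x; have c := @continuous_lor Y Y0 x.
apply: cvgB; first exact: c.
apply: cvgM; last exact: (cvgM c c).
apply: cvgM; first exact: cvg_cst.
exact: exprn_continuous.
Qed.

Lemma continuous_dkerIm Y : 0 < Y -> continuous (dkerIm Y).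
Proof.
move=> Y0 x; have c := @continuous_lor Y Y0 x.
apply: cvgN; apply: cvgM; last exact: (cvgM c c).
apply: cvgM; last exact: cvg_cst.
by apply: cvgM; [exact: cvg_cst|exact: cvg_id].
Qed.

Lemma dkerRe_le Y r : 0 < Y -> `|dkerRe Y r| <= lor Y r.
Proof.
move=> Y0; have k0 := lor_gt0 r Y0; have d0 := lor_den_gt0 r Y0.
have -> : dkerRe Y r = lor Y r * (1 - 2 * (r ^+ 2 * lor Y r)).
  by rewrite /dkerRe; ring.
rewrite normrM (gtr0_norm k0) -[leRHS]mulr1 ler_wpM2l ?(ltW k0)//.
have h0 : 0 <= r ^+ 2 * lor Y r by rewrite mulr_ge0 ?sqr_ge0// ltW.
have h1 : r ^+ 2 * lor Y r <= 1.
  by rewrite ler_pdivrMr// mul1r lerDl sqr_ge0.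
by rewrite ler_norml; apply/andP; split; lra.
Qed.

Lemma dkerIm_le Y r : 0 < Y -> `|dkerIm Y r| <= lor Y r.
Proof.
move=> Y0; have k0 := lor_gt0 r Y0; have d0 := lor_den_gt0 r Y0.
have -> : dkerIm Y r = lor Y r * - (2 * r * Y * lor Y r).
  by rewrite /dkerIm; ring.
rewrite normrM (gtr0_norm k0) -[leRHS]mulr1 ler_wpM2l ?(ltW k0)// normrN.
rewrite normrM (gtr0_norm k0) ler_pdivrMr// mul1r ler_norml.
have := sqr_ge0 (r - Y); have := sqr_ge0 (r + Y).
by rewrite sqrrB sqrrD => h1 h2; apply/andP; split; lra.
Qed.

(** The slope of the cutoff is at most 2 / L, and |g| is at most 2 L times the
    Lorentzian on the support of the cutoff, so the two terms of [cutoff_phi] have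
    the order of the Lorentzian uniformly in L. *)
Lemma cutoff_phi_le L Y r g dg : 0 < Y -> Y <= L -> 0 <= r <= 2 * L ->
  `|g| <= Num.max r Y * lor Y r -> `|dg| <= lor Y r ->
  `|cutoff_slope L r * g - cutoff L r * dg| <= 5 * lor Y r.
Proof.
move=> Y0 YL /andP[r0 rL] gk dgk; have k0 := lor_gt0 r Y0.
have L0 : 0 < L by exact: lt_le_trans YL.
apply: (le_trans (ler_normB _ _)).
rewrite (normrM (cutoff_slope L r)) (normrM (cutoff L r)).
have h2 : `|cutoff L r| * `|dg| <= lor Y r.
  rewrite -[leRHS]mul1r ler_pM// ger0_norm ?cutoff_ge0//.
  exact: cutoff_le1.
have h1 : `|cutoff_slope L r| * `|g| <= 4 * lor Y r.
  have sl : `|cutoff_slope L r| <= 2 / L.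
    rewrite /cutoff_slope ger0_norm ?divr_ge0 ?mulr_ge0 ?clamp_ge0 ?(ltW L0)//.
    rewrite ler_pM2r ?invr_gt0// -[leRHS]mulr1 ler_pM2l//.
    exact: clamp_le1.
  have gl : `|g| <= 2 * L * lor Y r.
    apply: (le_trans gk); rewrite ler_wpM2r ?(ltW k0)// ge_max rL/=; lra.
  apply: (le_trans (ler_pM _ _ sl gl)) => //.
  have -> : 2 / L * (2 * L * lor Y r) = 4 * lor Y r.
    by field; rewrite gt_eqF.
  by [].
lra.
Qed.

Definition phiRe L Y := cutoff_phi L (kerRe Y) (dkerRe Y).
Definition phiIm L Y := cutoff_phi L (kerIm Y) (dkerIm Y).

Lemma phiRe_le L Y r : 0 < Y -> Y <= L -> 0 <= r <= 2 * L ->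
  `|phiRe L Y r| <= 5 * lor Y r.
Proof.
move=> Y0 YL rL; apply: cutoff_phi_le => //; last exact: dkerRe_le.
have /andP[r0 _] := rL.
rewrite /kerRe normrM (ger0_norm r0) gtr0_norm ?lor_gt0//.
by rewrite ler_wpM2r ?(ltW (lor_gt0 _ _))// le_max lexx.
Qed.

Lemma phiIm_le L Y r : 0 < Y -> Y <= L -> 0 <= r <= 2 * L ->
  `|phiIm L Y r| <= 5 * lor Y r.
Proof.
move=> Y0 YL rL; apply: cutoff_phi_le => //; last exact: dkerIm_le.
rewrite /kerIm normrM (gtr0_norm Y0) gtr0_norm ?lor_gt0//.
by rewrite ler_wpM2r ?(ltW (lor_gt0 _ _))// le_max lexx orbT.
Qed.

Lemma mass_pos_mono mu : {homo mass_pos mu : x y / x <= y}.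
Proof.
move=> x y xy; rewrite /mass_pos fine_le ?lf_itv_fin//.
by apply: le_measure; rewrite ?inE//; apply: subset_itvl; rewrite bnd_simp.
Qed.

Lemma mass_neg_mono mu : {homo mass_neg mu : x y / x <= y}.
Proof.
move=> x y xy; rewrite /mass_neg fine_le ?lf_itv_fin//.
by apply: le_measure; rewrite ?inE//; apply: subset_itvr; rewrite bnd_simp lerN2.
Qed.

Definition discrepancy mu K r : R :=
  `|mass_pos mu r - K * r| + `|mass_neg mu r - K * r|.

Lemma measurable_discrepancy mu K : measurable_fun setT (discrepancy mu K).
Proof.
apply: measurable_funD; apply: measurableT_comp => //; apply: measurable_funB.
- apply: nondecreasing_measurable => // x y; exact: mass_pos_mono.
- exact: mulrl_measurable.
- apply: nondecreasing_measurable => // x y; exact: mass_neg_mono.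
- exact: mulrl_measurable.
Qed.

Lemma cutoff_parts_le mu L Y g dg (e K : R) : is_weighted_point_measure mu ->
  0 < Y -> Y <= L -> (forall x, is_derive x 1 g (dg x)) -> continuous dg ->
  (forall x, g (- x) = e * g x) -> `|e| <= 1 ->
  (forall r, 0 <= r <= 2 * L -> `|cutoff_phi L g dg r| <= 5 * lor Y r) ->
  ((`|\int[mu]_x (cutoff L x * g x) -
    (1 + e) * K * \int[leb]_(r in `[0, 2 * L]) (cutoff_phi L g dg r * r)|)%:E <=
  \int[leb]_(r in `[0%R, (2 * L)%R]) (5 * lor Y r * discrepancy mu K r)%:E)%E.
Proof.
move=> wmu Y0 YL gd cdg gN e1 phile.
have L0 : 0 < L by exact: lt_le_trans YL.
have [iN ->] := cutoff_parts K wmu L0 gd cdg gN.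
rewrite EFin_normr_Rintegral//.
apply: (le_trans (le_abse_integral _ _ _)) => //.
  by case/integrableP : iN.
apply: ge0_le_integral => //.
- by apply: measurableT_comp => //; case/integrableP : iN.
- apply/measurable_EFinP; apply: measurable_funTS; apply: measurable_funM.
    apply: measurable_funM; first exact: measurable_cst.
    by apply: continuous_measurable_fun; exact: continuous_lor.
  exact: measurable_discrepancy.
- move=> r; rewrite /= in_itv/= => rL; rewrite lee_fin normrM ler_pM//.
    exact: phile.
  apply: (le_trans (ler_normD _ _)); rewrite normrM lerD2l.
  by rewrite -[leRHS]mul1r ler_wpM2r.
Qed.

(** The mean density K contributes [2 * K * cIm L Y] to the imaginary part. *)
Definition cIm L Y : R := \int[leb]_(r in `[0, 2 * L]) (phiIm L Y r * r).

(** The kernel is odd, so the linear profiles of the two half-lines cancel and no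
    main term is left. *)
Lemma cutRe_le mu L Y K : is_weighted_point_measure mu -> 0 < Y -> Y <= L ->
  ((`|\int[mu]_x (cutoff L x * kerRe Y x)|)%:E <=
  \int[leb]_(r in `[0%R, (2 * L)%R]) (5 * lor Y r * discrepancy mu K r)%:E)%E.
Proof.
move=> wmu Y0 YL.
have := @cutoff_parts_le mu L Y (kerRe Y) (dkerRe Y) (-1) K wmu Y0 YL.
rewrite subrr !mul0r subr0; apply.
- by move=> x; exact: is_derive_kerRe.
- exact: continuous_dkerRe.
- by move=> x; rewrite /kerRe sqrrN mulN1r mulNr.
- by rewrite normrN1.
- by move=> r; exact: phiRe_le.
Qed.

Lemma cutIm_le mu L Y K : is_weighted_point_measure mu -> 0 < Y -> Y <= L ->
  ((`|\int[mu]_x (cutoff L x * kerIm Y x) - 2 * K * cIm L Y|)%:E <=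
  \int[leb]_(r in `[0%R, (2 * L)%R]) (5 * lor Y r * discrepancy mu K r)%:E)%E.
Proof.
move=> wmu Y0 YL.
have := @cutoff_parts_le mu L Y (kerIm Y) (dkerIm Y) 1 K wmu Y0 YL.
apply.
- by move=> x; exact: is_derive_kerIm.
- exact: continuous_dkerIm.
- by move=> x; rewrite /kerIm sqrrN mul1r.
- by rewrite normr1.
- by move=> r; exact: phiIm_le.
Qed.

End kernels.

Section constant.
Variable R : realType.
Notation leb := (@lebesgue_measure R).
Implicit Types (mu : lfmeasure R) (L x y r Y K : R).

Lemma Rintegral_itv_split (f : R -> R) (a b c : R) : a <= b -> b <= c ->
  leb.-integrable `[a, c] (EFin \o f) ->
  \int[leb]_(x in `[a, c]) f x =
  \int[leb]_(x in `[a, b]) f x + \int[leb]_(x in `[b, c]) f x.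
Proof.
move=> ab bc fi.
have := @Rintegral_itvB _ f (BLeft a) (BRight c) b fi; rewrite !bnd_simp.
move=> /(_ ab bc) /eqP; rewrite subr_eq addrC => /eqP ->; congr (_ + _).
rewrite Rintegral_itv_obnd_cbnd//; apply: integrableS fi => //.
by apply: subset_itvr; rewrite bnd_simp.
Qed.

Lemma normr_Rintegral_itv_le (f : R -> R) (a b c : R) : a <= b ->
  leb.-integrable `[a, b] (EFin \o f) ->
  (forall x, a <= x <= b -> `|f x| <= c) ->
  `|\int[leb]_(x in `[a, b]) f x| <= c * (b - a).
Proof.
move=> ab fi fc; apply: (le_trans (le_normr_Rintegral _ fi)) => //.
apply: (@le_trans _ _ (\int[leb]_(x in `[a, b]) c)).
  apply: le_Rintegral => //.
  - by move: fi => /integrable_norm; apply: eq_integrable.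
  - by apply: (@continuous_itv_integrable R (cst c)) => x; exact: cvg_cst.
have lI : leb `[a, b]%classic = (b - a)%:E.
  rewrite lebesgue_measure_itv/= lte_fin.
  by move: ab; rewrite le_eqVlt => /predU1P[->|->]; rewrite ?ltxx ?subrr.
by rewrite Rintegral_cst// [X in c * X](_ : _ = b - a)//; exact: (congr1 fine lI).
Qed.

(** On [0, L] the integrand is the derivative of atan (r / Y) - r Y lor Y r. The
    transition zone [L, 2 L] has length L and an integrand of order Y / L^2. *)
Lemma cIm_approx L Y : 0 < Y -> Y <= L -> `|cIm L Y - atan (L / Y)| <= 7 * Y / L.
Proof.
move=> Y0 YL; have L0 : 0 < L by exact: lt_le_trans YL.
have cphi : continuous (fun r => phiIm L Y r * r).
  move=> x; apply: cvgM; last exact: cvg_id.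
  apply: continuous_cutoff_phi => [z|]; first exact: is_derive_kerIm.
  exact: continuous_dkerIm.
have L2 : L <= 2 * L by lra.
rewrite /cIm (@Rintegral_itv_split _ 0 L)// ?(ltW L0)//; last first.
  exact: continuous_itv_integrable.
pose F r := atan (r / Y) - r * Y * lor Y r.
pose dF r := 2 * r ^+ 2 * Y * lor Y r ^+ 2.
have dFP x : is_derive x 1 F (dF x).
  have H := is_derive_lor x Y0.
  have H2 : is_derive x 1 (fun r : R => r / Y) (Y^-1).
    by apply: is_derive_eq; rewrite /GRing.scale/=; ring.
  have H3 := @is_derive1_comp R atan (fun r => r / Y) x _ _ (is_derive1_atan (x / Y)) H2.
  have H4 : is_derive x 1 (fun r => r * Y * lor Y r)
      (Y * lor Y x - 2 * x ^+ 2 * Y * lor Y x ^+ 2).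
    by apply: is_derive_eq; rewrite /GRing.scale/=; ring.
  have H5 : is_derive x 1 F ((1 + (x / Y) ^+ 2)^-1 * Y^-1 -
      (Y * lor Y x - 2 * x ^+ 2 * Y * lor Y x ^+ 2)) := is_deriveB H3 H4.
  apply: is_derive_eq.
  rewrite /dF /GRing.scale/= /lor; field.
  by rewrite !gt_eqF ?lor_den_gt0 ?ltr_wpDl ?sqr_ge0 ?exprn_gt0.
have -> : \int[leb]_(x in `[0, L]) (phiIm L Y x * x) = F L - F 0.
  transitivity (\int[leb]_(x in `[0, L]) dF x).
    apply: eq_Rintegral => r; rewrite inE/= in_itv/= => /andP[r0 rL].
    rewrite /phiIm /cutoff_phi cutoff1 ?ger0_norm// /cutoff_slope clamp0.
      by rewrite /dF /dkerIm; ring.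
    by rewrite subr_le0 ler_pdivrMr// mul1r.
  rewrite (FTC_closed_itv (f := F))// ?(ltW L0)// => x _.
  apply: cvgM; last first.
    by have c := @continuous_lor _ _ Y0 x; exact: (cvgM c c).
  apply: cvgM; last exact: cvg_cst.
  by apply: cvgM; [exact: cvg_cst|exact: exprn_continuous].
rewrite /F mul0r atan0 !mul0r subr0 subr0.
have e1 : 0 <= L * Y * lor Y L <= Y / L.
  rewrite !mulr_ge0 ?(ltW L0) ?(ltW Y0) ?(ltW (lor_gt0 _ _))//=.
  rewrite /lor ler_pdivrMr ?lor_den_gt0//.
  have -> : Y / L * (L ^+ 2 + Y ^+ 2) = L * Y + Y ^+ 3 / L.
    by field; rewrite gt_eqF.
  by rewrite lerDl divr_ge0 ?exprn_ge0// ltW.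
have e2 : `|\int[leb]_(x in `[L, 2 * L]) (phiIm L Y x * x)| <= 6 * Y / L.
  have -> : 6 * Y / L = 6 * Y / L ^+ 2 * (2 * L - L) by field; rewrite gt_eqF.
  apply: normr_Rintegral_itv_le => //; first exact: continuous_itv_integrable.
  move=> r /andP[Lr rL].
  have r0 : 0 < r by exact: lt_le_trans Lr.
  have l0 := lor_gt0 r Y0.
  have lL : lor Y r <= L^-2.
    rewrite /lor lef_pV2 ?posrE ?lor_den_gt0 ?exprn_gt0//.
    apply: (@le_trans _ _ (r ^+ 2)); last by rewrite lerDl sqr_ge0.
    by rewrite ler_pXn2r// ?nnegrE ltW.
  have c1 : cutoff_slope L r * r <= 4.
    have -> : 4 = 2 / L * (2 * L) :> R by field; rewrite gt_eqF.
    rewrite ler_pM ?(ltW r0)//.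
      by rewrite /cutoff_slope divr_ge0 ?mulr_ge0 ?clamp_ge0 ?(ltW L0).
    rewrite /cutoff_slope ler_pM2r ?invr_gt0// -[leRHS]mulr1 ler_pM2l//.
    exact: clamp_le1.
  have c0 : 0 <= cutoff_slope L r * r.
    by rewrite !mulr_ge0 ?clamp_ge0 ?invr_ge0 ?(ltW L0) ?(ltW r0).
  have k1 : r ^+ 2 * lor Y r <= 1.
    by rewrite /lor ler_pdivrMr ?lor_den_gt0// mul1r lerDl sqr_ge0.
  have k0 : 0 <= r ^+ 2 * lor Y r by rewrite mulr_ge0 ?sqr_ge0// ltW.
  have cc0 := cutoff_ge0 L r; have cc1 := cutoff_le1 L r.
  have -> : phiIm L Y r * r = Y * lor Y r *
      (cutoff_slope L r * r + 2 * (cutoff L r * (r ^+ 2 * lor Y r))).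
    by rewrite /phiIm /cutoff_phi /dkerIm /kerIm -/(lor Y r); ring.
  have Q : 0 <= cutoff L r * (r ^+ 2 * lor Y r) <= 1.
    by rewrite mulr_ge0//= -[leRHS]mulr1 ler_pM.
  rewrite ger0_norm; last by rewrite mulr_ge0 ?mulr_ge0 ?(ltW Y0) ?(ltW l0)//; lra.
  have -> : 6 * Y / L ^+ 2 = Y / L ^+ 2 * 6 by ring.
  rewrite ler_pM ?mulr_ge0 ?(ltW Y0) ?(ltW l0)//; try lra.
  by rewrite ler_wpM2l// ltW.
have -> : 7 * Y / L = Y / L + 6 * Y / L by ring.
set I2 := \int[leb]_(x in `[L, 2 * L]) _ in e2 *.
have -> : atan (L / Y) - L * Y * lor Y L + I2 - atan (L / Y) =
  - (L * Y * lor Y L) + I2 by ring.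
apply: (le_trans (ler_normD _ _)); apply: lerD e2; rewrite normrN.
by case/andP: e1 => e10 e11; rewrite ger0_norm.
Qed.

Lemma cIm_cvg Y e : 0 < Y -> 0 < e ->
  \forall m \near \oo, `|2 * cIm m%:R Y - pi| < e.
Proof.
move=> Y0 e0.
have h : atan (m%:R / Y) @[m --> \oo] --> (pi / 2 : R).
  have h0 : (fun m : nat => m%:R / Y) @ \oo --> +oo%R.
    apply/cvgryPge => A; near=> m; rewrite ler_pdivlMr//.
    by near: m; exact: nbhs_infty_ger.
  exact: cvg_comp _ _ h0 (@cvgy_atan R).
have e4 : 0 < e / 4 by rewrite divr_gt0.
near=> m.
have Ym : Y <= m%:R by near: m; exact: nbhs_infty_ger.
have m0 : 0 < m%:R :> R by exact: lt_le_trans Ym.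
have h1 : `|pi / 2 - atan (m%:R / Y)| < e / 4.
  by near: m; move/cvgrPdist_lt : h => /(_ _ e4).
have h2 := cIm_approx Y0 Ym.
have h3 : 7 * Y / m%:R <= e / 4.
  rewrite ler_pdivrMr// [leRHS]mulrC -ler_pdivrMr//.
  by near: m; exact: nbhs_infty_ger.
move: h1 h2 h3; rewrite ltr_norml => /andP[a1 a2]; rewrite ler_norml => /andP[b1 b2] h3.
by rewrite ltr_norml; apply/andP; split; lra.
Unshelve. all: by end_near. Qed.

End constant.

(** * Tails of the reciprocal integral *)

Section tail.
Variable R : realType.
Notation leb := (@lebesgue_measure R).
Implicit Types (mu : lfmeasure R) (L x y r Y K A : R) (s : seq (R * R)).

Definition balance mu r : R :=
  fine (mu `]0, r]%classic) - fine (mu `[(- r), 0[%classic).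

(** Minus the derivative of [tail_ker L] on the positive half-line; the maximum
    makes it vanish below L, as the tail kernel does. *)
Definition tail_phi L r : R :=
  (Num.max r L) ^- 2 - L ^- 2 * (r <= 2 * L)%R%:R.

Definition tail_ker L x : R := (1 - cutoff L x) / x.

Lemma continuous_tail_main L : 0 < L -> continuous (fun r => (Num.max r L) ^- 2).
Proof.
move=> L0 x; have c : {for x, continuous (fun r => Num.max r L)}.
  apply: (@continuous_max _ _ id (cst L) x); first exact: cvg_id.
  exact: cst_continuous.
have m0 : 0 < Num.max x L by rewrite lt_max L0 orbT.
apply: cvgV; first by rewrite gt_eqF// exprn_gt0.
exact: (cvgM c c).
Qed.

Lemma tail_phi_integrable L A : 0 < L ->
  leb.-integrable `[L, A] (EFin \o tail_phi L).
Proof.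
move=> L0; have i1 := continuous_itv_integrable L A (continuous_tail_main L0).
have c2 : continuous (cst (L ^- 2) : R -> R) by exact: cst_continuous.
have i2 := bounded_ind_integrable (continuous_itv_integrable L A c2)
  (measurable_fun_ler (@measurable_id _ _ setT) (@measurable_cst _ _ _ _ setT (2 * L))).
by apply: eq_integrable (integrableB _ i1 i2).
Qed.

Lemma integral_invsqr (a b : R) : 0 < a -> a <= b ->
  \int[leb]_(r in `[a, b]) (r ^- 2) = a^-1 - b^-1.
Proof.
move=> a0 ab.
have d x : a <= x <= b -> is_derive x 1 (fun r : R => - r^-1) (x ^- 2).
  move=> /andP[ax _]; have x0 : x != 0 by rewrite gt_eqF// (lt_le_trans a0).
  have H : is_derive x 1 (fun r : R => r^-1) (- x ^- 2 *: (1 : R)).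
    exact: (@is_deriveV R id x 1 1 x0).
  have H2 : is_derive x 1 (fun r : R => - r^-1) (- (- x ^- 2 *: (1 : R))).
    exact: is_deriveN.
  by apply: is_derive_eq; rewrite /GRing.scale/= mulr1 opprK.
have c x : a <= x <= b -> {for x, continuous (fun r : R => r ^- 2)}.
  move=> /andP[ax _]; have x0 : 0 < x by rewrite (lt_le_trans a0).
  apply: cvgV; first by rewrite gt_eqF// exprn_gt0.
  exact: exprn_continuous.
by rewrite (FTC_closed_itv ab d c) opprK addrC.
Qed.

Lemma tail_phi_primitive L A y : 0 < L -> 2 * L <= A -> 0 < y -> y <= A ->
  \int[leb]_(r in `[L, A]) (tail_phi L r * (y <= r)%R%:R) = tail_ker L y - A^-1.
Proof.
move=> L0 LA y0 yA.
pose m := Num.max y L.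
have m0 : 0 < m by rewrite lt_max y0.
have mA : m <= A by rewrite ge_max yA; lra.
have Lm : L <= m by rewrite le_max lexx orbT.
have mle r : L <= r -> (m <= r) = (y <= r) by rewrite ge_max => ->; rewrite andbT.
transitivity (\int[leb]_(r in `[m, A]) tail_phi L r).
  rewrite [LHS]Rintegral_mkcond [RHS]Rintegral_mkcond; apply: eq_Rintegral => r _.
  rewrite !patchE !mem_setE !in_itv/=.
  have [Lr|rL]/= := leP L r.
    rewrite mle//; case: (y <= r) => /=; first by rewrite mulr1.
    by rewrite mulr0 if_same.
  by rewrite ifF//; apply/negbTE; rewrite negb_and -ltNge (lt_le_trans rL).
have c2 : continuous (cst (L ^- 2) : R -> R) by exact: cst_continuous.
pose g r : R := L ^- 2 * (r <= 2 * L)%R%:R.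
have i1 : leb.-integrable `[m, A] (EFin \o (fun r => r ^- 2)).
  have i0 := continuous_itv_integrable m A (continuous_tail_main m0).
  apply: eq_integrable i0 => // r; rewrite inE/= in_itv/= => /andP[mr _].
  by rewrite max_l.
have i2 : leb.-integrable `[m, A] (EFin \o g).
  exact: bounded_ind_integrable (continuous_itv_integrable m A c2)
   (measurable_fun_ler (@measurable_id _ _ setT) (@measurable_cst _ _ _ _ setT (2 * L))).
transitivity (\int[leb]_(r in `[m, A]) (r ^- 2 - g r)).
  apply: eq_Rintegral => r; rewrite inE/= in_itv/= => /andP[mr _].
  by rewrite /tail_phi max_l// (le_trans Lm).
rewrite RintegralB// integral_invsqr//.
have -> : \int[leb]_(r in `[m, A]) g r =
    if m <= 2 * L then L ^- 2 * (2 * L - m) else 0.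
  transitivity (\int[leb]_(r in `[m, 2 * L]) (L ^- 2)).
    rewrite [LHS]Rintegral_mkcond [RHS]Rintegral_mkcond; apply: eq_Rintegral => r _.
    rewrite !patchE !mem_setE !in_itv/= /g.
    have [mr|rm] //= := leP m r.
    have [rL|rL]/= := leP r (2 * L); first by rewrite (le_trans rL)// mulr1.
    by rewrite mulr0 if_same.
  case: ifPn => [mL|]; last first.
    rewrite -ltNge => mL; suff -> : (`[m, 2 * L]%classic : set R) = set0.
      by rewrite Rintegral_set0.
    by apply/seteqP; split => r //=; rewrite in_itv/= => /andP[? ?]; lra.
  have lI : leb `[m, 2 * L]%classic = (2 * L - m)%:E.
    rewrite lebesgue_measure_itv/= lte_fin.
    by move: mL; rewrite le_eqVlt => /predU1P[->|->]; rewrite ?ltxx ?subrr.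
  by rewrite Rintegral_cst// [X in _ * X](_ : _ = 2 * L - m)//; exact: (congr1 fine lI).
have L00 : L != 0 by rewrite gt_eqF.
have y00 : y != 0 by rewrite gt_eqF.
have A00 : A != 0 by rewrite gt_eqF// (lt_le_trans y0).
rewrite /tail_ker; have [yL|Ly] := leP y L.
  have -> : m = L by rewrite /m max_r.
  rewrite ifT; last lra.
  have -> : cutoff L y = 1 by apply: cutoff1 => //; rewrite ger0_norm// ltW.
  by field; rewrite L00 y00 A00.
have -> : m = y by rewrite /m max_l// ltW.
case: ifPn => [yL|].
  have -> : cutoff L y = 1 - (y / L - 1) ^+ 2 by rewrite cutoff_mid// yL ltW.
  by field; rewrite L00 y00 A00.
rewrite -ltNge => yL.
have -> : cutoff L y = 0.
  by apply: cutoff0 => //; rewrite ger0_norm ?(ltW y0)// ltW.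
by field; rewrite y00 A00.
Qed.

Lemma tail_phi_le L r : 0 < L -> L <= r -> `|tail_phi L r| <= 4 / r ^+ 2.
Proof.
move=> L0 Lr; have r0 : 0 < r by exact: lt_le_trans Lr.
have r2 : 0 < r ^+ 2 by rewrite exprn_gt0.
have ri0 : 0 <= r ^- 2 by rewrite invr_ge0 ltW.
have Li0 : 0 <= L ^- 2 by rewrite invr_ge0 sqr_ge0.
rewrite /tail_phi max_l//; have [rL|rL]/= := leP r (2 * L); last first.
  by rewrite mulr0 subr0 ger0_norm//; lra.
rewrite mulr1.
have h1 : r ^- 2 <= L ^- 2.
  by rewrite lef_pV2 ?posrE ?exprn_gt0// ler_pXn2r// ?nnegrE ltW.
have h2 : L ^- 2 <= 4 / r ^+ 2.
  rewrite ler_pdivlMr// mulrC ler_pdivrMr ?exprn_gt0//.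
  have -> : 4 * L ^+ 2 = (2 * L) ^+ 2 by ring.
  by rewrite ler_pXn2r// ?nnegrE ?ltW// mulr_gt0.
by rewrite ler0_norm; lra.
Qed.

Lemma balance_atoms mu B s r : atoms mu B s -> r <= B ->
  balance mu r = \sum_(p <- s) p.1 * ((0 < p.2) && (p.2 <= r))%:R
               - \sum_(p <- s) p.1 * ((p.2 < 0) && (- p.2 <= r))%:R.
Proof.
move=> smu rB; rewrite /balance -[X in X - _]/(mass_pos mu r).
rewrite (mass_pos_atoms smu rB); congr (_ - _); case: smu => _ ->//=.
  apply: eq_bigr => p _; rewrite indicE; congr (_ * (nat_of_bool _)%:R).
  by rewrite mem_setE in_itv/= lerNl andbC.
move=> x /=; rewrite !in_itv/= => /andP[x0 xr]; apply/andP; split; lra.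
Qed.

Lemma measurable_ind_neg0 x :
  measurable_fun setT (fun r : R => (x < 0) && (- x <= r)).
Proof.
apply: measurable_and; first exact: measurable_cst.
exact: measurable_fun_ler.
Qed.

Lemma measurable_balance mu : measurable_fun setT (balance mu).
Proof.
apply: measurable_funB; apply: nondecreasing_measurable => // x y xy.
  exact: mass_pos_mono.
rewrite fine_le ?lf_itv_fin//.
by apply: le_measure; rewrite ?inE//; apply: subset_itvr; rewrite bnd_simp lerN2.
Qed.

(** Integration by parts as in [cutoff_parts]. The tail kernel is odd, so only the
    balance of the two half-lines enters: at the end point A, where the kernel is
    1 / A, and under the integral. *)
Lemma tail_parts s mu L A : atoms mu A s -> 0 < L -> 2 * L <= A ->
  ((`|\sum_(p <- s) p.1 * tail_ker L p.2|)%:E <= (`|balance mu A| / A)%:E +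
   \int[leb]_(r in `[L, A]) (4 / r ^+ 2 * `|balance mu r|)%:E)%E.
Proof.
move=> smu L0 LA; have A0 : 0 < A by apply: lt_le_trans LA; rewrite mulr_gt0.
have iphi := tail_phi_integrable A L0.
have [i1 I1] := sum_ind_integral s iphi (@measurable_ind_pos R).
have [i2 I2] := sum_ind_integral s iphi (@measurable_ind_neg0).
set S1 := (fun r => tail_phi L r * _) in i1 I1.
set S2 := (fun r => tail_phi L r * _) in i2 I2.
have i12 : leb.-integrable `[L, A] (EFin \o (fun r => S1 r - S2 r)).
  by apply: eq_integrable (integrableB _ i1 i2) => //.
have E r : r \in (`[L, A]%classic : set R) ->
    S1 r - S2 r = tail_phi L r * balance mu r.
  rewrite inE/= in_itv/= => /andP[_ rA].
  by rewrite (balance_atoms smu rA) /S1 /S2 mulrBr.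
have -> : \sum_(p <- s) p.1 * tail_ker L p.2 =
   balance mu A / A + \int[leb]_(r in `[L, A]) (S1 r - S2 r).
  rewrite RintegralB// I1 I2 (balance_atoms smu (lexx A)).
  rewrite mulrBl !mulr_suml addrACA -opprD -!big_split -sumrB/=.
  rewrite !big_seq; apply: eq_bigr => p /(proj1 smu)[_]; rewrite ler_norml => /andP[pA1 pA2].
  have zI (h : R -> bool) :
      \int[leb]_(r in `[L, A]) (tail_phi L r * (false && h r)%:R) = 0.
    under eq_Rintegral do rewrite andFb mulr0.
    by rewrite Rintegral_cst// mul0r.
  have A00 : A != 0 by rewrite gt_eqF.
  have [x0|x0|<-] := ltrgtP 0 p.2.
  - rewrite zI tail_phi_primitive//= pA2 /=.
    by field.
  - have nx0 : 0 < - p.2 by rewrite oppr_gt0.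
    have nxA : - p.2 <= A by rewrite lerNl.
    rewrite (zI (fun r => p.2 <= r)) (tail_phi_primitive L0 LA nx0 nxA).
    rewrite nxA /=.
    by rewrite /tail_ker cutoffN invrN; field; rewrite A00 lt_eqF.
  - rewrite !zI /= /tail_ker invr0 !mulr0 mul0r; ring.
have -> : `|balance mu A| / A = `|balance mu A / A|.
  by rewrite normrM normfV (gtr0_norm A0).
rewrite (le_trans (_ : _ <= (`|balance mu A / A| + `|\int[leb]_(r in `[L, A]) (S1 r - S2 r)|)%:E)%E)//.
  by rewrite lee_fin ler_normD.
rewrite EFinD leeD2l// EFin_normr_Rintegral//.
apply: (le_trans (le_abse_integral _ _ _)) => //.
  by case/integrableP : i12.
apply: ge0_le_integral => //.
- by apply: measurableT_comp => //; case/integrableP : i12.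
- apply/measurable_EFinP; apply: measurable_funM; last first.
    apply: measurable_funTS; apply: measurableT_comp => //.
    exact: measurable_balance.
  apply: (eq_measurable_fun (fun r => 4 * Num.max r L ^- 2)).
    by move=> r; rewrite inE/= in_itv/= => /andP[Lr _]; rewrite max_l.
  apply: measurable_funTS; apply: measurable_funM => //.
  by apply: continuous_measurable_fun; exact: continuous_tail_main.
- move=> r rI; rewrite /= E ?inE// lee_fin normrM ler_wpM2r//.
  by apply: tail_phi_le => //; move: rI; rewrite /= in_itv/= => /andP[].
Qed.

End tail.

Section compare.
Variable R : realType.
Notation leb := (@lebesgue_measure R).
Implicit Types (mu : lfmeasure R) (L x y r Y K A : R) (s : seq (R * R)).

Lemma measurable_invr : measurable_fun setT (fun x : R => x^-1).
Proof.
have o : open [set x : R | x != 0] by exact: open_neq.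
have mo : measurable_fun [set x : R | x != 0] (fun x : R => x^-1).
  apply: open_continuous_measurable_fun => // x; rewrite inE => x0.
  exact: inv_continuous.
have -> : (fun x : R => x^-1) = (fun x => x^-1) \_ [set x : R | x != 0].
  apply/funext => x; rewrite patchE; case: ifPn => // /negP.
  by rewrite inE /= => /negP; rewrite negbK => /eqP ->; rewrite invr0.
by apply/(measurable_restrictT _ _).1 => //; exact: open_measurable.
Qed.

(** An atom at 0 drops out of the sum because 0^-1 = 0. *)
Lemma reciprocal_integralE mu A s : atoms mu A s ->
  reciprocal_integral A mu = \sum_(p <- s) p.1 / p.2.
Proof.
move=> smu; rewrite /reciprocal_integral.
pose D := [set x : R | 0 < `|x| <= A].
have mD : measurable D.
  rewrite (_ : D = (`[- A, A]%classic `\ 0)); first exact: measurableD.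
  apply/seteqP; split => x; rewrite /D /= normr_gt0 in_itv/= -ler_norml.
    by move=> /andP[/eqP].
  by move=> [xA /eqP ->].
rewrite (atoms_Rintegral smu)//; last 2 first.
- by move=> x /= /andP[_]; rewrite in_itv/= -ler_norml.
- by apply: measurable_funTS; exact: measurable_invr.
rewrite !big_seq; apply: eq_bigr => p /(proj1 smu)[_ pA].
have [->|p0] := eqVneq p.2 0; first by rewrite invr0 !mulr0.
by rewrite indicE mem_set ?mulr1//= normr_gt0 p0.
Qed.

(** Real and imaginary parts at i Y of the Stieltjes transform of the measure cut off
    at scale L. *)
Definition FRe L Y mu : R := \int[mu]_x (cutoff L x * kerRe Y x).
Definition FIm L Y mu : R := \int[mu]_x (cutoff L x * kerIm Y x).

Lemma FReE mu B s L Y : atoms mu B s -> 0 < Y -> 0 < L -> 2 * L <= B ->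
  FRe L Y mu = \sum_(p <- s) p.1 * (cutoff L p.2 * kerRe Y p.2).
Proof.
move=> smu Y0 L0 LB; rewrite /FRe (atoms_Rintegral_support smu)//.
  apply: measurable_funM; apply: continuous_measurable_fun.
    exact: continuous_cutoff.
  exact: continuous_kerRe.
by move=> x Bx; rewrite cutoff0 ?mul0r// ltW// (le_lt_trans LB).
Qed.

Lemma FImE mu B s L Y : atoms mu B s -> 0 < Y -> 0 < L -> 2 * L <= B ->
  FIm L Y mu = \sum_(p <- s) p.1 * (cutoff L p.2 * kerIm Y p.2).
Proof.
move=> smu Y0 L0 LB; rewrite /FIm (atoms_Rintegral_support smu)//.
  apply: measurable_funM; apply: continuous_measurable_fun.
    exact: continuous_cutoff.
  exact: continuous_kerIm.
by move=> x Bx; rewrite cutoff0 ?mul0r// ltW// (le_lt_trans LB).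
Qed.

Lemma FIm_ge0 mu L Y : 0 < Y -> 0 <= FIm L Y mu.
Proof.
move=> Y0; apply: Rintegral_ge0 => x _.
by rewrite mulr_ge0 ?cutoff_ge0// divr_ge0 ?(ltW Y0)// addr_ge0 ?sqr_ge0.
Qed.

(** Both errors are at most y / x^2, and away from 0 this is comparable to
    y times [kerIm 1 x]. *)
Lemma kernel_compare c x y delta : 0 < y -> 0 < delta -> delta <= `|x| ->
  0 <= c -> `|c * (x^-1 - kerRe y x)| + c * kerIm y x <=
  2 * y * (1 + delta ^- 2) * (c * kerIm 1 x).
Proof.
move=> y0 d0 dx c0.
have x0 : x != 0 by rewrite -normr_gt0 (lt_le_trans d0).
have x2 : 0 < x ^+ 2 by rewrite exprn_even_gt0.
have xy : 0 < x ^+ 2 + y ^+ 2 by exact: lor_den_gt0.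
have x1 : 0 < x ^+ 2 + 1 by rewrite ltr_wpDl ?sqr_ge0.
have d2 : 0 < delta ^+ 2 by rewrite exprn_gt0.
have e1 : kerIm y x <= y / x ^+ 2.
  by rewrite /kerIm ler_pM2l// lef_pV2 ?posrE// lerDl sqr_ge0.
have e2 : `|x^-1 - kerRe y x| <= y / x ^+ 2.
  have -> : x^-1 - kerRe y x = y / x ^+ 2 * (x * y / (x ^+ 2 + y ^+ 2)).
    by rewrite /kerRe; field; rewrite x0 gt_eqF.
  rewrite normrM (gtr0_norm (divr_gt0 y0 x2)) -[leRHS]mulr1.
  rewrite ler_wpM2l ?(ltW (divr_gt0 y0 x2))//.
  rewrite normrM normfV (gtr0_norm xy) ler_pdivrMr// mul1r ler_norml.
  have := sqr_ge0 (x - y); have := sqr_ge0 (x + y).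
  have := sqr_ge0 x; have := sqr_ge0 y.
  by rewrite sqrrB sqrrD => h1 h2 h3 h4; apply/andP; split; lra.
have e3 : y / x ^+ 2 <= y * (1 + delta ^- 2) * kerIm 1 x.
  rewrite /kerIm expr1n mul1r -mulrA ler_pM2l// ler_pdivlMr// mulrC.
  rewrite mulrDl mul1r mulfV ?gt_eqF// lerD2l lef_pV2 ?posrE//.
  by rewrite -(real_normK (num_real x)) ler_pXn2r// nnegrE ltW// (lt_le_trans d0).
rewrite normrM (ger0_norm c0) -mulrDr [leRHS]mulrCA ler_wpM2l//; lra.
Qed.

(** Apart from the tail, moving the pole from 0 to i y costs y times a quantity
    that lives at height 1, whose expectation is bounded. *)
Lemma reciprocal_compare mu s L A delta y : atoms mu A s ->
  0 < y -> 0 < delta -> delta <= A -> 0 < L -> 2 * L <= A ->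
  mu `](- delta), delta[%classic = 0%E ->
  `|reciprocal_integral A mu - FRe L y mu| + FIm L y mu <=
  `|\sum_(p <- s) p.1 * tail_ker L p.2|
   + 2 * y * (1 + delta ^- 2) * FIm L 1 mu.
Proof.
move=> smu y0 d0 dA L0 LA mu0.
rewrite (reciprocal_integralE smu) (FReE smu)// !(FImE smu)//.
have w0 p : p \in s -> p.1 = 0 \/ delta <= `|p.2|.
  move=> ps; have [pd|?] := ltP `|p.2| delta; [left|by right].
  have : (\sum_(p <- s) p.1 * \1_(`](- delta), delta[%classic : set R) p.2) = 0 :> R.
    have := mu0; case: (smu) => _ -> //; first by case.
    move=> x /=; rewrite !in_itv/= => /andP[? ?]; apply/andP; split; lra.
  move=> /eqP; rewrite big_seq psumr_eq0; last first.
    by move=> q /(proj1 smu)[q0 _]; rewrite mulr_ge0.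
  move=> /allP/(_ _ ps); rewrite ps/= indicE mem_set ?mulr1; first by move/eqP.
  by rewrite /= in_itv/= -ltr_norml.
pose T := \sum_(p <- s) p.1 * tail_ker L p.2.
pose U := \sum_(p <- s) p.1 * (cutoff L p.2 * (p.2^-1 - kerRe y p.2)).
have -> : \sum_(p <- s) p.1 / p.2 -
    \sum_(p <- s) p.1 * (cutoff L p.2 * kerRe y p.2) = T + U.
  rewrite -sumrB /T /U -big_split; apply: eq_bigr => p _ /=.
  rewrite /tail_ker; ring.
rewrite -/T.
apply: (@le_trans _ _ (`|T| + (`|U| +
    \sum_(p <- s) p.1 * (cutoff L p.2 * kerIm y p.2)))).
  by rewrite addrA lerD2r; exact: ler_normD.
rewrite lerD2l; apply: (@le_trans _ _ (\sum_(p <- s)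
    (`|p.1 * (cutoff L p.2 * (p.2^-1 - kerRe y p.2))| +
     p.1 * (cutoff L p.2 * kerIm y p.2)))).
  by rewrite big_split/= lerD2r; exact: ler_norm_sum.
rewrite mulr_sumr !big_seq; apply: ler_sum => p ps.
have [p0 _] := (proj1 smu) p ps.
have [->|pd] := w0 p ps; first by rewrite !mul0r normr0 !mulr0 addr0.
rewrite normrM (ger0_norm p0) -mulrDr [leRHS]mulrCA ler_wpM2l//.
by apply: kernel_compare => //; exact: cutoff_ge0.
Qed.

End compare.

(** * Joint measurability and Tonelli *)

Section gaps.
Variable R : realType.
Implicit Types (t : seq R) (r B : R).

(** Finitely many jump points leave a gap to the right of r; this is
    right-continuity of the mass of ]0, r] in an elementary form. *)
Lemma right_gap t r B : r < B ->
  exists2 q, r < q <= B & forall x, x \in t -> (x <= q) = (x <= r).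
Proof.
move=> rB; elim: t => [|y t [q /andP[rq qB] IH]].
  by exists B; rewrite ?rB ?lexx.
have [yr|ry] := leP y r.
  exists q; first by rewrite rq.
  move=> x; rewrite inE => /predU1P[->|]; last exact: IH.
  by rewrite yr; apply: le_trans yr (ltW rq).
exists (Num.min q ((r + y) / 2)).
  rewrite lt_min rq ge_min qB /= andbT; lra.
move=> x; rewrite inE le_min => /predU1P[->|xt].
  by rewrite andbC (_ : (y <= (r + y) / 2) = false) ?(leNgt y r) ?ry//; apply/negbTE; rewrite -ltNge; lra.
rewrite IH//; have [xr|] //= := leP x r; lra.
Qed.

Lemma left_gap t r :
  exists2 q, q < r & forall x, x \in t -> (x < q) = (x < r).
Proof.
elim: t => [|y t [q rq IH]].
  by exists (r - 1) => //; lra.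
have [ry|yr] := leP r y.
  exists q => // x; rewrite inE => /predU1P[->|]; last exact: IH.
  by rewrite !ltNge ry (le_trans (ltW rq)).
exists (Num.max q ((r + y) / 2)).
  by rewrite gt_max rq /=; lra.
move=> x; rewrite inE lt_max => /predU1P[->|xt].
  by rewrite orbC (_ : (y < (r + y) / 2) = true) ?yr//; lra.
rewrite IH//; have [xr|] //= := ltP x r; lra.
Qed.

End gaps.

Section joint.
Context {R : realType} {d : measure_display} {W : measurableType d}.
Implicit Types (f : W -> R -> R).

(** By monotonicity and right-continuity the sublevel sets are countable unions of
    measurable rectangles with rational corners. *)
Lemma measurable_mono_right f : (forall r, measurable_fun setT (f ^~ r)) ->
  (forall w, {homo f w : x y / x <= y}) ->
  (forall w r c, f w r < c -> exists2 q, r < q & f w q < c) ->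
  measurable_fun setT (fun wr : W * measurableTypeR R => f wr.1 wr.2).
Proof.
move=> mf f_nd f_rc; apply: (measurability _ (RGenInftyO.measurableE R)).
move=> _ [_ [c ->] <-]; rewrite setTI.
have -> : (fun wr : W * measurableTypeR R => f wr.1 wr.2) @^-1` `]-oo, c[ =
   \bigcup_(q in [set: rat])
     ((f ^~ (ratr q)) @^-1` `]-oo, c[ `*` `]-oo, (ratr q : R)[%classic).
  apply/seteqP; split => [[w r] /=|[w r] [q _] [/=]].
    rewrite in_itv/= => /f_rc[q rq fq].
    have [p] := rat_in_itvoo rq; rewrite in_itv/= => /andP[rp pq].
    exists p => //=; split; rewrite /= in_itv//=.
    by apply: le_lt_trans fq; apply: f_nd; exact: ltW.
  rewrite !in_itv/= => fq rq.
  by apply: le_lt_trans fq; apply: f_nd; exact: ltW.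
apply: bigcupT_measurable_rat => q; apply: measurableX => //.
by rewrite -[X in measurable X]setTI; exact: mf.
Qed.

Lemma measurable_mono_left f : (forall r, measurable_fun setT (f ^~ r)) ->
  (forall w, {homo f w : x y / x <= y}) ->
  (forall w r c, c < f w r -> exists2 q, q < r & c < f w q) ->
  measurable_fun setT (fun wr : W * measurableTypeR R => f wr.1 wr.2).
Proof.
move=> mf f_nd f_rc; apply: (measurability _ (RGenOInfty.measurableE R)).
move=> _ [_ [c ->] <-]; rewrite setTI.
have -> : (fun wr : W * measurableTypeR R => f wr.1 wr.2) @^-1` `]c, +oo[ =
   \bigcup_(q in [set: rat])
     ((f ^~ (ratr q)) @^-1` `]c, +oo[ `*` `](ratr q : R), +oo[%classic).
  apply/seteqP; split => [[w r] /=|[w r] [q _] [/=]].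
    rewrite in_itv/= andbT => /f_rc[q rq fq].
    have [p] := rat_in_itvoo rq; rewrite in_itv/= => /andP[rp pq].
    exists p => //=; split; rewrite /= in_itv/= ?andbT//.
    by apply: lt_le_trans fq _; apply: f_nd; exact: ltW.
  rewrite !in_itv/= !andbT => fq rq.
  by apply: lt_le_trans fq _; apply: f_nd; exact: ltW.
apply: bigcupT_measurable_rat => q; apply: measurableX => //.
by rewrite -[X in measurable X]setTI; exact: mf.
Qed.

Variable M : W -> lfmeasure R.
Hypothesis mM : measurable_fun setT M.
Hypothesis wM : forall w, is_weighted_point_measure (M w).

Lemma measurable_mass_itv (i j : bool) (a b : R) :
  measurable_fun setT (fun w => M w [set` Interval (BSide i a) (BSide j b)]).
Proof. exact: (measurableT_comp (lf_mass_measurable i j a b) mM). Qed.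

Lemma measurable_fine_mass_itv (i j : bool) (a b : R) :
  measurable_fun setT (fun w => fine (M w [set` Interval (BSide i a) (BSide j b)])).
Proof. exact: (measurableT_comp (itv_mass_measurable i j a b) mM). Qed.

Lemma joint_mass_pos :
  measurable_fun setT (fun wr : W * measurableTypeR R => mass_pos (M wr.1) wr.2).
Proof.
apply: (@measurable_mono_right (fun w r => mass_pos (M w) r)).
- by move=> r; exact: measurable_fine_mass_itv.
- by move=> w; exact: mass_pos_mono.
- move=> w r c fc; have [s smu] := point_measure_atoms (r + 1) (wM w).
  have rr1 : r < r + 1 by rewrite ltrDl.
  have [q /andP[rq qr] qP] := right_gap (map snd s) rr1.
  exists q => //; rewrite (mass_pos_atoms smu qr).
  have r1 : r <= r + 1 by rewrite lerDl.
  rewrite (mass_pos_atoms smu r1) in fc.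
  apply: le_lt_trans fc; rewrite le_eqVlt; apply/orP; left; apply/eqP.
  rewrite !big_seq; apply: eq_bigr => p ps; congr (_ * (_ && _)%:R).
  by apply: qP; exact: map_f.
Qed.

Lemma joint_mass_neg :
  measurable_fun setT (fun wr : W * measurableTypeR R => mass_neg (M wr.1) wr.2).
Proof.
apply: (@measurable_mono_left (fun w r => mass_neg (M w) r)).
- by move=> r; exact: measurable_fine_mass_itv.
- by move=> w; exact: mass_neg_mono.
- move=> w r c fc; have [s smu] := point_measure_atoms r (wM w).
  have [q qr qP] := left_gap (map (fun p => - p.2) s) r.
  exists q => //; rewrite (mass_neg_atoms smu (ltW qr)).
  rewrite (mass_neg_atoms smu (lexx r)) in fc.
  apply: lt_le_trans fc _; rewrite le_eqVlt; apply/orP; left; apply/eqP.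
  rewrite !big_seq; apply: eq_bigr => p ps; congr (_ * (_ && _)%:R).
  by rewrite qP//; exact: (map_f (fun p => - p.2)).
Qed.

Lemma joint_balance :
  measurable_fun setT (fun wr : W * measurableTypeR R => balance (M wr.1) wr.2).
Proof.
apply: measurable_funB; first exact: joint_mass_pos.
apply: (@measurable_mono_right (fun w r => fine (M w `[(- r), 0[%classic))).
- by move=> r; exact: measurable_fine_mass_itv.
- move=> w x y xy; rewrite fine_le ?lf_itv_fin//.
  by apply: le_measure; rewrite ?inE//; apply: subset_itvr; rewrite bnd_simp lerN2.
- move=> w r c fc; have [s smu] := point_measure_atoms (r + 1) (wM w).
  have rr1 : r < r + 1 by rewrite ltrDl.
  have [q /andP[rq qr] qP] := right_gap (map (fun p => - p.2) s) rr1.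
  exists q => //.
  have E x : x <= r + 1 -> fine (M w `[(- x), 0[%classic) =
      \sum_(p <- s) p.1 * ((p.2 < 0) && (- p.2 <= x))%:R.
    move=> xr; have := balance_atoms smu xr; rewrite /balance.
    rewrite -[X in X - _ = _]/(mass_pos (M w) x) (mass_pos_atoms smu xr).
    by move=> /addrI/oppr_inj.
  have r1 : r <= r + 1 by rewrite lerDl.
  rewrite (E _ qr); rewrite (E _ r1) in fc.
  apply: le_lt_trans fc; rewrite le_eqVlt; apply/orP; left; apply/eqP.
  rewrite !big_seq; apply: eq_bigr => p ps; congr (_ * (_ && _)%:R).
  by rewrite qP//; exact: (map_f (fun p => - p.2)).
Qed.

Lemma joint_discrepancy K :
  measurable_fun setT (fun wr : W * measurableTypeR R => discrepancy (M wr.1) K wr.2).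
Proof.
have m2 : measurable_fun setT (fun wr : W * measurableTypeR R => K * (wr.2 : R)).
  apply: measurable_funM; first exact: measurable_cst.
  exact: measurable_snd.
apply: measurable_funD; apply: measurableT_comp => //; apply: measurable_funB => //.
- exact: joint_mass_pos.
- exact: joint_mass_neg.
Qed.

End joint.

Section tonelli.
Context {R : realType} {d : measure_display} {W : measurableType d}.
Variable P : probability W R.
Notation leb := (@lebesgue_measure R).

Variables (phi : R -> R) (T : W * measurableTypeR R -> R) (a b : R).
Hypotheses (mphi : measurable_fun `[a, b] phi) (phi0 : forall r, 0 <= phi r).
Hypotheses (mT : measurable_fun setT T) (T0 : forall z, 0 <= T z).

Let I : set (measurableTypeR R) := `[a, b]%classic.
Let F (z : W * measurableTypeR R) : \bar R := (((phi \_ I) z.2 * T z)%:E).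

Let mF : measurable_fun setT F.
Proof.
apply/measurable_EFinP; apply: measurable_funM => //.
apply: (measurableT_comp (f := phi \_ I)); last exact: measurable_snd.
apply/(measurable_restrictT _ _).1 => //; exact: measurable_itv.
Qed.

Let F0 z : (0 <= F z)%E.
Proof.
by rewrite lee_fin mulr_ge0// patchE; case: ifPn.
Qed.

Let FE w : (\int[leb]_(r in `[a, b]) (phi r * T (w, r))%:E = \int[leb]_r F (w, r))%E.
Proof.
rewrite integral_mkcond; apply: eq_integral => r _; rewrite /F !patchE /=.
by case: ifPn => // _; rewrite mul0r.
Qed.

Lemma measurable_param_integral :
  measurable_fun setT (fun w => \int[leb]_(r in `[a, b]) (phi r * T (w, r))%:E)%E.
Proof.
under eq_fun do rewrite FE.
exact: (measurable_fun_fubini_tonelli_F F mF F0).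
Qed.

(** Tonelli, with a weight [phi] that does not depend on the sample point. *)
Lemma expectation_integral :
  (\int[P]_w \int[leb]_(r in `[a, b]) (phi r * T (w, r))%:E =
   \int[leb]_(r in `[a, b]) ((phi r)%:E * \int[P]_w (T (w, r))%:E))%E.
Proof.
under eq_integral do rewrite FE.
rewrite (fubini_tonelli F mF F0) [RHS]integral_mkcond; apply: eq_integral => r _.
under eq_integral do rewrite /F /= patchE.
rewrite patchE; case: ifPn => [_|_]; last first.
  by under eq_integral do rewrite mul0r; rewrite integral0.
under eq_integral do rewrite EFinM.
rewrite ge0_integralZl//.
- apply/measurable_EFinP.
  exact: measurableT_comp mT (pair2_measurable r).
- by move=> w _; rewrite lee_fin.
- by rewrite lee_fin.
Qed.

Lemma measurable_param_expectation :
  measurable_fun setT (fun r : measurableTypeR R => \int[P]_w (T (w, r))%:E)%E.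
Proof.
apply: (measurable_fun_fubini_tonelli_G (fun z => (T z)%:E)).
  exact/measurable_EFinP.
by move=> z; rewrite lee_fin.
Qed.

End tonelli.

Section expectation_bound.
Context {R : realType} {d : measure_display} {W : measurableType d}.
Variables (P : probability W R) (M : W -> lfmeasure R) (K : R) (hM : R -> R).
Notation leb := (@lebesgue_measure R).
Hypothesis mM : measurable_fun setT M.
Hypothesis wM : forall w, is_weighted_point_measure (M w).
Hypothesis K0 : 0 < K.
Hypothesis E_small : forall r : R, 0 <= r -> r <= 1 ->
  (\int[P]_w (discrepancy (M w) K r)%:E <= (4 * K)%:E)%E.
Hypothesis hMi : tail_integrable hM.
Hypothesis E_large : forall r, 1 <= r ->
  (\int[P]_w (discrepancy (M w) K r)%:E <= (2 * hM r)%:E)%E.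

(** Bounds, uniformly in L, the mean error of the integration by parts at height Y:
    the first term accounts for radii below 1 through the intensity, the second for
    the other radii through [hM]. *)
Definition parts_bound Y : \bar R :=
  ((20 * K / Y ^+ 2)%:E + \int[leb]_(r in `[1%R, +oo[) (10 * lor Y r * hM r)%:E)%E.

Lemma expectation_discrepancy Y L : 0 < Y -> 0 < L ->
  (\int[P]_w \int[leb]_(r in `[0%R, (2 * L)%R])
     (5 * lor Y r * discrepancy (M w) K r)%:E <= parts_bound Y)%E.
Proof.
move=> Y0 L0; case: hMi => mh h0 hi.
have mlor : measurable_fun setT (fun r => 5 * lor Y r).
  apply: measurable_funM; first exact: measurable_cst.
  by apply: continuous_measurable_fun; exact: continuous_lor.
have lor0 r : 0 <= 5 * lor Y r by rewrite mulr_ge0// ltW// lor_gt0.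
have mT := joint_discrepancy mM wM K.
have T0 (z : W * measurableTypeR R) : 0 <= discrepancy (M z.1) K z.2.
  by rewrite addr_ge0.
rewrite (expectation_integral P (phi := fun r => 5 * lor Y r)
  (T := fun z => discrepancy (M z.1) K z.2))//; last exact: measurable_funTS.
pose G r := (\int[P]_w (discrepancy (M w) K r)%:E)%E.
have G0 r : (0 <= G r)%E by apply: integral_ge0 => w _; rewrite lee_fin addr_ge0.
have mG : measurable_fun setT G by exact: (measurable_param_expectation P mT T0).
have mH : measurable_fun setT (fun r => (5 * lor Y r)%:E * G r)%E.
  by apply: emeasurable_funM => //; exact/measurable_EFinP.
have H0 r : (0 <= (5 * lor Y r)%:E * G r)%E by rewrite mule_ge0// lee_fin.
apply: (@le_trans _ _ (\int[leb]_(r in `[0%R, +oo[) ((5 * lor Y r)%:E * G r))%E).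
  apply: ge0_subset_integral => //; [exact: measurable_funTS|by apply: subset_itvl; rewrite bnd_simp].
rewrite (@itv_bndbnd_setU _ _ _ (BLeft (1 : R))) ?bnd_simp//.
rewrite ge0_integral_setU//=; last 2 first.
- exact: measurable_funTS.
- apply/disj_setPLR => r /=; rewrite !in_itv/= andbT => /andP[_ r1].
  by apply/negP; rewrite -ltNge.
apply: leeD.
- apply: (@le_trans _ _ (\int[leb]_(r in `[0%R, 1%R[) (20 * K / Y ^+ 2)%:E)%E).
    apply: ge0_le_integral => //=.
    + exact: measurable_funTS.
    + move=> r; rewrite in_itv/= => /andP[r0 r1].
      have -> : 20 * K / Y ^+ 2 = (5 * Y ^- 2) * (4 * K) by ring.
      rewrite [leRHS]EFinM lee_pmul//; [by rewrite lee_fin| |exact: E_small (ltW r1)].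
      rewrite lee_fin ler_pM2l// lef_pV2 ?posrE ?lor_den_gt0 ?exprn_gt0//.
      by rewrite lerDr sqr_ge0.
  rewrite integral_cst//= lebesgue_measure_itv/= lte_fin ltr01 sube0 mule1//.
- apply: ge0_le_integral => //=.
  + exact: measurable_funTS.
  + apply/measurable_EFinP; apply: measurable_funM => //; apply: measurable_funTS.
    apply: measurable_funM; first exact: measurable_cst.
    by apply: continuous_measurable_fun; exact: continuous_lor.
  + move=> r; rewrite in_itv/= andbT => r1.
    have -> : 10 * lor Y r * hM r = 5 * lor Y r * (2 * hM r) by ring.
    by rewrite [leRHS]EFinM lee_wpmul2l ?lee_fin//; exact: E_large.
Qed.

Let lor_hM_le (Y r : R) : 0 < Y -> 1 <= r ->
  0 <= 10 * lor Y r * hM r <= 10 * (hM r / r ^+ 2).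
Proof.
move=> Y0 r1; case: hMi => _ h0 _; have r0 : 0 < r by exact: lt_le_trans r1.
rewrite !mulr_ge0 ?h0 ?(ltW (lor_gt0 _ _))//= -mulrA ler_pM2l//.
rewrite [leRHS]mulrC ler_wpM2r ?h0// lef_pV2 ?posrE ?lor_den_gt0 ?exprn_gt0//.
by rewrite lerDl sqr_ge0.
Qed.

Let measurable_lor_hM (Y : R) : 0 < Y ->
  measurable_fun (`[1, +oo[%classic : set R) (fun r : R => (10 * lor Y r * hM r)%:E).
Proof.
move=> Y0; case: hMi => mh _ _.
apply/measurable_EFinP; apply: measurable_funM => //; apply: measurable_funTS.
apply: measurable_funM; first exact: measurable_cst.
by apply: continuous_measurable_fun; exact: continuous_lor.
Qed.

Let hM_integrable :
  leb.-integrable `[1, +oo[ (fun r => (10 * (hM r / r ^+ 2))%:E).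
Proof.
case: hMi => mh h0 hi.
have h1 r : r \in (`[1, +oo[%classic : set R) -> 0 <= hM r / r ^+ 2.
  by rewrite inE/= in_itv/= andbT => r1; rewrite divr_ge0 ?h0 ?sqr_ge0.
have i1 : leb.-integrable `[1, +oo[ (EFin \o (fun r => hM r / r ^+ 2)).
  apply/integrableP; split.
    apply/measurable_EFinP; apply: measurable_funM => //; apply: measurable_funTS.
    apply: (measurableT_comp (@measurable_invr R)); exact: exprn_measurable.
  apply: le_lt_trans hi; rewrite le_eqVlt; apply/orP; left; apply/eqP.
  by apply: eq_integral => r rI /=; rewrite ger0_norm// h1.
by apply: eq_integrable (integrableZl _ 10 i1) => //.
Qed.

Lemma parts_bound_fin Y : 0 < Y -> (parts_bound Y < +oo)%E.
Proof.
move=> Y0; apply: lte_add_pinfty; first exact: ltry.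
case/integrableP : hM_integrable => mh; apply: le_lt_trans.
apply: ge0_le_integral => //=.
- by move=> r; rewrite in_itv/= andbT => /(lor_hM_le Y0)/andP[].
- exact: measurable_lor_hM.
- by apply: (measurableT_comp (@abse_measurable R setT) mh).
- move=> r; rewrite in_itv/= andbT => /(lor_hM_le Y0)/andP[_ h].
  by rewrite lee_fin (le_trans h)// ler_norm.
Qed.

(** The Lorentzian is at most r^-2 and vanishes as Y grows, so the tail
    integrability of [hM] gives dominated convergence. *)
Lemma parts_bound_cvg e B : 0 < e ->
  exists2 Y, B <= Y & (parts_bound Y < e%:E)%E.
Proof.
move=> e0.
have nY n : 0 < n.+1%:R :> R by rewrite ltr0n.
have := @dominated_cvg _ _ R leb (`[1, +oo[%classic : set R)
  (measurable_itv _) (fun n r => (10 * lor n.+1%:R r * hM r)%:E) (cst 0)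
  (fun r => (10 * (hM r / r ^+ 2))%:E).
rewrite integral0 => cv.
have {}cv : (\int[leb]_(r in `[1%R, +oo[) (10 * lor n.+1%:R r * hM r)%:E)%E
    @[n --> \oo] --> 0%E.
  apply: cv => //.
  - by move=> n; exact: measurable_lor_hM.
  - move=> r _; apply: cvg_EFin; first exact: nearW.
    have : 10 * lor n.+1%:R r * hM r @[n --> \oo] --> (10 * 0 * hM r : R).
      apply: cvgM; last exact: cvg_cst.
      apply: cvgM; first exact: cvg_cst.
      apply/cvgr0Pnorm_lt => a a0; near=> n.
      rewrite gtr0_norm ?lor_gt0// /lor invf_plt ?posrE ?lor_den_gt0//.
      apply: (@lt_le_trans _ _ n.+1%:R).
        by rewrite -[ltRHS]natr1 ltr_wpDr//; near: n; exact: nbhs_infty_gtr.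
      apply: (@le_trans _ _ (n.+1%:R ^+ 2)); last by rewrite lerDr sqr_ge0.
      by rewrite expr2 ler_peMl// ler1n.
    by rewrite mulr0 mul0r.
  - move=> n r; rewrite /= in_itv/= andbT => r1.
    have /andP[h1 h2] := lor_hM_le (nY n) r1.
    by rewrite lee_fin ger0_norm.
have e2 : 0 < e / 2 by rewrite divr_gt0.
move/fine_cvgP : (cv) => [fcv /cvgrPdist_lt/(_ _ e2) hcv].
have [N _ HN] : \forall n \near \oo, B <= n.+1%:R /\ (parts_bound n.+1%:R < e%:E)%E.
  near=> n; split.
    by rewrite -[leRHS]natr1 ler_wpDr//; near: n; exact: nbhs_infty_ger.
  rewrite /parts_bound (splitr e) EFinD lteD//.
    rewrite lte_fin ltr_pdivrMr ?exprn_gt0// [ltRHS]mulrC -ltr_pdivrMr//.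
    apply: (@lt_le_trans _ _ n.+1%:R).
      by rewrite -[ltRHS]natr1 ltr_wpDr//; near: n; exact: nbhs_infty_gtr.
    by rewrite expr2 ler_peMl// ler1n.
  have : `|0 - fine (\int[leb]_(r in `[1%R, +oo[) (10 * lor n.+1%:R r * hM r)%:E)%E| < e / 2.
    by near: n; exact: hcv.
  rewrite sub0r normrN => /(le_lt_trans (ler_norm _)) h'.
  have fn : (\int[leb]_(r in `[1%R, +oo[) (10 * lor n.+1%:R r * hM r)%:E \is a fin_num)%E.
    by near: n; exact: fcv.
  by rewrite -(fineK fn) lte_fin.
by exists N.+1%:R; have [] := HN N (leqnn _).
Unshelve. all: by end_near. Qed.

End expectation_bound.

(** * Resolvent functionals and stationarity *)

Section functionals.
Variable R : realType.
Implicit Types (mu : lfmeasure R) (L x y r Y K t a b : R).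

(** The pole is moved to t + i y while the cutoff stays centred at 0. *)
Definition FReS L t y mu : R := \int[mu]_x (cutoff L x * kerRe y (x - t)).
Definition FImS L t y mu : R := \int[mu]_x (cutoff L x * kerIm y (x - t)).

Lemma FReS0 L y mu : FReS L 0 y mu = FRe L y mu.
Proof. by apply: eq_Rintegral => x _; rewrite subr0. Qed.

Lemma FImS0 L y mu : FImS L 0 y mu = FIm L y mu.
Proof. by apply: eq_Rintegral => x _; rewrite subr0. Qed.

Lemma continuous_comp_subr (f : R -> R) t : continuous f -> continuous (fun x => f (x - t)).
Proof.
move=> cf x; apply: continuous_comp; last exact: cf.
by apply: cvgB; [exact: cvg_id|exact: cvg_cst].
Qed.

Lemma cutoffM_continuous L (f : R -> R) : continuous f ->
  continuous (fun x => cutoff L x * f x).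
Proof. by move=> cf x; apply: cvgM; [exact: continuous_cutoff|exact: cf]. Qed.

Lemma cutoffM_support L (f : R -> R) x : 0 < L -> 2 * L < `|x| ->
  cutoff L x * f x = 0.
Proof. by move=> L0 xL; rewrite cutoff0 ?mul0r// ltW. Qed.

Lemma cpt_integral_continuous (f : R -> R) B : continuous f ->
  (forall x, B < `|x| -> f x = 0) ->
  continuous (fun mu : lfmeasure R => \int[mu]_x f x).
Proof.
move=> cf fB.
exact: (@test_integral_continuous R (TestFunction cf (cpt_support fB))).
Qed.

Lemma cpt_integrable mu (f : R -> R) B : continuous f ->
  (forall x, B < `|x| -> f x = 0) -> mu.-integrable setT (EFin \o f).
Proof.
move=> cf fB.
exact: (test_integrable mu (TestFunction cf (cpt_support fB))).
Qed.

Lemma continuous_FReS L t y : 0 < L -> 0 < y -> continuous (FReS L t y).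
Proof.
move=> L0 y0.
apply: (@cpt_integral_continuous (fun x => cutoff L x * kerRe y (x - t)) (2 * L)).
  apply: cutoffM_continuous; apply: continuous_comp_subr.
  exact: continuous_kerRe.
by move=> x; exact: (@cutoffM_support L (fun x => kerRe y (x - t))).
Qed.

Lemma continuous_FImS L t y : 0 < L -> 0 < y -> continuous (FImS L t y).
Proof.
move=> L0 y0.
apply: (@cpt_integral_continuous (fun x => cutoff L x * kerIm y (x - t)) (2 * L)).
  apply: cutoffM_continuous; apply: continuous_comp_subr.
  exact: continuous_kerIm.
by move=> x; exact: (@cutoffM_support L (fun x => kerIm y (x - t))).
Qed.

Lemma kerIm_ge0 y x : 0 < y -> 0 <= kerIm y x.
Proof. by move=> y0; rewrite divr_ge0 ?(ltW y0)// addr_ge0 ?sqr_ge0. Qed.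

Lemma FImS_ge0 L t y mu : 0 < y -> 0 <= FImS L t y mu.
Proof.
move=> y0; apply: Rintegral_ge0 => x _.
by rewrite mulr_ge0 ?cutoff_ge0 ?kerIm_ge0.
Qed.

(** Real part and minus the imaginary part of the resolvent 1 / (F + b + i a), where F
    is the transform of the cut-off measure at t + i y. *)
Definition pS a b L t y mu : R := resRe a b (FReS L t y mu) (FImS L t y mu).
Definition qS a b L t y mu : R := resIm a b (FReS L t y mu) (FImS L t y mu).

Lemma res_den_gt0 a b (u v : R) : 0 < a -> 0 <= v -> 0 < (u + b) ^+ 2 + (v + a) ^+ 2.
Proof. by move=> a0 v0; rewrite ltr_wpDl ?sqr_ge0// exprn_gt0// ltr_wpDl. Qed.

Lemma continuous_res (T : topologicalType) (u v : T -> R) a b : 0 < a ->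
  continuous u -> continuous v -> (forall z, 0 <= v z) ->
  continuous (fun z => resRe a b (u z) (v z)) /\
  continuous (fun z => resIm a b (u z) (v z)).
Proof.
move=> a0 cu cv v0.
have d1 z : {for z, continuous (fun z => u z + b)}.
  by apply: cvgD; [exact: cu|exact: cvg_cst].
have d2 z : {for z, continuous (fun z => v z + a)}.
  by apply: cvgD; [exact: cv|exact: cvg_cst].
have d z : {for z, continuous (fun z => ((u z + b) ^+ 2 + (v z + a) ^+ 2)^-1)}.
  apply: cvgV; first by rewrite gt_eqF// res_den_gt0.
  apply: cvgD; [exact: (cvgM (d1 z) (d1 z))|exact: (cvgM (d2 z) (d2 z))].
by split => z; apply: cvgM; [exact: d1|exact: d|exact: d2|exact: d].
Qed.

Lemma continuous_pS a b L t y : 0 < a -> 0 < L -> 0 < y -> continuous (pS a b L t y).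
Proof.
move=> a0 L0 y0; apply: (@continuous_res _ _ _ a b a0 _ _ _).1.
- exact: continuous_FReS.
- exact: continuous_FImS.
- by move=> mu; exact: FImS_ge0.
Qed.

Lemma continuous_qS a b L t y : 0 < a -> 0 < L -> 0 < y -> continuous (qS a b L t y).
Proof.
move=> a0 L0 y0; apply: (@continuous_res _ _ _ a b a0 _ _ _).2.
- exact: continuous_FReS.
- exact: continuous_FImS.
- by move=> mu; exact: FImS_ge0.
Qed.

Lemma translateE t mu (B : set R) :
  lf_translate t mu B = mu ((fun x => x - t) @^-1` B).
Proof.
rewrite /= /translate; congr (mu _).
apply/seteqP; split => [_ [x Bx <-]|y /= By]; first by rewrite /= addrK.
by exists (y - t) => //; rewrite subrK.
Qed.

Lemma integral_translate t mu (f : R -> R) B : continuous f ->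
  (forall x, B < `|x| -> f x = 0) ->
  \int[lf_translate t mu]_x f x = \int[mu]_x f (x - t).
Proof.
move=> cf fB; congr fine.
have mt : measurable_fun setT ((fun x => x - t) : measurableTypeR R -> measurableTypeR R).
  exact: measurable_funB.
pose nu : {measure set (measurableTypeR R) -> \bar R} :=
  measure_function_pushforward__canonical__measure_function_Measure mu mt.
rewrite (@eq_measure_integral _ (measurableTypeR R) R setT nu); last first.
  by move=> A mA _; rewrite translateE.
rewrite [LHS](@integral_pushforward _ _ (measurableTypeR R) (measurableTypeR R) R
   (fun x => x - t) mt mu setT (EFin \o f)) //.
- apply/measurable_EFinP; exact: continuous_measurable_fun.
- apply: (@cpt_integrable mu (fun x => f (x - t)) (B + `|t|)).
    exact: continuous_comp_subr.
  move=> x xB; apply: fB; rewrite -ltrBrDr in xB; apply: (lt_le_trans xB).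
  by rewrite lerBlDr (le_trans _ (ler_normD _ _))// subrK.
Qed.

End functionals.

Section stationary.
Context {R : realType} {d : measure_display} {W : measurableType d}.
Variables (P : probability W R) (M : {RV P >-> lfmeasure R}).
Hypothesis stat : stationary P M.

(** Stationarity is an equality of laws of random measures, hence of the laws of
    [F] on the extended line, against which both expectations are computed. *)
Lemma stationary_ge0_integral t (F : lfmeasure R -> \bar R) :
  measurable_fun setT F -> (forall mu, 0 <= F mu)%E ->
  measurable_fun setT (fun w => F (lf_translate t (M w))) ->
  (\int[P]_w F (lf_translate t (M w)) = \int[P]_w F (M w))%E.
Proof.
move=> mF F0 mFt.
have mM : measurable_fun setT (M : W -> lfmeasure R) by [].
have mFM : measurable_fun setT (fun w => F (M w)) by exact: measurableT_comp.
have E (X : W -> \bar R) : measurable_fun setT X -> (forall w, 0 <= X w)%E ->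
   (\int[P]_w X w = \int[pushforward P X]_y `|y|)%E.
  move=> mX X0; rewrite ge0_integral_pushforward//=.
  by apply: eq_integral => w _; rewrite gee0_abs.
rewrite E// E//.
have mt' : {measure set (\bar R) -> \bar R} :=
  measure_function_pushforward__canonical__measure_function_Measure P mFt.
apply: eq_measure_integral => A mA _.
rewrite /pushforward -[X in _ = P X]/((M : W -> lfmeasure R) @^-1` (F @^-1` A)).
rewrite -(stat t) //.
by rewrite -[X in measurable X]setTI; exact: mF.
Qed.

End stationary.

Section prob.
Context {R : realType} {d : measure_display} {W : measurableType d}.
Variables (P : probability W R).
Implicit Types (f g h : W -> R).

Lemma bounded_prob_integrable f C : measurable_fun setT f ->
  (forall w, `|f w| <= C) -> P.-integrable setT (EFin \o f).
Proof.
move=> mf fC; apply: measurable_bounded_integrable => //.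
  by rewrite ltey_eq fin_num_measure.
exists C; split; first exact: num_real.
by move=> x Cx w _; exact: le_trans (fC w) (ltW Cx).
Qed.

Lemma Rintegral_dist f g : P.-integrable setT (EFin \o f) ->
  P.-integrable setT (EFin \o g) ->
  ((`|\int[P]_w f w - \int[P]_w g w|)%:E <= \int[P]_w (`|f w - g w|)%:E)%E.
Proof.
move=> fi gi.
have fgi : P.-integrable setT (EFin \o (fun w => f w - g w)).
  by apply: eq_integrable (integrableB _ fi gi).
rewrite -RintegralB// EFin_normr_Rintegral//.
by apply: le_abse_integral => //; case/integrableP : fgi.
Qed.

Lemma Rintegral_dist_le f g h c : P.-integrable setT (EFin \o f) ->
  P.-integrable setT (EFin \o g) -> measurable_fun setT h ->
  (forall w, `|f w - g w| <= h w) -> (\int[P]_w (h w)%:E <= c%:E)%E ->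
  `|\int[P]_w f w - \int[P]_w g w| <= c.
Proof.
move=> fi gi mh fgh hc; rewrite -lee_fin.
apply: (le_trans (Rintegral_dist fi gi)); apply: le_trans hc.
have fgi : P.-integrable setT (EFin \o (fun w => f w - g w)).
  by apply: eq_integrable (integrableB _ fi gi).
apply: ge0_le_integral => //=.
- case/integrableP : fgi => mfg _.
  exact: (measurableT_comp (@abse_measurable R setT) mfg).
- exact/measurable_EFinP.
- by move=> w _; rewrite lee_fin.
Qed.

End prob.

Section stationary_moments.
Context {R : realType} {d : measure_display} {W : measurableType d}.
Variables (P : probability W R) (M : {RV P >-> lfmeasure R}) (K : R) (hM : R -> R).
Hypothesis wM : forall w, is_weighted_point_measure (M w).
Hypothesis stat : stationary P M.
Hypothesis K0 : 0 < K.
Hypothesis MK : intensity P M = K%:E.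
Hypothesis hMi : tail_integrable hM.
Hypothesis hMb : forall x : R, 1 <= `|x| ->
  ('E_P[fun w => (`|counting_function (M w) x - K * x|)%R] <= (hM `|x|)%:E)%E.

Let mM : measurable_fun setT (M : W -> lfmeasure R).
Proof. by []. Qed.

Lemma expectation_mass1 a :
  (\int[P]_w M w `]a, (a + 1)%R]%classic = K%:E)%E.
Proof.
rewrite -MK /intensity.
have tE w : M w `]a, (a + 1)%R]%classic =
    lf_translate a (M w) `]0%R, 1%R]%classic.
  rewrite translateE; congr (M w _); apply/seteqP; split => x /=;
  by rewrite !in_itv/= subr_gt0 lerBlDr (addrC 1).
under eq_integral do rewrite tE.
apply: (stationary_ge0_integral (F := fun mu => mu `]0%R, 1%R]%classic) stat).
- exact: lf_mass_measurable.
- by [].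
- under eq_fun do rewrite -tE; exact: measurable_mass_itv.
Qed.

Lemma expectation_mass a n :
  (\int[P]_w M w `]a, (a + n%:R)%R]%classic = (n%:R * K)%:E)%E.
Proof.
elim: n => [|n IH].
  rewrite mul0r addr0; under eq_integral do rewrite set_itvoc0 measure0.
  by rewrite integral0.
have E w : M w `]a, (a + n.+1%:R)%R]%classic =
   (M w `]a, (a + n%:R)%R]%classic + M w `](a + n%:R)%R, (a + n%:R + 1)%R]%classic)%E.
  rewrite -natr1 addrA -measureU//.
    rewrite -itv_bndbnd_setU// bnd_simp ?lerDl//.
  apply/seteqP; split => x //= [] /=; rewrite !in_itv/= => /andP[_ h1] /andP[h2 _].
  by move: (lt_le_trans h2 h1); rewrite ltxx.
under eq_integral do rewrite E.
rewrite ge0_integralD//; [|exact: measurable_mass_itv|exact: measurable_mass_itv].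
by rewrite IH expectation_mass1 -EFinD -natr1 mulrDl mul1r.
Qed.

Lemma mass_fine w (i j : bool) (a b : R) :
  (fine (M w [set` Interval (BSide i a) (BSide j b)]))%:E =
  M w [set` Interval (BSide i a) (BSide j b)].
Proof. by rewrite fineK// lf_itv_fin. Qed.

(** Masses increase with the radius, so radius 1 controls all smaller ones. *)
Lemma expectation_discrepancy_small r : 0 <= r -> r <= 1 ->
  (\int[P]_w (discrepancy (M w) K r)%:E <= (4 * K)%:E)%E.
Proof.
move=> r0 r1.
have m1 := measurable_fine_mass_itv mM false false 0 1.
have m2 := measurable_fine_mass_itv mM false false (- 1) 0.
have mp := measurable_fine_mass_itv mM false false 0 r.
have mn := measurable_fine_mass_itv mM false false (- r) 0.
apply: (@le_trans _ _ (\int[P]_w (M w `]0%R, 1%R]%classic + (M w `](- 1)%R, 0%R]%classic + (2 * K)%:E)))%E).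
  apply: ge0_le_integral => //.
  - by move=> w _; rewrite lee_fin addr_ge0.
  - apply/measurable_EFinP; apply: measurable_funD; apply: measurableT_comp => //;
    by apply: measurable_funB => //; exact: measurable_cst.
  - apply: emeasurable_funD; first exact: measurable_mass_itv.
    by apply: emeasurable_funD; [exact: measurable_mass_itv|exact: measurable_cst].
  - move=> w _; rewrite -(mass_fine w false false 0 1).
    rewrite -(mass_fine w false false (- 1) 0) -!EFinD lee_fin /discrepancy.
    have h1 := mass_pos_mono (M w) r1.
    have h2 := mass_neg_mono (M w) r1.
    have p0 : 0 <= mass_pos (M w) r by exact: fine_ge0.
    have n0 : 0 <= mass_neg (M w) r by exact: fine_ge0.
    have Kr0 : 0 <= K * r by rewrite mulr_ge0// ltW.
    have Kr1 : K * r <= K by rewrite ler_piMr// ltW.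
    rewrite -[fine (M w `]0%R, 1%R]%classic)]/(mass_pos (M w) 1).
    rewrite -[fine (M w `](- 1)%R, 0%R]%classic)]/(mass_neg (M w) 1).
    have e1 : `|mass_pos (M w) r - K * r| <= mass_pos (M w) 1 + K.
      by rewrite ler_norml; apply/andP; split; lra.
    have e2 : `|mass_neg (M w) r - K * r| <= mass_neg (M w) 1 + K.
      by rewrite ler_norml; apply/andP; split; lra.
    lra.
have e1 := expectation_mass1 0; rewrite add0r in e1.
have e2 := expectation_mass1 (- 1); rewrite addNr in e2.
rewrite ge0_integralD//; last 3 first.
- exact: measurable_mass_itv.
- by move=> w _; rewrite adde_ge0// lee_fin mulr_ge0// ltW.
- by apply: emeasurable_funD; [exact: measurable_mass_itv|exact: measurable_cst].
rewrite ge0_integralD//; last 2 first.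
- exact: measurable_mass_itv.
- by move=> w _; rewrite lee_fin mulr_ge0// ltW.
rewrite e1 e2 integral_cst//= probability_setT mule1 -!EFinD lee_fin; lra.
Qed.

Lemma expectation_discrepancy_large r : 1 <= r ->
  (\int[P]_w (discrepancy (M w) K r)%:E <= (2 * hM r)%:E)%E.
Proof.
move=> r1; have r0 : 0 < r by exact: lt_le_trans r1.
have mp := measurable_fine_mass_itv mM false false 0 r.
have mn := measurable_fine_mass_itv mM false false (- r) 0.
have h1 := hMb (x := r); have h2 := hMb (x := - r).
rewrite unlock normrN !(gtr0_norm r0) in h1 h2.
rewrite (_ : (2 * hM r)%:E = (hM r)%:E + (hM r)%:E)%E; last first.
  by rewrite -EFinD; congr EFin; ring.
rewrite /discrepancy; under eq_integral do rewrite EFinD.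
rewrite ge0_integralD//; last 2 first.
- apply/measurable_EFinP; apply: measurableT_comp => //.
  by apply: measurable_funB => //; exact: measurable_cst.
- apply/measurable_EFinP; apply: measurableT_comp => //.
  by apply: measurable_funB => //; exact: measurable_cst.
apply: leeD.
  apply: le_trans (h1 r1); rewrite le_eqVlt; apply/orP; left; apply/eqP.
  by apply: eq_integral => w _; rewrite /counting_function ltW.
apply: le_trans (h2 r1); rewrite le_eqVlt; apply/orP; left; apply/eqP.
apply: eq_integral => w _; rewrite /counting_function leNgt oppr_lt0 r0/=.
by congr EFin; rewrite -normrN; congr (`|_|); rewrite /mass_neg; ring.
Qed.

End stationary_moments.

(** * The expected resolvent of a stationary measure *)

Section pathwise.
Variable R : realType.
Implicit Types (mu : lfmeasure R) (L x y r Y K t a b m eta : R) (k : R -> R).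

(** The two cutoffs differ by O(eta / m), and only where |x - eta| >= m / 2, so that
    the kernel is O(1 / m) there; this leaves eta / m^2 times the mass of a window. *)
Lemma shift_cutoff_le k mu eta m : is_weighted_point_measure mu ->
  continuous k -> (forall t, `|t| * `|k t| <= 1) -> 0 < eta -> eta <= 1 -> 4 <= m ->
  `|\int[mu]_x (cutoff m x * k (x - eta)) -
    \int[mu]_x (cutoff m (x - eta) * k (x - eta))|
  <= 4 * eta / m ^+ 2 * fine (mu `](- (3 * m)), (3 * m)]%classic).
Proof.
move=> wmu ck k1 e0 e1 m4.
have m0 : 0 < m by apply: lt_le_trans m4.
have [s smu] := point_measure_atoms (3 * m) wmu.
have ck' : continuous (fun x => k (x - eta)) by exact: (continuous_comp_subr (f := k)).
have far x : 3 * m < `|x| \/ ~~ (- (3 * m) < x <= 3 * m) ->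
    cutoff m x = 0 /\ cutoff m (x - eta) = 0.
  move=> h; have xm : 3 * m <= `|x|.
    case: h => [/ltW//|]; rewrite negb_and -leNgt -ltNge => /orP[h|/ltW h].
      by apply: le_trans (_ : - x <= _); [lra|rewrite -normrN ler_norm].
    by apply: le_trans h _; exact: ler_norm.
  split; apply: cutoff0 => //; first lra.
  have := ler_dist_dist x eta; rewrite (gtr0_norm e0).
  by move/(le_trans (ler_norm _)); lra.
rewrite !(atoms_Rintegral_support smu).
- case: (smu) => s0 ->//; last first.
    by move=> x /=; rewrite !in_itv/= => /andP[/ltW -> ->].
  rewrite -sumrB mulr_sumr !big_seq.
  apply: (le_trans (ler_norm_sum _ _ _)); apply: ler_sum => p ps.
  have [p0 _] := s0 p ps.
  rewrite -mulrBr -mulrBl normrM (ger0_norm p0) [leRHS]mulrCA ler_wpM2l//.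
  rewrite indicE mem_setE in_itv/=.
  have [pI|pI] := boolP (- (3 * m) < p.2 <= 3 * m); last first.
    have [|-> ->] := far p.2; first by right.
    by rewrite subrr mul0r normr0 mulr0.
  rewrite mulr1 normrM.
  have [h|h] := leP (m / 2) `|p.2 - eta|.
    have c := cutoff_lipschitz p.2 (p.2 - eta) m0.
    have e : p.2 - (p.2 - eta) = eta by ring.
    rewrite e (gtr0_norm e0) in c.
    have kk : `|k (p.2 - eta)| <= 2 / m.
      have := k1 (p.2 - eta); rewrite mulrC => h1.
      rewrite ler_pdivlMr// -(ler_pM2r (_ : 0 < 2^-1 :> R)) ?invr_gt0//.
      rewrite mulfV// -mulrA; apply: le_trans h1; rewrite ler_wpM2l//.
    apply: (le_trans (ler_pM _ _ c kk)) => //.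
    have -> : 2 / m * eta * (2 / m) = 4 * eta / m ^+ 2 by field; rewrite gt_eqF.
    by [].
  have h' : `|p.2| <= m.
    have := ler_dist_dist p.2 eta; rewrite (gtr0_norm e0).
    by move/(le_trans (ler_norm _)); lra.
  have -> : cutoff m p.2 = 1 by exact: cutoff1.
  have -> : cutoff m (p.2 - eta) = 1 by apply: cutoff1 => //; lra.
  rewrite subrr normr0 mul0r.
  by apply: divr_ge0; [rewrite mulr_ge0// ltW|exact: sqr_ge0].
- apply: continuous_measurable_fun => x; apply: cvgM; last exact: ck'.
  by apply: (continuous_comp_subr (f := cutoff m)); exact: continuous_cutoff.
- by move=> x xm; have [|_ ->] := far x; [left|rewrite mul0r].
- apply: continuous_measurable_fun => x; apply: cvgM; last exact: ck'.
  exact: continuous_cutoff.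
- by move=> x xm; have [|-> _] := far x; [left|rewrite mul0r].
Qed.

Lemma kerRe_le1 y t : 0 < y -> `|t| * `|kerRe y t| <= 1.
Proof.
move=> y0; have d0 := lor_den_gt0 t y0.
rewrite -normrM /kerRe mulrA normrM normfV (gtr0_norm d0) ler_pdivrMr// mul1r.
by rewrite -expr2 ger0_norm ?sqr_ge0// lerDl sqr_ge0.
Qed.

Lemma kerIm_le1 y t : 0 < y -> `|t| * `|kerIm y t| <= 1.
Proof.
move=> y0; have d0 := lor_den_gt0 t y0.
rewrite -normrM /kerIm mulrA normrM normfV (gtr0_norm d0) ler_pdivrMr// mul1r.
have := sqr_ge0 (t - y); have := sqr_ge0 (t + y).
have := sqr_ge0 t; have := sqr_ge0 y.
by rewrite sqrrB sqrrD ler_norml => h1 h2 h3 h4; apply/andP; split; lra.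
Qed.

(** Absorbing the cutoff in the masses leaves a finite measure. *)
Lemma pS_qS_cauchy_riemann mu L a b y eta : is_weighted_point_measure mu ->
  0 < L -> 0 < a -> 0 < y -> 0 < eta <= y ->
  `|(qS a b L 0 (y + eta) mu - qS a b L 0 y mu) +
    (pS a b L eta y mu - pS a b L 0 y mu)| <= 10 * eta ^+ 2 / (a * y ^+ 2).
Proof.
move=> wmu L0 a0 y0 ey; have /andP[e0 _] := ey.
have [s smu] := point_measure_atoms (2 * L) wmu.
(* Same positions, masses multiplied by the cutoff. *)
pose s' := [seq (p.1 * cutoff L p.2, p.2) | p <- s].
have s'0 p : p \in s' -> 0 <= p.1.
  by move=> /mapP[q /(proj1 smu)[q0 _] ->]; rewrite mulr_ge0 ?cutoff_ge0.
have Re t z : 0 < z -> FReS L t z mu = sumRe s' t z.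
  move=> z0; rewrite /FReS (atoms_Rintegral_support smu).
  - by rewrite /sumRe big_map; apply: eq_bigr => p _; rewrite mulrA.
  - apply: continuous_measurable_fun; apply: cutoffM_continuous.
    by apply: continuous_comp_subr; exact: continuous_kerRe.
  - by move=> x; exact: (@cutoffM_support _ L (fun x => kerRe z (x - t))).
have Im t z : 0 < z -> FImS L t z mu = sumIm s' t z.
  move=> z0; rewrite /FImS (atoms_Rintegral_support smu).
  - by rewrite /sumIm big_map; apply: eq_bigr => p _; rewrite mulrA.
  - apply: continuous_measurable_fun; apply: cutoffM_continuous.
    by apply: continuous_comp_subr; exact: continuous_kerIm.
  - by move=> x; exact: (@cutoffM_support _ L (fun x => kerIm z (x - t))).
have ye0 : 0 < y + eta by exact: addr_gt0.
rewrite /qS /pS !Re// !Im//.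
exact: resolvent_cauchy_riemann.
Qed.

End pathwise.

Section vertical_step.
Context {R : realType} {d : measure_display} {W : measurableType d}.
Variables (P : probability W R) (M : {RV P >-> lfmeasure R}) (K : R) (hM : R -> R).
Hypothesis wM : forall w, is_weighted_point_measure (M w).
Hypothesis stat : stationary P M.
Hypothesis K0 : 0 < K.
Hypothesis MK : intensity P M = K%:E.
Hypothesis hMi : tail_integrable hM.
Hypothesis hMb : forall x : R, 1 <= `|x| ->
  ('E_P[fun w => (`|counting_function (M w) x - K * x|)%R] <= (hM `|x|)%:E)%E.

Let mM : measurable_fun setT (M : W -> lfmeasure R).
Proof. by []. Qed.

Variables (a b : R).
Hypothesis a0 : 0 < a.

Let Ep L t y := \int[P]_w pS a b L t y (M w).
Let Eq L t y := \int[P]_w qS a b L t y (M w).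

Lemma continuous_lf_comp_measurable (F : lfmeasure R -> R) : continuous F ->
  measurable_fun setT (fun w => F (M w)).
Proof.
by move=> cF; apply: (measurableT_comp (continuous_lf_measurable cF)).
Qed.

Lemma measurable_pS L t y : 0 < L -> 0 < y ->
  measurable_fun setT (fun w => pS a b L t y (M w)).
Proof.
by move=> L0 y0; apply: continuous_lf_comp_measurable; exact: continuous_pS.
Qed.

Lemma measurable_qS L t y : 0 < L -> 0 < y ->
  measurable_fun setT (fun w => qS a b L t y (M w)).
Proof.
by move=> L0 y0; apply: continuous_lf_comp_measurable; exact: continuous_qS.
Qed.

Lemma normr_pS_le L t y (mu : lfmeasure R) : 0 < y -> `|pS a b L t y mu| <= a^-1.
Proof. by move=> y0; apply: normr_resRe_le => //; exact: FImS_ge0. Qed.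

Lemma normr_qS_le L t y (mu : lfmeasure R) : 0 < y -> `|qS a b L t y mu| <= a^-1.
Proof.
move=> y0; rewrite ger0_norm; first by apply: resIm_le => //; exact: FImS_ge0.
by apply: resIm_ge0 => //; exact: FImS_ge0.
Qed.

Lemma pS_integrable L t y : 0 < L -> 0 < y ->
  P.-integrable setT (EFin \o (fun w => pS a b L t y (M w))).
Proof.
move=> L0 y0; apply: (@bounded_prob_integrable _ _ _ _ _ a^-1).
  exact: measurable_pS.
by move=> w; exact: normr_pS_le.
Qed.

Lemma qS_integrable L t y : 0 < L -> 0 < y ->
  P.-integrable setT (EFin \o (fun w => qS a b L t y (M w))).
Proof.
move=> L0 y0; apply: (@bounded_prob_integrable _ _ _ _ _ a^-1).
  exact: measurable_qS.
by move=> w; exact: normr_qS_le.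
Qed.

Let FReT L eta y (mu : lfmeasure R) : R :=
  \int[mu]_x (cutoff L (x - eta) * kerRe y (x - eta)).
Let FImT L eta y (mu : lfmeasure R) : R :=
  \int[mu]_x (cutoff L (x - eta) * kerIm y (x - eta)).

Lemma pS_translate L eta y (mu : lfmeasure R) : 0 < L -> 0 < y ->
  pS a b L 0 y (lf_translate eta mu) = resRe a b (FReT L eta y mu) (FImT L eta y mu).
Proof.
move=> L0 y0; rewrite /pS FReS0 FImS0 /FRe /FIm.
rewrite (@integral_translate _ eta mu (fun x => cutoff L x * kerRe y x) (2 * L)).
- rewrite (@integral_translate _ eta mu (fun x => cutoff L x * kerIm y x) (2 * L)) //.
    by apply: cutoffM_continuous; exact: continuous_kerIm.
  by move=> x; exact: cutoffM_support.
- by apply: cutoffM_continuous; exact: continuous_kerRe.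
- by move=> x; exact: cutoffM_support.
Qed.

Let FT_continuous L eta (k : R -> R) : 0 < L -> continuous k ->
  continuous (fun mu : lfmeasure R => \int[mu]_x (cutoff L (x - eta) * k (x - eta))).
Proof.
move=> L0 ck; apply: (@cpt_integral_continuous _
  (fun x => cutoff L (x - eta) * k (x - eta)) (2 * L + `|eta|)).
  apply: (continuous_comp_subr (f := fun x => cutoff L x * k x)).
  exact: cutoffM_continuous.
move=> x xL; rewrite cutoff0 ?mul0r// ltW//.
have := ler_normD (x - eta) eta; rewrite subrK; lra.
Qed.

Lemma measurable_pS_translate L eta y : 0 < L -> 0 < y ->
  measurable_fun setT (fun w => pS a b L 0 y (lf_translate eta (M w))).
Proof.
move=> L0 y0; under eq_fun do rewrite pS_translate//.
apply: (@continuous_lf_comp_measurable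
  (fun mu => resRe a b (FReT L eta y mu) (FImT L eta y mu))).
apply: (@continuous_res _ _ (FReT L eta y) (FImT L eta y) a b a0 _ _ _).1.
- by apply: FT_continuous => //; exact: continuous_kerRe.
- by apply: FT_continuous => //; exact: continuous_kerIm.
- move=> mu; apply: Rintegral_ge0 => x _.
  by rewrite mulr_ge0 ?cutoff_ge0 ?kerIm_ge0.
Qed.

Lemma expectation_pS_translate L eta y : 0 < L -> 0 < y ->
  \int[P]_w pS a b L 0 y (lf_translate eta (M w)) = Ep L 0 y.
Proof.
move=> L0 y0; have mt := measurable_pS_translate eta L0 y0.
have m1 := measurable_pS 0 L0 y0.
have i1 := pS_integrable 0 L0 y0.
have i2 : P.-integrable setT
    (EFin \o (fun w => pS a b L 0 y (lf_translate eta (M w)))).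
  apply: (@bounded_prob_integrable _ _ _ _ _ a^-1) => // w.
  exact: normr_pS_le.
have ic : P.-integrable setT (EFin \o cst a^-1).
  apply: (@bounded_prob_integrable _ _ _ _ _ a^-1) => // w.
  by rewrite ger0_norm// invr_ge0 ltW.
(* Adding 1 / a makes the functional nonnegative, as transfer by stationarity requires. *)
apply: (@addIr _ (\int[P]_w a^-1)).
apply: (etrans (esym (RintegralD measurableT i2 ic))).
apply: (etrans _ (RintegralD measurableT i1 ic)); congr fine.
apply: (stationary_ge0_integral (F := fun mu => (pS a b L 0 y mu + a^-1)%:E) stat).
- apply/measurable_EFinP; apply: measurable_funD; last exact: measurable_cst.
  by apply: continuous_lf_measurable; exact: continuous_pS.
- move=> mu; rewrite lee_fin -lerBlDr sub0r.
  by have := normr_pS_le L 0 mu y0; rewrite ler_norml => /andP[].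
- by apply/measurable_EFinP; apply: measurable_funD => //; exact: measurable_cst.
Qed.

(** A horizontal move of the pole is a translation of the measure, except that the
    cutoff does not follow. Stationarity removes the translation, and the window of
    length 6 m has mean mass 6 m K, whence an error of order eta / m. *)
Lemma expectation_pS_shift (m : nat) eta y : (4 <= m)%N -> 0 < eta -> eta <= 1 -> 0 < y ->
  `|Ep m%:R eta y - Ep m%:R 0 y| <= 48 * eta * K / (a ^+ 2 * m%:R).
Proof.
move=> m4 e0 e1 y0; have m4' : 4 <= m%:R :> R by rewrite ler_nat.
have m0 : 0 < m%:R :> R by apply: lt_le_trans m4'.
rewrite -(expectation_pS_translate eta m0 y0).
pose c := 8 * eta / (a ^+ 2 * m%:R ^+ 2).
have c0 : 0 <= c by rewrite /c divr_ge0 ?mulr_ge0 ?sqr_ge0// ltW.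
pose mass w := fine (M w `](- (3 * m%:R)), (3 * m%:R)]%classic).
apply: (Rintegral_dist_le (h := fun w => c * mass w)).
- exact: pS_integrable.
- apply: (@bounded_prob_integrable _ _ _ _ _ a^-1).
    exact: measurable_pS_translate.
  by move=> w; exact: normr_pS_le.
- apply: measurable_funM; first exact: measurable_cst.
  exact: measurable_fine_mass_itv.
- move=> w; rewrite pS_translate// /pS.
  apply: le_trans (resRe_lipschitz _ _ _ a0 _ _) _.
  + exact: FImS_ge0.
  + apply: Rintegral_ge0 => x _.
    by rewrite mulr_ge0 ?cutoff_ge0 ?kerIm_ge0.
  have k1 := shift_cutoff_le (wM w) (continuous_kerRe y0) (fun t => kerRe_le1 t y0) e0 e1 m4'.
  have k2 := shift_cutoff_le (wM w) (continuous_kerIm y0) (fun t => kerIm_le1 t y0) e0 e1 m4'.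
  rewrite ler_pdivrMr ?exprn_gt0//.
  have -> : c * mass w * a ^+ 2 = 4 * eta / m%:R ^+ 2 * mass w + 4 * eta / m%:R ^+ 2 * mass w.
    by rewrite /c; field; rewrite !gt_eqF.
  exact: lerD.
- under eq_integral do rewrite EFinM.
  rewrite ge0_integralZl//; last 2 first.
  + by apply/measurable_EFinP; exact: measurable_fine_mass_itv.
  + by move=> w _; rewrite lee_fin fine_ge0.
  have E := expectation_mass stat MK (- (3 * m%:R)) (6 * m).
  have e6 : - (3 * m%:R) + (6 * m)%:R = 3 * m%:R :> R by rewrite natrM; ring.
  rewrite e6 in E.
  under eq_integral do rewrite mass_fine.
  rewrite E -EFinM lee_fin /c natrM le_eqVlt; apply/orP; left; apply/eqP.
  by field; rewrite !gt_eqF.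
Qed.

(** The Cauchy-Riemann relation trades the vertical step for a horizontal one, which
    stationarity makes negligible in the mean. *)
Lemma expectation_qS_step (m : nat) eta y : (4 <= m)%N -> 0 < eta -> eta <= 1 -> eta <= y ->
  0 < y ->
  `|Eq m%:R 0 (y + eta) - Eq m%:R 0 y| <=
  10 * eta ^+ 2 / (a * y ^+ 2) + 48 * eta * K / (a ^+ 2 * m%:R).
Proof.
move=> m4 e0 e1 ey y0.
have m0 : 0 < m%:R :> R by rewrite ltr0n (leq_trans _ m4).
have ye0 : 0 < y + eta by exact: addr_gt0.
have hD := expectation_pS_shift m4 e0 e1 y0.
have i1 := qS_integrable 0 m0 ye0; have i2 := qS_integrable 0 m0 y0.
have i3 := pS_integrable eta m0 y0; have i4 := pS_integrable 0 m0 y0.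
have key : `|(Eq m%:R 0 (y + eta) + Ep m%:R eta y) - (Eq m%:R 0 y + Ep m%:R 0 y)|
    <= 10 * eta ^+ 2 / (a * y ^+ 2).
  have E1 : _ = Eq m%:R 0 (y + eta) + Ep m%:R eta y := RintegralD measurableT i1 i3.
  have E2 : _ = Eq m%:R 0 y + Ep m%:R 0 y := RintegralD measurableT i2 i4.
  rewrite -{}E1 -{}E2; apply: (Rintegral_dist_le (h := fun=> 10 * eta ^+ 2 / (a * y ^+ 2))).
  - by apply: eq_integrable (integrableD _ i1 i3).
  - by apply: eq_integrable (integrableD _ i2 i4).
  - exact: measurable_cst.
  - move=> w; have ey' : 0 < eta <= y by rewrite e0.
    have := pS_qS_cauchy_riemann b (wM w) m0 a0 y0 ey'.
    by rewrite addrACA -opprD.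
  - by rewrite integral_cst//= probability_setT mule1.
move: hD key; move: (Eq m%:R 0 (y + eta)) (Eq m%:R 0 y) (Ep m%:R eta y).
move: (Ep m%:R 0 y) => p0 q1 q0 p1 hD key.
have -> : q1 - q0 = (q1 + p1 - (q0 + p0)) - (p1 - p0) by ring.
by apply: (le_trans (ler_normB _ _)); exact: lerD.
Qed.

End vertical_step.

Section stationary_limit.
Context {R : realType} {d : measure_display} {W : measurableType d}.
Variables (P : probability W R) (M : {RV P >-> lfmeasure R}) (K : R) (hM : R -> R).
Hypothesis wM : forall w, is_weighted_point_measure (M w).
Hypothesis stat : stationary P M.
Hypothesis K0 : 0 < K.
Hypothesis MK : intensity P M = K%:E.
Hypothesis hMi : tail_integrable hM.
Hypothesis hMb : forall x : R, 1 <= `|x| ->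
  ('E_P[fun w => (`|counting_function (M w) x - K * x|)%R] <= (hM `|x|)%:E)%E.

Let mM : measurable_fun setT (M : W -> lfmeasure R).
Proof. by []. Qed.

Let discr Y L := expectation_discrepancy (P := P) mM wM
  (expectation_discrepancy_small stat K0 MK) hMi
  (expectation_discrepancy_large hMb) (Y := Y) (L := L).

Lemma measurable_FRe L Y : 0 < L -> 0 < Y ->
  measurable_fun setT (fun w => FRe L Y (M w)).
Proof.
move=> L0 Y0; under eq_fun do rewrite -FReS0.
by apply: continuous_lf_comp_measurable; exact: continuous_FReS.
Qed.

Lemma measurable_FIm L Y : 0 < L -> 0 < Y ->
  measurable_fun setT (fun w => FIm L Y (M w)).
Proof.
move=> L0 Y0; under eq_fun do rewrite -FImS0.
by apply: continuous_lf_comp_measurable; exact: continuous_FImS.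
Qed.

Let measurable_discr L Y : 0 < Y -> measurable_fun setT (fun w =>
  \int[@lebesgue_measure R]_(r in `[0%R, (2 * L)%R])
     (5 * lor Y r * discrepancy (M w) K r)%:E)%E.
Proof.
move=> Y0; apply: (measurable_param_integral (phi := fun r => 5 * lor Y r)
    (T := fun z => discrepancy (M z.1) K z.2)).
- apply: measurable_funTS; apply: measurable_funM; first exact: measurable_cst.
  by apply: continuous_measurable_fun; exact: continuous_lor.
- by move=> r; rewrite mulr_ge0// ltW// lor_gt0.
- exact: joint_discrepancy.
- by move=> z; rewrite addr_ge0.
Qed.

Lemma expectation_FRe L Y : 0 < Y -> Y <= L ->
  (\int[P]_w (`|FRe L Y (M w)|)%:E <= parts_bound K hM Y)%E.
Proof.
move=> Y0 YL; have L0 : 0 < L by exact: lt_le_trans YL.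
apply: le_trans (discr Y0 L0); apply: ge0_le_integral => //.
- apply/measurable_EFinP; apply: measurableT_comp => //; exact: measurable_FRe.
- exact: measurable_discr.
- by move=> w _; exact: cutRe_le.
Qed.

Lemma expectation_FIm L Y : 0 < Y -> Y <= L ->
  (\int[P]_w (`|FIm L Y (M w) - 2 * K * cIm L Y|)%:E <= parts_bound K hM Y)%E.
Proof.
move=> Y0 YL; have L0 : 0 < L by exact: lt_le_trans YL.
apply: le_trans (discr Y0 L0); apply: ge0_le_integral => //.
- apply/measurable_EFinP; apply: measurableT_comp => //.
  by apply: measurable_funB; [exact: measurable_FIm|exact: measurable_cst].
- exact: measurable_discr.
- by move=> w _; exact: cutIm_le.
Qed.

(** Uniformity in L is what matters: this controls the error of regularization near
    the origin before the cutoff is chosen. *)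
Lemma expectation_FIm1_bounded : exists C, forall L, 1 <= L ->
  (\int[P]_w (FIm L 1 (M w))%:E <= C%:E)%E.
Proof.
have pf : (parts_bound K hM 1 < +oo)%E by exact: parts_bound_fin.
have pf0 : (0 <= parts_bound K hM 1)%E.
  by apply: le_trans (expectation_FRe (L := 1) _ _) => //; apply: integral_ge0.
have pfin : parts_bound K hM 1 \is a fin_num by rewrite ge0_fin_numE.
exists (fine (parts_bound K hM 1) + K * (14 + pi)) => L L1.
have L0 : 0 < L by exact: lt_le_trans L1.
have c0 : 0 <= K * (14 + pi) by rewrite mulr_ge0 ?(ltW K0)// addr_ge0// pi_ge0.
have cb : `|2 * K * cIm L 1| <= K * (14 + pi).
  have -> : 2 * K * cIm L 1 = K * (2 * cIm L 1) by ring.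
  rewrite normrM (gtr0_norm K0) ler_pM2l//.
  have := cIm_approx (@ltr01 R) L1; rewrite divr1 mulr1 ler_norml => /andP[h1 h2].
  have h3 : 7 / L <= 7 by rewrite ler_pdivrMr// ler_peMr.
  have a1 := @atan_gtNpi2 R L; have a2 := @atan_ltpi2 R L.
  have := @pi_ge0 R; rewrite ler_norml => pi0; apply/andP; split; lra.
rewrite EFinD fineK//; apply: (@le_trans _ _
  (\int[P]_w ((`|FIm L 1 (M w) - 2 * K * cIm L 1|)%:E + (K * (14 + pi))%:E))%E).
  apply: ge0_le_integral => //.
  - by move=> w _; rewrite lee_fin FIm_ge0.
  - by apply/measurable_EFinP; exact: measurable_FIm.
  - apply: emeasurable_funD; last exact: measurable_cst.
    apply/measurable_EFinP; apply: measurableT_comp => //.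
    by apply: measurable_funB; [exact: measurable_FIm|exact: measurable_cst].
  - move=> w _; rewrite -EFinD lee_fin.
    have := ler_norm (FIm L 1 (M w) - 2 * K * cIm L 1).
    by move: cb; rewrite ler_norml => /andP[_ h] h'; lra.
rewrite ge0_integralD//; last first.
  apply/measurable_EFinP; apply: measurableT_comp => //.
  by apply: measurable_funB; [exact: measurable_FIm|exact: measurable_cst].
rewrite integral_cst//= probability_setT mule1 leeD2r//.
exact: expectation_FIm.
Qed.

Variables (a b : R).
Hypothesis a0 : 0 < a.

Let Eq L y := \int[P]_w qS a b L 0 y (M w).

(** The error of a step decreases with the height, so the one at y serves for all. *)
Lemma expectation_qS_chain (m N : nat) eta y : (4 <= m)%N -> 0 < eta -> eta <= 1 ->
  eta <= y -> 0 < y ->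
  `|Eq m%:R (y + N%:R * eta) - Eq m%:R y| <=
  N%:R * (10 * eta ^+ 2 / (a * y ^+ 2) + 48 * eta * K / (a ^+ 2 * m%:R)).
Proof.
move=> m4 e0 e1 ey y0; elim: N => [|N IH].
  by rewrite !mul0r addr0 subrr normr0.
pose z := y + N%:R * eta.
have yz : y <= z by rewrite lerDl mulr_ge0// ltW.
have z0 : 0 < z by exact: lt_le_trans yz.
have -> : y + N.+1%:R * eta = z + eta by rewrite -natr1 /z; ring.
have step := expectation_qS_step wM stat MK b a0 m4 e0 e1 (le_trans ey yz) z0.
apply: (le_trans (ler_distD (Eq m%:R z) _ _)).
rewrite -natr1 mulrDl mul1r addrC; apply: lerD; first exact: IH.
apply: (le_trans step); rewrite lerD2r ler_wpM2l//.
  by rewrite mulr_ge0 ?sqr_ge0.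
rewrite lef_pV2 ?posrE ?mulr_gt0 ?exprn_gt0// ler_pM2l//.
by rewrite ler_pXn2r ?nnegrE ?(ltW y0) ?(ltW z0).
Qed.

(** At a large height the transform is close to i pi K in the mean, and the resolvent
    is Lipschitz. *)
Lemma expectation_qS_far (m : nat) Y : 0 < Y -> Y <= m%:R ->
  `|Eq m%:R Y - resIm a b 0 (pi * K)| <=
  (2 * fine (parts_bound K hM Y) + K * `|2 * cIm m%:R Y - pi|) / a ^+ 2.
Proof.
move=> Y0 Ym; have m0 : 0 < m%:R :> R by exact: lt_le_trans Ym.
pose c := K * `|2 * cIm m%:R Y - pi|.
have c0 : 0 <= c by rewrite mulr_ge0// ltW.
pose h w := (`|FRe m%:R Y (M w)| + (`|FIm m%:R Y (M w) - 2 * K * cIm m%:R Y| + c)).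
have mRe : measurable_fun setT (fun w => `|FRe m%:R Y (M w)|).
  by apply: measurableT_comp => //; exact: measurable_FRe.
have mIm : measurable_fun setT (fun w => `|FIm m%:R Y (M w) - 2 * K * cIm m%:R Y|).
  apply: measurableT_comp => //.
  by apply: measurable_funB; [exact: measurable_FIm|exact: measurable_cst].
have mh : measurable_fun setT h.
  apply: measurable_funD => //; apply: measurable_funD => //.
pose g := resIm a b 0 (pi * K).
have gE : g = \int[P]_w g.
  by rewrite Rintegral_cst//= probability_setT mulr1.
rewrite -/g gE.
have pk0 : 0 <= pi * K by rewrite mulr_ge0 ?pi_ge0// ltW.
apply: (Rintegral_dist_le (h := fun w => a ^- 2 * h w)).
- exact: qS_integrable.
- by apply: (@bounded_prob_integrable _ _ _ _ _ `|g|).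
- by apply: measurable_funM; first exact: measurable_cst.
- move=> w; rewrite /qS FReS0 FImS0 mulrC.
  apply: le_trans (resIm_lipschitz _ _ _ a0 _ pk0) _; first exact: FIm_ge0.
  rewrite subr0 ler_wpM2r ?invr_ge0 ?sqr_ge0//.
  rewrite /h lerD2l.
  have -> : FIm m%:R Y (M w) - pi * K =
    (FIm m%:R Y (M w) - 2 * K * cIm m%:R Y) + K * (2 * cIm m%:R Y - pi) by ring.
  by apply: (le_trans (ler_normD _ _)); rewrite lerD2l normrM gtr0_norm.
- under eq_integral do rewrite EFinM.
  have h0 w : 0 <= h w by rewrite addr_ge0// addr_ge0.
  rewrite ge0_integralZl//; last 3 first.
  + exact/measurable_EFinP.
  + by move=> w _; rewrite lee_fin.
  + by rewrite lee_fin invr_ge0 sqr_ge0.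
  rewrite mulrC EFinM lee_wpmul2l// ?lee_fin ?invr_ge0 ?sqr_ge0//.
  have pf : (parts_bound K hM Y < +oo)%E by exact: parts_bound_fin.
  have pf0 : (0 <= parts_bound K hM Y)%E.
    by apply: le_trans (expectation_FRe Y0 Ym) => //; apply: integral_ge0.
  have pfin : parts_bound K hM Y \is a fin_num by rewrite ge0_fin_numE.
  rewrite /h; under eq_integral do rewrite EFinD.
  rewrite ge0_integralD//; last 3 first.
  + exact/measurable_EFinP.
  + by move=> w _; rewrite lee_fin addr_ge0.
  + by apply/measurable_EFinP; apply: measurable_funD.
  under [X in (_ + X <= _)%E]eq_integral do rewrite EFinD.
  rewrite ge0_integralD//; last first.
    exact/measurable_EFinP.
  rewrite integral_cst//= probability_setT mule1.
  have -> : (2 * fine (parts_bound K hM Y) + c)%:E =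
    (parts_bound K hM Y + (parts_bound K hM Y + c%:E))%E.
    by rewrite -(fineK pfin) -!EFinD/=; congr EFin; ring.
  apply: leeD; first exact: expectation_FRe.
  by rewrite leeD2r//; exact: expectation_FIm.
Qed.

(** Climb from y to a height Y with small [parts_bound], in N steps of length
    (Y - y) / N. The second order errors add up to O(1 / N) and the errors of the
    horizontal shifts to O(1 / m), so N is fixed before m grows. *)
Theorem resolvent_expectation_cvg y e : 0 < y -> 0 < e ->
  \forall m \near \oo, `|Eq m%:R y - resIm a b 0 (pi * K)| < e.
Proof.
move=> y0 e0.
have a2 : 0 < a ^+ 2 by rewrite exprn_gt0.
have e8 : 0 < e * a ^+ 2 / 8 by rewrite divr_gt0// mulr_gt0.
have [Y yY pY] := parts_bound_cvg K hMi (y + 1) e8.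
have Y0 : 0 < Y by lra.
pose D := Y - y.
have D0 : 0 < D by rewrite subr_gt0; lra.
pose c1 := 10 * D ^+ 2 / (a * y ^+ 2).
have c10 : 0 <= c1.
  by rewrite /c1 divr_ge0 ?mulr_ge0 ?sqr_ge0// ltW.
have [N [N1 [N2 [N3 N4]]]] : exists N : nat, (0 < N)%N /\ D <= N%:R /\
    D / y <= N%:R /\ 8 * c1 / e <= N%:R.
  have [N _ HN] : \forall N \near \oo, (0 < N)%N /\ D <= N%:R /\
    D / y <= N%:R /\ 8 * c1 / e <= N%:R.
    near=> N; split; first by near: N; exact: nbhs_infty_gt.
    by split; [|split]; near: N; exact: nbhs_infty_ger.
  by exists N; exact: (HN N (leqnn _)).
have N0 : 0 < N%:R :> R by rewrite ltr0n.
(* N >= D and N >= D / y keep the step below 1 and below y; N >= 8 c1 / e makes the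
   accumulated second order error at most e / 8. *)
pose eta := D / N%:R.
have eta0 : 0 < eta by rewrite divr_gt0.
have eta1 : eta <= 1 by rewrite ler_pdivrMr// mul1r.
have etay : eta <= y by rewrite ler_pdivrMr// mulrC -ler_pdivrMr.
have YE : Y = y + N%:R * eta by rewrite /eta mulrC divfK ?gt_eqF// /D; ring.
near=> m.
have m4 : (4 <= m)%N by near: m; exact: nbhs_infty_ge.
have m0 : 0 < m%:R :> R by rewrite ltr0n (leq_trans _ m4).
have Ym : Y <= m%:R by near: m; exact: nbhs_infty_ger.
have ch := expectation_qS_chain N m4 eta0 eta1 etay y0; rewrite -YE in ch.
have far := expectation_qS_far Y0 Ym.
have t1 : N%:R * (10 * eta ^+ 2 / (a * y ^+ 2)) <= e / 8.
  have -> : N%:R * (10 * eta ^+ 2 / (a * y ^+ 2)) = c1 / N%:R.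
    by rewrite /c1 /eta; field; rewrite !gt_eqF.
  rewrite ler_pdivrMr// mulrC.
  move: N4; rewrite ler_pdivrMr//; lra.
have t2 : N%:R * (48 * eta * K / (a ^+ 2 * m%:R)) <= e / 8.
  have -> : N%:R * (48 * eta * K / (a ^+ 2 * m%:R)) = 48 * D * K / a ^+ 2 / m%:R.
    by rewrite /eta; field; rewrite !gt_eqF.
  rewrite ler_pdivrMr// [leRHS]mulrC -ler_pdivrMr ?divr_gt0//.
  by near: m; exact: nbhs_infty_ger.
have t3 : K * `|2 * cIm m%:R Y - pi| <= e * a ^+ 2 / 8.
  rewrite mulrC -ler_pdivlMr// ltW//.
  near: m; apply: cIm_cvg => //; exact: divr_gt0.
have t4 : 2 * fine (parts_bound K hM Y) <= 2 * (e * a ^+ 2 / 8).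
  rewrite ler_pM2l// -lee_fin fineK ?ltW//.
  rewrite ge0_fin_numE; first exact: lt_trans pY (ltry _).
  by apply: le_trans (expectation_FRe Y0 Ym) => //; apply: integral_ge0.
have t5 : (2 * fine (parts_bound K hM Y) + K * `|2 * cIm m%:R Y - pi|) / a ^+ 2
    <= 3 / 8 * e.
  rewrite ler_pdivrMr//; lra.
apply: (le_lt_trans (ler_distD (Eq m%:R Y) _ _)); rewrite (distrC (Eq m%:R y)).
move: ch far; move: `|Eq m%:R Y - Eq m%:R y| `|Eq m%:R Y - _| => q1 q2 ch far.
rewrite mulrDr in ch; lra.
Unshelve. all: by end_near. Qed.

End stationary_limit.

(** * Truncating the reciprocal integral *)

Section truncation.
Context {R : realType} {d : measure_display} {W : measurableType d}.
Variable (M : W -> lfmeasure R).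
Hypothesis mM : measurable_fun setT M.
Hypothesis wM : forall w, is_weighted_point_measure (M w).

(** A continuous function that vanishes at 0 and is 1 / x for |x| >= 1 / (n + 1). *)
Let trunc_inv (n : nat) (x : R) : R := x / Num.max (x ^+ 2) (n.+1%:R ^- 2).

Let trunc_recip (A : R) (n : nat) (x : R) : R :=
  trunc_inv n x * clamp (n.+1%:R * (A - `|x|) + 1).

Let max_gt0 n (x : R) : 0 < Num.max (x ^+ 2) (n.+1%:R ^- 2).
Proof. by rewrite lt_max; apply/orP; right; rewrite invr_gt0 exprn_gt0 ?ltr0n. Qed.

Let continuous_trunc_recip A n : continuous (trunc_recip A n).
Proof.
move=> x; apply: cvgM.
  apply: cvgM; first exact: cvg_id.
  apply: cvgV; first by rewrite gt_eqF// max_gt0.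
  apply: (@continuous_max _ _ (fun x : R => x ^+ 2) (cst (n.+1%:R ^- 2)) x).
    exact: exprn_continuous.
  exact: cst_continuous.
apply: (@continuous_clamp _ (fun x => n.+1%:R * (A - `|x|) + 1)) => {}x.
apply: cvgD; last exact: cvg_cst.
apply: cvgM; first exact: cvg_cst.
by apply: cvgB; [exact: cvg_cst|exact: norm_continuous].
Qed.

Let trunc_recip_support A n (x : R) : A + 1 < `|x| -> trunc_recip A n x = 0.
Proof.
move=> xA; rewrite /trunc_recip clamp0 ?mulr0//.
have : n.+1%:R * (A - `|x|) <= n.+1%:R * (- 1) by rewrite ler_pM2l ?ltr0n//; lra.
have : 1 <= n.+1%:R :> R by rewrite ler1n.
lra.
Qed.

Let trunc_recip_cvg A (x : R) :
  trunc_recip A n x @[n --> \oo] --> ((`|x| <= A)%R%:R / x : R).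
Proof.
have [->|x0] := eqVneq x 0.
  rewrite invr0 mulr0 /trunc_recip /trunc_inv.
  under eq_fun do rewrite !mul0r.
  exact: cvg_cst.
rewrite mulrC; apply: cvgM.
  apply: cvg_near_cst; near=> n.
  rewrite /trunc_inv max_l.
    by rewrite expr2 invfM mulrA mulfV// mul1r.
  have x2 : 0 < x ^+ 2 by rewrite exprn_even_gt0.
  have n2 : 0 < n.+1%:R ^+ 2 :> R by rewrite exprn_gt0.
  rewrite invf_ple ?posrE//.
  apply: (@le_trans _ _ n.+1%:R).
    by rewrite -[leRHS]natr1 ler_wpDr//; near: n; exact: nbhs_infty_ger.
  by rewrite expr2 ler_peMl// ler1n.
have := @cvg_clamp R true (A - `|x|).
rewrite -(cvg_shiftS (fun n : nat => clamp (n%:R * (A - `|x|) + true%:R))) /=.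
by rewrite subr_ge0.
Unshelve. all: by end_near. Qed.

(** For a fixed sample point only finitely many atoms matter, so pointwise
    convergence of the truncated reciprocals is enough. *)
Lemma measurable_reciprocal_integral A : 0 < A ->
  measurable_fun setT (fun w => reciprocal_integral A (M w)).
Proof.
move=> A0.
apply: (@measurable_fun_cvg _ _ _ _ (fun n w => \int[M w]_x trunc_recip A n x)).
  move=> n; have c : measurable_fun setT
      (fun mu : lfmeasure R => \int[mu]_x trunc_recip A n x).
    apply: continuous_lf_measurable.
    apply: (@cpt_integral_continuous _ _ (A + 1)); first exact: continuous_trunc_recip.
    by move=> x; exact: trunc_recip_support.
  exact: (measurableT_comp c mM).
move=> w _.
have [s smu] := point_measure_atoms (A + 1) (wM w).
have -> : (fun n => \int[M w]_x trunc_recip A n x) =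
   (fun n => \sum_(p <- s) p.1 * trunc_recip A n p.2).
  apply/funext => n; rewrite (atoms_Rintegral_support smu)//.
    by apply: continuous_measurable_fun; exact: continuous_trunc_recip.
  by move=> x; exact: trunc_recip_support.
have -> : reciprocal_integral A (M w) =
    \sum_(p <- s) p.1 * ((`|p.2| <= A)%R%:R / p.2).
  rewrite /reciprocal_integral (atoms_Rintegral smu); last 3 first.
  - rewrite (_ : [set x : R | 0 < `|x| <= A] = (`[- A, A]%classic `\ 0)).
      exact: measurableD.
    apply/seteqP; split => x; rewrite /= normr_gt0 in_itv/= -ler_norml.
      by move=> /andP[/eqP].
    by move=> [xA /eqP ->].
  - move=> x /= /andP[_ xA]; rewrite in_itv/= -ler_norml; lra.
  - by apply: measurable_funTS; exact: measurable_invr.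
  apply: eq_bigr => p _; rewrite -mulrA; congr (_ * _).
  have [->|p0] := eqVneq p.2 0; first by rewrite invr0 !mulr0.
  rewrite indicE (_ : (p.2 \in _) = (`|p.2| <= A))//.
  by apply/idP/idP => [/set_mem /= /andP[]//|pA]; apply/mem_set; rewrite /= normr_gt0 p0.
elim: s {smu} => [|p s IH].
  by rewrite big_nil; under eq_fun do rewrite big_nil; exact: cvg_cst.
rewrite big_cons; under eq_fun do rewrite big_cons.
apply: cvgD; last exact: IH.
by apply: cvgM; [exact: cvg_cst|exact: trunc_recip_cvg].
Qed.

End truncation.

Section tail_limit.
Variable R : realType.
Notation leb := (@lebesgue_measure R).

Lemma tail_integral_cvg (h : R -> R) e : tail_integrable h -> 0 < e ->
  \forall m \near \oo,
    (\int[leb]_(r in `[m%:R, +oo[) (4 * (h r / r ^+ 2))%:E < e%:E)%E.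
Proof.
move=> [mh h0 hi] e0.
have h1 (r : R) : 1 <= r -> 0 <= 4 * (h r / r ^+ 2).
  by move=> r1; rewrite mulr_ge0// divr_ge0 ?h0 ?sqr_ge0.
have mf : measurable_fun (`[1, +oo[%classic : set R) (fun r => 4 * (h r / r ^+ 2)).
  apply: measurable_funM; first exact: measurable_cst.
  apply: measurable_funM => //; apply: measurable_funTS.
  by apply: (measurableT_comp (@measurable_invr R)); exact: exprn_measurable.
have ig : leb.-integrable `[1, +oo[ (fun r => (4 * (h r / r ^+ 2))%:E).
  have i1 : leb.-integrable `[1, +oo[ (EFin \o (fun r => h r / r ^+ 2)).
    apply/integrableP; split.
      apply/measurable_EFinP; apply: measurable_funM => //; apply: measurable_funTS.
      by apply: (measurableT_comp (@measurable_invr R)); exact: exprn_measurable.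
    apply: le_lt_trans hi; rewrite le_eqVlt; apply/orP; left; apply/eqP.
    apply: eq_integral => r; rewrite inE/= in_itv/= andbT => r1.
    by rewrite ger0_norm// divr_ge0 ?h0 ?sqr_ge0.
  by apply: eq_integrable (integrableZl _ 4 i1) => //.
pose f n (r : R) := (4 * (h r / r ^+ 2) * (n%:R <= r)%R%:R)%:E.
have := @dominated_cvg _ _ R leb (`[1, +oo[%classic : set R)
  (measurable_itv _) f (cst 0) (fun r => (4 * (h r / r ^+ 2))%:E).
rewrite integral0 => cv.
have {}cv : (\int[leb]_(r in `[1%R, +oo[) f n r)%E @[n --> \oo] --> 0%E.
  apply: cv => //.
  - move=> n; apply/measurable_EFinP; apply: measurable_funM => //.
    apply: measurable_funTS; apply: measurable_bool_ind.
    exact: measurable_fun_ler.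
  - move=> r _; apply: cvg_near_cst; near=> n; rewrite /f.
    rewrite (_ : (n%:R <= r)%R = false) ?mulr0//; apply/negbTE; rewrite -ltNge.
    by near: n; exact: nbhs_infty_gtr.
  - move=> n r; rewrite /= in_itv/= andbT => r1.
    rewrite lee_fin normrM (ger0_norm (h1 _ r1)) -[leRHS]mulr1 ler_wpM2l ?h1//.
    by case: (n%:R <= r); rewrite /= ?normr1 ?normr0.
move/fine_cvgP : (cv) => [fcv /cvgrPdist_lt/(_ _ e0) hcv].
near=> m.
have m1 : 1 <= m%:R :> R by near: m; exact: nbhs_infty_ger.
have fE : (\int[leb]_(r in `[m%:R, +oo[) (4 * (h r / r ^+ 2))%:E =
    \int[leb]_(r in `[1%R, +oo[) f m r)%E.
  rewrite integral_mkcond [RHS]integral_mkcond; apply: eq_integral => r _.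
  rewrite !patchE !mem_setE !in_itv/= !andbT /f.
  have [mr|rm] /= := leP m%:R r; first by rewrite (le_trans m1 mr) mulr1.
  by rewrite mulr0 if_same.
rewrite fE.
have fn : (\int[leb]_(r in `[1%R, +oo[) f m r)%E \is a fin_num.
  by near: m; exact: fcv.
have : `|0 - fine (\int[leb]_(r in `[1%R, +oo[) f m r)%E| < e.
  by near: m; exact: hcv.
rewrite sub0r normrN => /(le_lt_trans (ler_norm _)) h'.
by rewrite -(fineK fn) lte_fin.
Unshelve. all: by end_near. Qed.

Lemma limn_esup_lt_near (u : nat -> \bar R) (e : \bar R) :
  (limn_esup u < e)%E -> \forall n \near \oo, (u n < e)%E.
Proof.
rewrite /limn_esup /limf_esup => /ereal_inf_lt[_ [V FV <-] hV].
apply: filterS FV => n Vn; apply: le_lt_trans hV.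
by apply: ereal_sup_ubound; exists n.
Qed.

End tail_limit.

Section truncation_error.
Context {R : realType} {d : measure_display} {W : measurableType d}.
Variables (P : probability W R) (M : {RV P >-> lfmeasure R}).
Hypothesis wM : forall w, is_weighted_point_measure (M w).
Notation leb := (@lebesgue_measure R).
Variables (a b A L y delta : R) (h : R -> R).
Hypotheses (a0 : 0 < a) (y0 : 0 < y) (d0 : 0 < delta) (dA : delta <= A).
Hypotheses (L1 : 1 <= L) (LA : 2 * L <= A).
Hypothesis hi : tail_integrable h.
Hypothesis hb : forall r, 1 <= r <= A ->
  (\int[P]_w (`|balance (M w) r|)%:E <= (h r)%:E)%E.

Let mM : measurable_fun setT (M : W -> lfmeasure R).
Proof. by []. Qed.

Let L0 : 0 < L. Proof. exact: lt_le_trans L1. Qed.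
Let A0 : 0 < A. Proof. by apply: lt_le_trans LA; rewrite mulr_gt0. Qed.

Let bad := [set w | (0 < M w `](- delta)%R, delta[%classic)%E].

Lemma measurable_mass_gt0 : measurable bad.
Proof.
rewrite -[X in measurable X]setTI.
have := measurable_mass_itv mM false true (- delta) delta.
by move=> /(emeasurable_fun_o_infty measurableT) /(_ 0%E).
Qed.

Let gX w := resIm a b (reciprocal_integral A (M w)) 0.
Let gF w := qS a b L 0 y (M w).
Let c := 2 * y * (1 + delta ^- 2) / a ^+ 2.

Lemma measurable_resIm_line : measurable_fun setT (fun x : R => resIm a b x 0).
Proof.
apply: continuous_measurable_fun.
apply: (@continuous_res _ _ (fun x : R => x) (cst 0) a b a0 _ _ _).2.
- by move=> x; exact: cvg_id.
- exact: cst_continuous.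
- by [].
Qed.

Let mgX : measurable_fun setT gX.
Proof.
apply: (measurableT_comp measurable_resIm_line).
exact: measurable_reciprocal_integral.
Qed.

Let gX_bound w : 0 <= gX w <= a^-1.
Proof. by rewrite resIm_ge0// resIm_le. Qed.

Let gF_bound w : 0 <= gF w <= a^-1.
Proof. by rewrite resIm_ge0 ?resIm_le// FImS_ge0. Qed.

Let D w : \bar R := ((`|balance (M w) A| / A)%:E +
   \int[leb]_(r in `[L, A]) (4 / r ^+ 2 * `|balance (M w) r|)%:E)%E.

Let inv20 (r : R) : 0 <= 4 / r ^+ 2.
Proof. by rewrite divr_ge0// sqr_ge0. Qed.

Let D1_ge0 w : 0 <= `|balance (M w) A| / A.
Proof. by apply: divr_ge0 => //; exact: ltW. Qed.

Let D0 w : (0 <= D w)%E.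
Proof.
rewrite /D; apply: adde_ge0; first by rewrite lee_fin.
by apply: integral_ge0 => r _; rewrite lee_fin mulr_ge0.
Qed.

Let mbal r : measurable_fun setT (fun w => `|balance (M w) r|).
Proof.
apply: measurableT_comp => //; apply: measurable_funB;
exact: measurable_fine_mass_itv.
Qed.

Let minv2 : measurable_fun (`[L, A]%classic : set R) (fun r : R => 4 / r ^+ 2).
Proof.
apply: measurable_funTS; apply: measurable_funM; first exact: measurable_cst.
by apply: (measurableT_comp (@measurable_invr R)); exact: exprn_measurable.
Qed.

Let mjoint : measurable_fun setT
  (fun z : W * measurableTypeR R => `|balance (M z.1) z.2|).
Proof. by apply: measurableT_comp => //; exact: joint_balance. Qed.

Let mD2 : measurable_fun setT (fun w =>
   \int[leb]_(r in `[L, A]) (4 / r ^+ 2 * `|balance (M w) r|)%:E)%E.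
Proof.
by apply: (measurable_param_integral (phi := fun r => 4 / r ^+ 2)
  (T := fun z => `|balance (M z.1) z.2|)).
Qed.

Let mD1 : measurable_fun setT (fun w => (`|balance (M w) A| / A)%:E).
Proof.
by apply/measurable_EFinP; apply: measurable_funM; [exact: mbal|exact: measurable_cst].
Qed.

Let expectation_D : (\int[P]_w D w <= (h A / A)%:E +
   \int[leb]_(r in `[L, +oo[) (4 * (h r / r ^+ 2))%:E)%E.
Proof.
have [mh h0 _] := hi.
rewrite /D ge0_integralD//; last 2 first.
- by move=> w _; rewrite lee_fin.
- by move=> w _; apply: integral_ge0 => r _; rewrite lee_fin mulr_ge0.
apply: leeD.
  under eq_integral do rewrite mulrC EFinM.
  rewrite ge0_integralZl//; last 2 first.
  - exact/measurable_EFinP.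
  - by rewrite lee_fin invr_ge0 ltW.
  rewrite mulrC EFinM lee_wpmul2l ?lee_fin ?invr_ge0 ?(ltW A0)//.
  apply: hb; rewrite lexx andbT; apply: le_trans LA; have := L1; lra.
rewrite (expectation_integral P (phi := fun r => 4 / r ^+ 2)
  (T := fun z => `|balance (M z.1) z.2|))//.
have LI : `[L, A] `<=` (`[1, +oo[%classic : set R).
  by move=> r /=; rewrite !in_itv/= andbT => /andP[Lr _]; exact: le_trans Lr.
have LI' : (`[L, +oo[%classic : set R) `<=` (`[1, +oo[%classic : set R).
  by move=> r /=; rewrite !in_itv/= !andbT; exact: le_trans.
have mH : measurable_fun (`[1, +oo[%classic : set R) (fun r => (4 * (h r / r ^+ 2))%:E).
  apply/measurable_EFinP.
  apply: measurable_funM; first exact: measurable_cst.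
  apply: measurable_funM => //; apply: measurable_funTS.
  by apply: (measurableT_comp (@measurable_invr R)); exact: exprn_measurable.
apply: (@le_trans _ _ (\int[leb]_(r in `[L, A]) (4 * (h r / r ^+ 2))%:E)%E).
  apply: ge0_le_integral => //=.
  - move=> r _; rewrite mule_ge0 ?lee_fin//.
    by apply: integral_ge0 => w _; rewrite lee_fin.
  - apply: emeasurable_funM; first exact/measurable_EFinP.
    apply: measurable_funTS.
    by apply: (measurable_param_expectation P (T := fun z => `|balance (M z.1) z.2|)).
  - exact: measurable_funS mH.
  - move=> r; rewrite in_itv/= => /andP[Lr rA].
    have -> : 4 * (h r / r ^+ 2) = 4 / r ^+ 2 * h r by ring.
    rewrite [leRHS]EFinM lee_wpmul2l ?lee_fin//.
    by apply: hb; rewrite rA (le_trans L1).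
apply: ge0_subset_integral => //.
- exact: measurable_funS mH.
- move=> r /LI' /=; rewrite in_itv/= andbT => r1.
  by rewrite lee_fin mulr_ge0// divr_ge0 ?h0 ?sqr_ge0.
- by apply: subset_itvl; rewrite bnd_simp.
Qed.

Let pathwise w : ((`|gX w - gF w|)%:E <=
   (2 / a * \1_bad w)%:E + ((Num.min (2 / a) (c * FIm L 1 (M w)))%:E +
     (a ^- 2)%:E * D w))%E.
Proof.
have c0 : 0 <= c.
  rewrite /c mulr_ge0 ?invr_ge0 ?sqr_ge0// mulr_ge0 ?mulr_ge0 ?(ltW y0)//.
  by rewrite addr_ge0 ?invr_ge0 ?sqr_ge0.
have F0 := FIm_ge0 (M w) L (@ltr01 R).
have m0 : 0 <= Num.min (2 / a) (c * FIm L 1 (M w)).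
  by rewrite le_min mulr_ge0// ?invr_ge0 ?(ltW a0)//= mulr_ge0.
have ai0 : (0 <= (a ^- 2)%:E :> \bar R)%E by rewrite lee_fin invr_ge0 sqr_ge0.
have trivial_bound : `|gX w - gF w| <= 2 / a.
  have /andP[g1 g2] := gX_bound w; have /andP[g3 g4] := gF_bound w.
  have ai : 0 < a^-1 by rewrite invr_gt0.
  by move: (gX w) (gF w) g1 g2 g3 g4 => u v g1 g2 g3 g4;
    rewrite ler_norml; apply/andP; split; lra.
have [wb|wb] := boolP (w \in bad).
  rewrite indicE wb mulr1; apply: (@le_trans _ _ ((2 / a)%:E + 0)%E).
    by rewrite adde0 lee_fin.
  by rewrite leeD2l// adde_ge0// ?lee_fin// mule_ge0.
rewrite indicE (negbTE wb) mulr0 add0e.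
have Mw0 : M w `](- delta), delta[%classic = 0%E.
  apply/eqP; rewrite eq_le measure_ge0 andbT leNgt; apply/negP => hw.
  by move/negP : wb; apply; rewrite inE.
have [s smu] := point_measure_atoms A (wM w).
have cmp := reciprocal_compare smu y0 d0 dA L0 LA Mw0.
have tl := tail_parts smu L0 LA.
set T := `|\sum_(p <- s) p.1 * tail_ker L p.2| in cmp tl.
have T0 : 0 <= T by exact: normr_ge0.
have lip : `|gX w - gF w| <= (T + 2 * y * (1 + delta ^- 2) * FIm L 1 (M w)) / a ^+ 2.
  rewrite /gX /gF /qS FReS0 FImS0.
  apply: le_trans (resIm_lipschitz _ _ _ a0 _ _) _ => //; first exact: FIm_ge0.
  rewrite ler_wpM2r ?invr_ge0 ?sqr_ge0// (le_trans _ cmp)// lerD2l sub0r normrN.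
  by rewrite ger0_norm// FIm_ge0.
have lip2 : `|gX w - gF w| <= Num.min (2 / a) (c * FIm L 1 (M w)) + a ^- 2 * T.
  rewrite addr_minl le_min; apply/andP; split.
    by apply: (le_trans trivial_bound); rewrite lerDl mulr_ge0// invr_ge0 sqr_ge0.
  apply: (le_trans lip); rewrite mulrDl addrC [T / _]mulrC lerD2r /c.
  by rewrite mulrAC.
apply: (@le_trans _ _ ((Num.min (2 / a) (c * FIm L 1 (M w)))%:E + (a ^- 2)%:E * T%:E)%E).
  by rewrite -EFinM -EFinD lee_fin.
by rewrite leeD2l// lee_wpmul2l.
Qed.

(** The three terms are an atom within [delta] of 0, where only the boundedness of
    the resolvent helps; the move of the pole to height y; and the tail. The second
    one keeps the minimum with 2 / a because it is then the expectation of a bounded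
    vaguely continuous functional, to which convergence in law applies. *)
Lemma truncation_error :
  ((`|\int[P]_w gX w - \int[P]_w gF w|)%:E <=
   (2 / a)%:E * P bad +
   ((\int[P]_w Num.min (2 / a) (c * FIm L 1 (M w)))%:E +
    (a ^- 2)%:E * ((h A / A)%:E +
   \int[leb]_(r in `[L, +oo[) (4 * (h r / r ^+ 2))%:E)))%E.
Proof.
have mb := measurable_mass_gt0.
have mF : measurable_fun setT (fun w => Num.min (2 / a) (c * FIm L 1 (M w))).
  apply: measurable_minr; first exact: measurable_cst.
  by apply: measurable_funM; [exact: measurable_cst|exact: measurable_FIm].
have c0 : 0 <= c.
  rewrite /c mulr_ge0 ?invr_ge0 ?sqr_ge0// mulr_ge0 ?mulr_ge0 ?(ltW y0)//.
  by rewrite addr_ge0 ?invr_ge0 ?sqr_ge0.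
have F0 w : 0 <= Num.min (2 / a) (c * FIm L 1 (M w)).
  by rewrite le_min mulr_ge0// ?invr_ge0 ?(ltW a0)//= mulr_ge0// FIm_ge0.
have ai0 : (0 <= (a ^- 2)%:E :> \bar R)%E by rewrite lee_fin invr_ge0 sqr_ge0.
have a20 : 0 <= 2 / a by rewrite divr_ge0// ltW.
have mDw : measurable_fun setT D by exact: emeasurable_funD.
have iF : P.-integrable setT (EFin \o (fun w => Num.min (2 / a) (c * FIm L 1 (M w)))).
  apply: (@bounded_prob_integrable _ _ _ _ _ (2 / a)) => // w.
  by rewrite ger0_norm// ge_min lexx.
apply: (le_trans (Rintegral_dist _ _)).
- apply: (@bounded_prob_integrable _ _ _ _ _ a^-1) => // w.
  by have /andP[? ?] := gX_bound w; rewrite ger0_norm.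
- exact: qS_integrable.
apply: (@le_trans _ _ (\int[P]_w ((2 / a * \1_bad w)%:E +
   ((Num.min (2 / a) (c * FIm L 1 (M w)))%:E + (a ^- 2)%:E * D w)))%E).
  apply: ge0_le_integral => //.
  - apply/measurable_EFinP; apply: measurableT_comp => //; apply: measurable_funB => //.
    exact: measurable_qS.
  - apply: emeasurable_funD.
      apply/measurable_EFinP; apply: measurable_funM; first exact: measurable_cst.
      exact: measurable_indic.
    apply: emeasurable_funD; first exact/measurable_EFinP.
    by apply: emeasurable_funM => //.
rewrite ge0_integralD//; last 4 first.
- by move=> w _; rewrite lee_fin mulr_ge0.
- apply/measurable_EFinP; apply: measurable_funM; first exact: measurable_cst.
  exact: measurable_indic.
- by move=> w _; rewrite adde_ge0// ?lee_fin// mule_ge0.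
- apply: emeasurable_funD; first exact/measurable_EFinP.
  by apply: emeasurable_funM => //.
apply: leeD.
  under eq_integral do rewrite EFinM.
  rewrite ge0_integralZl//; last first.
    by apply/measurable_EFinP; exact: measurable_indic.
  by rewrite integral_indic// setIT.
rewrite ge0_integralD//; last 4 first.
- by move=> w _; rewrite lee_fin.
- exact/measurable_EFinP.
- by move=> w _; rewrite mule_ge0.
- by apply: emeasurable_funM => //.
apply: leeD.
  by rewrite /Rintegral fineK//; exact: integrable_fin_num.
rewrite ge0_integralZl//.
by rewrite lee_wpmul2l.
Qed.

End truncation_error.

(** * Passing to the limit in law *)

Section transfer.
Context {R : realType} (d : nat -> measure_display)
    (W : forall n : nat, measurableType (d n))
    (P : forall n : nat, probability (W n) R)
    (Mn : forall n : nat, {RV (P n) >-> lfmeasure R})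
    (hMn : forall (n : nat) (w : W n), is_weighted_point_measure (Mn n w))
    (A : nat -> R) (hA : A n @[n --> \oo] --> +oo)
    (d' : measure_display) (W' : measurableType d')
    (P' : probability W' R) (M : {RV P' >-> lfmeasure R}) (K : R).
Hypothesis wM : forall w : W', is_weighted_point_measure (M w).
Hypothesis law : cvg_in_law P (fun n => Mn n : W n -> lfmeasure R) P' M.
Hypothesis stat : stationary P' M.
Hypothesis K0 : 0 < K.
Hypothesis MK : intensity P' M = K%:E.
Variable hM : R -> R.
Hypothesis hMi : tail_integrable hM.
Hypothesis hMb : forall x : R, 1 <= `|x| ->
  ('E_P'[fun w => (`|counting_function (M w) x - K * x|)%R] <= (hM `|x|)%:E)%E.
Hypothesis zero_free :
  limn_esup (fun n => P n [set w | (0 < Mn n w `](- delta)%R, delta[%classic)%E])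
      @[delta --> (0 : R)^'+] --> (0 : \bar R)%E.
Hypothesis bal : balance_condition P Mn A.

Lemma law_Rintegral (f : lfmeasure R -> R) C e : continuous f ->
  (forall mu, `|f mu| <= C) -> 0 < e ->
  \forall n \near \oo,
    `|\int[P n]_w f (Mn n w) - \int[P']_w f (M w)| < e.
Proof.
move=> cf fC e0.
have := law cf (ex_intro _ C fC); rewrite unlock.
have i' : P'.-integrable setT (EFin \o (fun w => f (M w))).
  apply: (@bounded_prob_integrable _ _ _ _ _ C) => //.
  exact: continuous_lf_comp_measurable.
have -> : (\int[P']_w ((f \o M) w)%:E)%E = (\int[P']_w f (M w))%:E.
  by rewrite fineK//; exact: integrable_fin_num i'.
move=> /fine_cvgP[_ /cvgrPdist_lt/(_ _ e0) h].
by apply: filterS h => n; rewrite distrC.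
Qed.

(** The order of choices is [delta], so that mass near 0 is unlikely; then the height
    y, small with respect to [delta] and to the bound on the mean at height 1; then
    the cutoff scale m, which settles the stationary limit and the tail; finally n. *)
Theorem resolvent_reciprocal_cvg (a b e : R) : 0 < a -> 0 < e ->
  \forall n \near \oo,
   `|\int[P n]_w resIm a b (reciprocal_integral (A n) (Mn n w)) 0 -
     resIm a b 0 (pi * K)| < e.
Proof.
move=> a0 e0; have a2 : 0 < a ^+ 2 by rewrite exprn_gt0.
have [h [hi hx hb]] := bal.
have [C HC] := expectation_FIm1_bounded wM stat K0 MK hMi hMb.
have e8 : 0 < e / 8 by rewrite divr_gt0.
have ea : 0 < a / 2 * (e / 8) by rewrite mulr_gt0// divr_gt0.
have [delta d0 badP] : exists2 delta : R, 0 < delta &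
    \forall n \near \oo,
    (P n [set w | (0 < Mn n w `](- delta)%R, delta[%classic)%E] < (a / 2 * (e / 8))%:E)%E.
  have zn : \forall delta \near (0 : R)^'+,
     (limn_esup (fun n => P n [set w | (0 < Mn n w `](- delta)%R, delta[%classic)%E])
      < (a / 2 * (e / 8))%:E)%E.
    move: zero_free => /(_ [set z | (z < (a / 2 * (e / 8))%:E)%E]); apply.
    by apply: open_nbhs_nbhs; split; [exact: open_ereal_lt_ereal|rewrite /= lte_fin].
  have : \forall delta \near (0 : R)^'+, 0 < delta /\
     (limn_esup (fun n => P n [set w | (0 < Mn n w `](- delta)%R, delta[%classic)%E])
      < (a / 2 * (e / 8))%:E)%E.
    by apply: filterI => //; exact: nbhs_right_gt.
  move=> /filter_ex[delta [d0 dlt]].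
  by exists delta => //; exact: limn_esup_lt_near.
pose C1 := `|C| + 1.
have C10 : 0 < C1 by rewrite ltr_wpDl.
pose D1 := 1 + delta ^- 2.
have D10 : 0 < D1 by rewrite /D1 ltr_wpDr// invr_ge0 sqr_ge0.
(* Chosen so that c, the Lipschitz cost of the height y, satisfies c * C1 = e / 8. *)
pose y := (e / 8) * a ^+ 2 / (2 * D1 * C1).
have y0 : 0 < y by rewrite /y divr_gt0 ?mulr_gt0.
pose c := 2 * y * D1 / a ^+ 2.
have c0 : 0 < c by apply: divr_gt0 => //; apply: mulr_gt0 => //; exact: mulr_gt0.
have cC : c * C1 = e / 8.
  by rewrite /c /y; field; rewrite !gt_eqF.
have ea2 : 0 < a ^+ 2 * (e / 8) by rewrite mulr_gt0.
have [m [m1 [mq mt]]] : exists m : nat, 1 <= m%:R :> R /\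
   `|\int[P']_w qS a b m%:R 0 y (M w) - resIm a b 0 (pi * K)| < e / 8 /\
   (\int[@lebesgue_measure R]_(r in `[m%:R, +oo[) (4 * (h r / r ^+ 2))%:E
      < (a ^+ 2 * (e / 8))%:E)%E.
  have [m _ Hm] : \forall m \near \oo, 1 <= m%:R :> R /\
   `|\int[P']_w qS a b m%:R 0 y (M w) - resIm a b 0 (pi * K)| < e / 8 /\
   (\int[@lebesgue_measure R]_(r in `[m%:R, +oo[) (4 * (h r / r ^+ 2))%:E
      < (a ^+ 2 * (e / 8))%:E)%E.
    near=> m; split; first by near: m; exact: nbhs_infty_ger.
    split; near: m; last exact: tail_integral_cvg.
    exact: (resolvent_expectation_cvg wM stat K0 MK hMi hMb b a0).
  by exists m; exact: (Hm m (leqnn _)).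
have m0 : 0 < m%:R :> R by apply: lt_le_trans m1.
have cq : continuous (qS a b m%:R 0 y) by exact: continuous_qS.
have n1 := law_Rintegral cq (fun mu => normr_qS_le b a0 m%:R 0 mu y0) e8.
pose f mu := Num.min (2 / a) (c * FIm m%:R 1 mu).
have cf : continuous f.
  move=> mu; apply: (@continuous_min _ _ (cst (2 / a)) (fun mu => c * FIm m%:R 1 mu) mu).
    exact: cst_continuous.
  apply: (@continuousM _ _ (cst c) (FIm m%:R 1) mu); first exact: cst_continuous.
  have := @continuous_FImS R m%:R 0 1 m0 ltr01 mu.
  by rewrite (_ : FImS m%:R 0 1 = FIm m%:R 1)//; apply/funext => z; exact: FImS0.
have f0 mu : 0 <= f mu.
  rewrite /f le_min mulr_ge0 ?invr_ge0 ?(ltW a0)//= mulr_ge0 ?(ltW c0)//.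
  exact: FIm_ge0.
have fb mu : `|f mu| <= 2 / a by rewrite ger0_norm// /f ge_min lexx.
have n2 := law_Rintegral cf fb e8.
have mf : measurable_fun setT (fun w => (f (M w))%:E).
  by apply/measurable_EFinP; exact: continuous_lf_comp_measurable.
have mF : measurable_fun setT (fun w => (FIm m%:R 1 (M w))%:E).
  by apply/measurable_EFinP; exact: measurable_FIm.
have fM : \int[P']_w f (M w) <= e / 8.
  rewrite -cC -lee_fin fineK; last first.
    apply: integrable_fin_num => //.
    apply: (@bounded_prob_integrable _ _ _ _ _ (2 / a)) => // .
    exact: continuous_lf_comp_measurable.
  apply: (@le_trans _ _ (\int[P']_w (c%:E * (FIm m%:R 1 (M w))%:E))%E).
    apply: ge0_le_integral => //.
    - by move=> w _; rewrite lee_fin f0.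
    - exact: emeasurable_funM.
    - by move=> w _; rewrite -EFinM lee_fin /f ge_min lexx orbT.
  rewrite ge0_integralZl//; last 2 first.
  - by move=> w _; rewrite lee_fin FIm_ge0.
  - by rewrite lee_fin ltW.
  rewrite [leRHS]EFinM lee_wpmul2l// ?lee_fin ?(ltW c0)//.
  apply: le_trans (HC _ m1) _; rewrite lee_fin /C1.
  by apply: (le_trans (ler_norm _)); rewrite lerDl.
have hA' := hA.
have n3 : \forall n \near \oo, h (A n) / A n < a ^+ 2 * (e / 8).
  have h1 : h (A n) / A n @[n --> \oo] --> 0.
    exact: cvg_comp _ _ hA hx.
  move/cvgrPdist_lt : h1 => /(_ _ ea2); apply: filterS => n.
  by rewrite sub0r normrN; apply: le_lt_trans; exact: ler_norm.
near=> n.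
have An1 : 1 <= A n by near: n; move/cvgryPge : hA' => /(_ 1).
have Am : 2 * m%:R <= A n by near: n; move/cvgryPge : hA' => /(_ (2 * m%:R)).
have dA : delta <= A n by near: n; move/cvgryPge : hA'; apply.
have hbn r : 1 <= r <= A n ->
  (\int[P n]_w (`|balance (Mn n w) r|)%:E <= (h r)%:E)%E.
  by move=> rA; have := hb n r rA; rewrite unlock.
have Yn : `|\int[P n]_w qS a b m%:R 0 y (Mn n w) -
    \int[P']_w qS a b m%:R 0 y (M w)| < e / 8 by near: n.
have Zn : `|\int[P n]_w f (Mn n w) - \int[P']_w f (M w)| < e / 8 by near: n.
have Pn : (P n [set w | (0 < Mn n w `](- delta)%R, delta[%classic)%E] <
   (a / 2 * (e / 8))%:E)%E by near: n.
have hn : h (A n) / A n < a ^+ 2 * (e / 8) by near: n.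
have := truncation_error (@hMn n) b a0 y0 d0 dA m1 Am hi hbn.
move: Yn Zn; rewrite /f /c /D1.
set Y := \int[P n]_w _ => Yn; set Z := \int[P n]_w _ => Zn; set X := \int[P n]_w _ => TE.
have XY : `|X - Y| <= e / 8 + (e / 4 + (e / 8 + e / 8)).
  rewrite -lee_fin; apply: (le_trans TE); rewrite !EFinD; apply: leeD.
    rewrite (_ : (e / 8)%:E = (2 / a)%:E * (a / 2 * (e / 8))%:E)%E; last first.
      by rewrite -EFinM; congr EFin; field; rewrite gt_eqF.
    by rewrite lee_wpmul2l ?lee_fin ?divr_ge0 ?(ltW a0)// ltW.
  apply: leeD.
    rewrite lee_fin; move: Zn fM; move: (\int[P']_w f (M w)) => z.
    by rewrite ltr_norml => /andP[_ z1] z2; lra.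
  rewrite (_ : (e / 8)%:E = (a ^- 2)%:E * (a ^+ 2 * (e / 8))%:E)%E; last first.
    by rewrite -EFinM; congr EFin; field; rewrite gt_eqF.
  rewrite -ge0_muleDr; last 2 first.
  - by rewrite lee_fin ltW.
  - by rewrite lee_fin ltW.
  rewrite lee_wpmul2l ?lee_fin ?invr_ge0 ?sqr_ge0//.
  by apply: leeD; [rewrite lee_fin ltW|exact: ltW].
apply: (le_lt_trans (ler_distD Y _ _)).
have := ler_distD (\int[P']_w qS a b m%:R 0 y (M w)) Y (resIm a b 0 (pi * K)).
move: mq Yn XY; move: `|X - Y| `|Y - resIm _ _ _ _| `|Y - \int[P']_w _|.
move: `|\int[P']_w _ - _| => q1 q2 q3 q4; lra.
Unshelve. all: by end_near. Qed.

End transfer.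

(** * Poisson kernels determine the Cauchy limit *)

Section poisson_kernel.
Context {R : realType}.
Notation leb := (@lebesgue_measure R).

Lemma kerIm_le (a t : R) : 0 < a -> kerIm a t <= a^-1.
Proof.
move=> a0; rewrite /kerIm ler_pdivrMr ?lor_den_gt0//.
rewrite mulrDr [a ^+ 2]expr2 mulKf ?gt_eqF// lerDr mulr_ge0 ?sqr_ge0//.
by rewrite invr_ge0 ltW.
Qed.

Lemma sqr_kerIm_le (a t : R) : 0 < a -> t ^+ 2 * kerIm a t <= a.
Proof.
move=> a0; rewrite /kerIm mulrCA ger_pMr//.
by rewrite ler_pdivrMr ?lor_den_gt0// mul1r lerDl sqr_ge0.
Qed.

Lemma continuous_kerIm_subl (a x : R) : 0 < a -> continuous (fun b => kerIm a (x - b)).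
Proof.
move=> a0 b; apply: (@continuous_comp _ _ _ (fun b => x - b) (kerIm a)).
  by apply: cvgB; [exact: cvg_cst|exact: cvg_id].
exact: continuous_kerIm.
Qed.

Lemma is_derive_poisson (a x b : R) : 0 < a ->
  is_derive b 1 (fun b => - atan ((x - b) / a)) (kerIm a (x - b)).
Proof.
move=> a0.
have d1 : is_derive b 1 (fun b : R => (x - b) / a) (- a^-1).
  apply: is_derive_eq; rewrite /GRing.scale /=; ring.
have d2 : is_derive b 1 (fun b : R => atan ((x - b) / a))
    ((1 + ((x - b) / a) ^+ 2)^-1 * - a^-1).
  apply: (@is_derive1_comp _ atan (fun b => (x - b) / a)).
apply: is_derive_eq.
have := lor_den_gt0 (x - b) a0 => p; rewrite /kerIm; field.
by rewrite !gt_eqF.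
Qed.

Lemma integral_kerIm_le (a x S : R) : 0 < a -> 0 <= S ->
  \int[leb]_(b in `[- S, S]) kerIm a (x - b) <= pi.
Proof.
move=> a0 S0.
have SS : - S <= S by rewrite ge0_cp.
rewrite (FTC_closed_itv SS (fun b _ => is_derive_poisson x b a0)); last first.
  by move=> b _; exact: continuous_kerIm_subl.
have := atan_ltpi2 ((x - - S) / a); have := atan_gtNpi2 ((x - S) / a).
by move: (atan _) (atan _) => u v; lra.
Qed.

(** Heine-Cantor on a slightly larger interval; beyond it both values are 0. *)
Lemma supported_unif_continuous (f : R -> R) (S e : R) : continuous f ->
  (forall x, S <= `|x| -> f x = 0) -> 0 < e ->
  exists2 rho : R, 0 < rho & forall x b, `|x - b| < rho -> `|f b - f x| < e.
Proof.
move=> cf fS e0.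
have /compact_near_coveringP/(_ _ (0 : R)^'+
   (fun r x => forall b, `|x - b| < r -> `|f b - f x| < e)) h :
   compact `[- (S + 1), S + 1]%classic by exact: segment_compact.
have {}h : \forall r \near (0 : R)^'+,
  `[- (S + 1), S + 1]%classic `<=` (fun x => forall b, `|x - b| < r -> `|f b - f x| < e).
  apply: h => x _.
  have e20 : 0 < e / 2 by rewrite divr_gt0.
  have /cvgrPdist_lt/(_ _ e20)/nbhs_ballP[r /= r0 hr] := cf x.
  have r20 : 0 < r / 2 by rewrite divr_gt0.
  exists (ball x (r / 2), [set s | 0 < s < r / 2]) => /=.
    split; first exact: nbhsx_ballx.
    near=> s; apply/andP; split; near: s; [exact: nbhs_right_gt|exact: nbhs_right_lt].
  move=> [x' s] /= [xx' /andP[s0 sr]] b x'b.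
  have h1 := hr x'; have h2 := hr b.
  have {}h1 : `|f x - f x'| < e / 2.
    by apply: h1; apply: lt_le_trans xx' _; rewrite ler_pdivrMr// ler_pMr//; lra.
  have {}h2 : `|f x - f b| < e / 2.
    apply: h2; rewrite /ball /=.
    apply: le_lt_trans (ler_distD x' _ _) _; rewrite [ltRHS](splitr r).
    by apply: ltrD => //; exact: lt_trans sr.
  apply: le_lt_trans (ler_distD (f x) _ _) _; rewrite [ltRHS](splitr e) distrC.
  exact: ltrD.
have [rho [[rho0 rho1] hrho]] : exists rho : R, (0 < rho /\ rho < 1) /\
   `[- (S + 1), S + 1]%classic `<=` (fun x => forall b, `|x - b| < rho -> `|f b - f x| < e).
  apply: (@filter_ex _ (0 : R)^'+ _); near=> r; split; last by near: r.
  by split; near: r; [exact: nbhs_right_gt|exact: nbhs_right_lt].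
exists rho => // x b xb.
have [xS|Sx] := leP `|x| (S + 1).
  by apply: hrho => //=; rewrite in_itv/= -ler_norml.
rewrite !fS ?subrr ?normr0//.
  by apply: ltW; apply: lt_trans Sx; rewrite ltrDl.
have := ler_distD b x 0; rewrite !subr0 => h1.
by move: h1 xb Sx rho1; move: `|x| `|b| `|x - b| => p q r; lra.
Unshelve. all: by end_near. Qed.

(** Near x the value f b is at most f x + e / 2. Away from x it is at most
    (C / rho^2) (x - b)^2, and t^2 [kerIm a t] <= a, so the far values contribute O(a). *)
Lemma poisson_smoothing_le (f : R -> R) (C S e : R) : continuous f ->
  (forall x, 0 <= f x <= C) -> 0 < S -> (forall x, S <= `|x| -> f x = 0) -> 0 < e ->
  exists2 a : R, 0 < a < e & forall x,
   \int[leb]_(b in `[- S, S]) (f b * kerIm a (x - b)) <= pi * (f x + e).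
Proof.
move=> cf f0 S0 fS e0.
have e20 : 0 < e / 2 by rewrite divr_gt0.
have [rho rho0 hrho] := supported_unif_continuous cf fS e20.
have C0 : 0 <= C by have /andP[h1 h2] := f0 0; exact: le_trans h2.
have r2 : 0 < rho ^+ 2 by rewrite exprn_gt0.
pose q := C / rho ^+ 2.
have q0 : 0 <= q by rewrite divr_ge0 ?sqr_ge0.
pose a := Num.min (e / 2) (pi * (e / 2) / (2 * S * q + 1)).
have D0 : 0 < 2 * S * q + 1 by rewrite ltr_wpDl// mulr_ge0// mulr_ge0// ltW.
have a0 : 0 < a by rewrite lt_min e20 divr_gt0// mulr_gt0// pi_gt0.
have ae : a < e by rewrite gt_min; apply/orP; left; rewrite ltr_pdivrMr// ltr_pMr//; lra.
have aq : 2 * S * q * a <= pi * (e / 2).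
  have : a <= pi * (e / 2) / (2 * S * q + 1) by rewrite /a ge_min lexx orbT.
  rewrite ler_pdivlMr// => h; apply: le_trans h; rewrite mulrC ler_wpM2l ?(ltW a0)//.
  by rewrite lerDl.
exists a; first by rewrite a0.
move=> x.
have SS : - S <= S by rewrite ge0_cp// ltW.
have ck := @continuous_kerIm_subl a x a0.
have pw b : f b * kerIm a (x - b) <= (f x + e / 2) * kerIm a (x - b) + q * a.
  have k0 := kerIm_ge0 (x - b) a0.
  have /andP[fx0 fxC] := f0 x; have /andP[fb0 fbC] := f0 b.
  have [xb|xb] := ltP `|x - b| rho.
    have := hrho _ _ xb; rewrite ltr_norml => /andP[_ h].
    apply: (@le_trans _ _ ((f x + e / 2) * kerIm a (x - b))).
      by rewrite ler_wpM2r// addrC; move: h; rewrite ltrBlDr => /ltW.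
    by rewrite lerDl mulr_ge0// ltW.
  apply: (@le_trans _ _ (q * a)); last first.
    by rewrite lerDr mulr_ge0// addr_ge0// ltW.
  apply: (@le_trans _ _ (C * kerIm a (x - b))); first by rewrite ler_wpM2r.
  rewrite /q -mulrA ler_wpM2l//.
  apply: le_trans (ler_wpM2l _ (sqr_kerIm_le (x - b) a0)); last by rewrite invr_ge0 ltW.
  rewrite mulrA ler_peMl// mulrC ler_pdivlMr// mul1r -[leRHS]real_normK ?num_real//.
  by rewrite lerXn2r// ?nnegrE// ltW.
have i1 : leb.-integrable `[- S, S] (EFin \o (fun b => f b * kerIm a (x - b))).
  by apply: continuous_itv_integrable => b; apply: cvgM; [exact: cf|exact: ck].
have i2 : leb.-integrable `[- S, S] (EFin \o (fun b => kerIm a (x - b))).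
  exact: continuous_itv_integrable.
have i3 : leb.-integrable `[- S, S] (EFin \o (fun b => (f x + e / 2) * kerIm a (x - b))).
  by apply: continuous_itv_integrable => b; apply: cvgM; [exact: cvg_cst|exact: ck].
have i4 : leb.-integrable `[- S, S] (EFin \o (fun b => q * a)).
  by apply: continuous_itv_integrable => b; exact: cvg_cst.
apply: (@le_trans _ _ (\int[leb]_(b in `[- S, S])
   ((f x + e / 2) * kerIm a (x - b) + q * a))).
  apply: le_Rintegral => //.
  exact: (integrableD _ i3 i4).
rewrite RintegralD// RintegralZl// Rintegral_cst//=.
have /andP[fx0 fxC] := f0 x.
have := integral_kerIm_le x a0 (ltW S0); set k := \int[leb]_(b in _) _ => kpi.
have mS : fine (leb `[- S, S]) = 2 * S.
  by rewrite lebesgue_measure_itv/= lte_fin gtrN//=; ring.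
rewrite mS.
have : (f x + e / 2) * k <= (f x + e / 2) * pi by rewrite ler_wpM2l// addr_ge0// ltW.
have -> : q * a * (2 * S) = 2 * S * q * a by ring.
have -> : pi * (f x + e) = (f x + e / 2) * pi + pi * (e / 2) by field.
by move=> h; exact: lerD.
Qed.

End poisson_kernel.

Section cauchy_density.
Context {R : realType}.
Notation leb := (@lebesgue_measure R).

Lemma cauchy_prob_dom : @cauchy_prob R `<< leb.
Proof.
apply/null_content_dominatesP => B mB B0; rewrite /cauchy_prob.
apply: null_set_integral => //; apply/measurable_EFinP/measurable_funTS.
exact: measurable_cauchy_pdf.
Qed.

Lemma integral_cauchy_prob (f : R -> \bar R) : measurable_fun setT f ->
  (@cauchy_prob R).-integrable setT f ->
  (\int[@cauchy_prob R]_x f x = \int[leb]_x (f x * (cauchy_pdf x)%:E))%E.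
Proof.
move=> mf fi.
rewrite -(Radon_Nikodym_change_of_variables cauchy_prob_dom)//=.
have mc : measurable_fun setT (fun x : R => (cauchy_pdf x)%:E).
  by apply/measurable_EFinP; exact: measurable_cauchy_pdf.
apply: ae_eq_integral => //.
- apply: emeasurable_funM => //; apply: (measurable_int leb).
  by apply: Radon_Nikodym_integrable; exact: cauchy_prob_dom.
- exact: emeasurable_funM.
- apply: ae_eqe_mul2l => /=.
  rewrite Radon_NikodymE//=; first exact: cauchy_prob_dom.
  move=> cleb; case: cid => /= h [h1 h2 h3]; apply: integral_ae_eq => //= E _ mE.
  by rewrite -h3.
Qed.

Lemma Rintegral_cauchy_prob (f : R -> R) (C S : R) : continuous f ->
  (forall x, `|f x| <= C) -> (forall x, S <= `|x| -> f x = 0) ->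
  \int[@cauchy_prob R]_x f x = pi^-1 * \int[leb]_(b in `[(- S)%R, S]) (f b * kerIm 1 b).
Proof.
move=> cf fC fS.
have mf : measurable_fun setT f by exact: continuous_measurable_fun.
have i1 : leb.-integrable `[(- S)%R, S] (EFin \o (fun b => f b * kerIm 1 b)).
  by apply: continuous_itv_integrable => b; apply: cvgM; [exact: cf|exact: continuous_kerIm].
rewrite -RintegralZl//; congr fine.
rewrite integral_cauchy_prob; last 2 first.
- exact/measurable_EFinP.
- exact: (@bounded_prob_integrable _ _ _ (@cauchy_prob R) f C).
rewrite [RHS]integral_mkcond; apply: eq_integral => x _; rewrite patchE.
case: ifPn => [_|].
  rewrite -EFinM; congr EFin; rewrite /cauchy_pdf /kerIm invfM expr1n addrC.
  by rewrite mul1r mulrCA.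
rewrite notin_setE/= in_itv/= -ler_norml => /negP; rewrite -ltNge => /ltW xS.
by rewrite fS// mul0e.
Qed.

End cauchy_density.

Section poisson_weak_limit.
Context {R : realType} (d : nat -> measure_display)
    (W : forall n : nat, measurableType (d n))
    (P : forall n : nat, probability (W n) R) (Z : forall n, W n -> R).
Arguments Z : clear implicits.
Notation leb := (@lebesgue_measure R).
Hypothesis mZ : forall n, measurable_fun setT (Z n).
Hypothesis poisson_cvg : forall a b e : R, 0 < a -> 0 < e -> \forall n \near \oo,
  `|\int[P n]_w kerIm a (Z n w - b) - kerIm (1 + a) b| < e.

Lemma measurable_kerIm_joint n (a : R) : 0 < a ->
  measurable_fun setT (fun z : W n * measurableTypeR R => kerIm a (Z n z.1 - z.2)).
Proof.
move=> a0; apply: (measurableT_comp (f := kerIm a)).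
  by apply: continuous_measurable_fun; exact: continuous_kerIm.
apply: measurable_funB; last exact: measurable_snd.
by apply: measurableT_comp; [exact: mZ|exact: measurable_fst].
Qed.

Lemma smoothing_expectation_cvg (f : R -> R) (C S a : R) : continuous f ->
  (forall x, 0 <= f x <= C) -> 0 < S -> 0 < a ->
  (\int[leb]_(b in `[(- S)%R, S]) ((f b)%:E * \int[P n]_w (kerIm a (Z n w - b))%:E))%E
    @[n --> \oo] --> (\int[leb]_(b in `[(- S)%R, S]) (f b * kerIm (1 + a) b)%:E)%E.
Proof.
move=> cf f0 S0 a0.
have mT n := @measurable_kerIm_joint n a a0.
have k0 n (z : W n * measurableTypeR R) : 0 <= kerIm a (Z n z.1 - z.2) by exact: kerIm_ge0.
have ki n b : (P n).-integrable setT (EFin \o (fun w => kerIm a (Z n w - b))).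
  apply: (@bounded_prob_integrable _ _ _ _ _ a^-1).
    exact: (measurableT_comp (mT n) (pair2_measurable b)).
  by move=> w; rewrite ger0_norm ?kerIm_ge0// kerIm_le.
have Gle n b : (0 <= \int[P n]_w (kerIm a (Z n w - b))%:E <= (a^-1)%:E)%E.
  apply/andP; split; first by apply: integral_ge0 => w _; rewrite lee_fin kerIm_ge0.
  apply: (@le_trans _ _ (\int[P n]_w (a^-1)%:E)%E).
    apply: ge0_le_integral => //=.
    - by move=> w _; rewrite lee_fin kerIm_ge0.
    - exact: measurable_int (ki n b).
    - by move=> w _; rewrite lee_fin kerIm_le.
  by rewrite integral_cst//= probability_setT mule1.
have mf : measurable_fun `[(- S)%R, S] (fun b : R => (f b)%:E).
  by apply/measurable_EFinP/measurable_funTS; exact: continuous_measurable_fun.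
apply: (@dominated_cvg _ _ _ _ _ _ _ _ (fun _ => (C * a^-1)%:E)) => //.
- move=> n; apply: emeasurable_funM => //; apply: measurable_funTS.
  exact: (measurable_param_expectation (P n) (mT n) (k0 n)).
- move=> b _; rewrite EFinM; apply: cvgeZl => //.
  apply/fine_cvgP; split.
    by near=> n; exact: integrable_fin_num (ki n b).
  apply/cvgrPdist_lt => e e0; apply: filterS (poisson_cvg b a0 e0) => n.
  by rewrite distrC.
- by apply: continuous_itv_integrable => b; exact: cvg_cst.
- move=> n b _; have /andP[G0 G1] := Gle n b; have /andP[fb0 fbC] := f0 b.
  rewrite gee0_abs ?mule_ge0 ?lee_fin// EFinM.
  by apply: lee_pmul; rewrite ?lee_fin.
Unshelve. all: by end_near. Qed.

(** By smoothing at a small width a, pi E f(Z n) is almost at least the integral of f b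
    times the mean of the Poisson kernel at b; these means converge to the Poisson
    kernel of width 1 + a, which is within a of the Cauchy density times pi. *)
Lemma poisson_limit_lower (f : R -> R) (C S e : R) : continuous f ->
  (forall x, 0 <= f x <= C) -> 0 < S -> (forall x, S <= `|x| -> f x = 0) -> 0 < e ->
  \forall n \near \oo, \int[@cauchy_prob R]_x f x - e < \int[P n]_w f (Z n w).
Proof.
move=> cf f0 S0 fS e0.
have C0 : 0 <= C by have /andP[h1 h2] := f0 0; exact: le_trans h2.
have p1 : 2 <= pi :> R by exact: pi_ge2.
have p0 : 0 < pi :> R by exact: pi_gt0.
(* The losses are 2 S C a <= 2 S C e1 for the kernel, pi e1 for the smoothing, and e1. *)
pose e1 := e / (4 * (1 + S * C)).
have D0 : 0 < 1 + S * C by rewrite ltr_pwDl// mulr_ge0// ltW.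
have e10 : 0 < e1 by rewrite divr_gt0// mulr_gt0.
have e1E : 4 * (e1 + S * C * e1) = e.
  by rewrite /e1; field; rewrite gt_eqF.
have [a /andP[a0 ae] smooth] := poisson_smoothing_le cf f0 S0 fS e10.
have ck : continuous (kerIm 1 : R -> R) by exact: continuous_kerIm.
have ck' : continuous (kerIm (1 + a)) by apply: continuous_kerIm; rewrite addr_gt0.
have i1 : leb.-integrable `[(- S)%R, S] (EFin \o (fun b => f b * kerIm 1 b)).
  by apply: continuous_itv_integrable => b; apply: cvgM; [exact: cf|exact: ck].
have i2 : leb.-integrable `[(- S)%R, S] (EFin \o (fun b => f b * kerIm (1 + a) b)).
  by apply: continuous_itv_integrable => b; apply: cvgM; [exact: cf|exact: ck'].
have i3 : leb.-integrable `[(- S)%R, S] (EFin \o (fun b => C * a)).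
  by apply: continuous_itv_integrable => b; exact: cvg_cst.
have kk b : `|kerIm (1 + a) b - kerIm 1 b| <= a.
  have := @resIm_lipschitz R 1 b 0 a 0 0 ltr01 (ltW a0) (lexx _).
  by rewrite /resIm /kerIm !add0r oppr0 normr0 addr0 add0r expr1n divr1 (gtr0_norm a0) [a + 1]addrC.
have J1 : \int[leb]_(b in `[(- S)%R, S]) (f b * kerIm 1 b) - 2 * S * C * a <=
    \int[leb]_(b in `[(- S)%R, S]) (f b * kerIm (1 + a) b).
  rewrite lerBlDr.
  have mS : fine (leb `[(- S)%R, S]) = 2 * S.
    by rewrite lebesgue_measure_itv/= lte_fin gtrN//=; ring.
  have -> : 2 * S * C * a = \int[leb]_(b in `[(- S)%R, S]) (C * a).
    by rewrite Rintegral_cst//= mS; ring.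
  rewrite -RintegralD//; apply: le_Rintegral => //; first exact: (integrableD _ i2 i3).
  move=> b _; have /andP[fb0 fbC] := f0 b.
  rewrite addrC -lerBlDr -mulrBr; apply: (le_trans (ler_norm _)).
  rewrite normrM (ger0_norm fb0); apply: ler_pM => //.
  by rewrite distrC.
have cvgI := smoothing_expectation_cvg cf f0 S0 a0.
set I := (\int[leb]_(b in `[(- S)%R, S]) (f b * kerIm (1 + a) b)) in J1.
have IE : (\int[leb]_(b in `[(- S)%R, S]) (f b * kerIm (1 + a) b)%:E = I%:E)%E.
  by rewrite fineK//; exact: integrable_fin_num i2.
rewrite IE in cvgI.
have nearI : \forall n \near \oo, ((I - e1)%:E <
  \int[leb]_(b in `[(- S)%R, S]) ((f b)%:E * \int[P n]_w (kerIm a (Z n w - b))%:E))%E.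
  move: cvgI => /(_ [set z | ((I - e1)%:E < z)%E]); apply.
  apply: open_nbhs_nbhs; split; first exact: open_ereal_gt_ereal.
  by rewrite /= lte_fin ltrBlDr ltrDl.
apply: filterS nearI => n.
have mT := @measurable_kerIm_joint n a a0.
have k0 (z : W n * measurableTypeR R) : 0 <= kerIm a (Z n z.1 - z.2) by exact: kerIm_ge0.
have mf : measurable_fun `[(- S)%R, S] f.
  by apply: measurable_funTS; exact: continuous_measurable_fun.
have fp x : 0 <= f x by have /andP[] := f0 x.
rewrite -(expectation_integral (P n) (T := fun z => kerIm a (Z n z.1 - z.2)) mf fp mT k0).
have mfZ : measurable_fun setT (fun w => f (Z n w)).
  by apply: measurableT_comp => //; exact: continuous_measurable_fun.
have fi : (P n).-integrable setT (EFin \o (fun w => f (Z n w))).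
  apply: (@bounded_prob_integrable _ _ _ _ _ C) => // w.
  by rewrite ger0_norm//; have /andP[] := f0 (Z n w).
have mg : measurable_fun setT (fun w => (pi * (f (Z n w) + e1))%:E).
  apply/measurable_EFinP; apply: measurable_funM; first exact: measurable_cst.
  by apply: measurable_funD => //; exact: measurable_cst.
have U : (\int[P n]_w \int[leb]_(b in `[(- S)%R, S]) (f b * kerIm a (Z n w - b))%:E <=
    \int[P n]_w (pi * (f (Z n w) + e1))%:E)%E.
  apply: ge0_le_integral => //.
  - by move=> w _; apply: integral_ge0 => b _; rewrite lee_fin mulr_ge0// kerIm_ge0.
  - exact: (measurable_param_integral mf fp mT k0).
  - move=> w _.
    have ib : leb.-integrable `[(- S)%R, S] (EFin \o (fun b => f b * kerIm a (Z n w - b))).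
      apply: continuous_itv_integrable => b.
      by apply: cvgM; [exact: cf|exact: continuous_kerIm_subl].
    rewrite -[leLHS]fineK; last exact: integrable_fin_num ib.
    by rewrite lee_fin; exact: smooth.
have UE : (\int[P n]_w (pi * (f (Z n w) + e1))%:E =
    (pi * (\int[P n]_w f (Z n w) + e1))%:E)%E.
  have ic : (P n).-integrable setT (EFin \o (fun w => e1)).
    by apply: (@bounded_prob_integrable _ _ _ _ _ e1) => // w; rewrite gtr0_norm.
  have ifc : (P n).-integrable setT (EFin \o (fun w => f (Z n w) + e1)).
    exact: (integrableD _ fi ic).
  have ip : (P n).-integrable setT (EFin \o (fun w => pi * (f (Z n w) + e1))).
    exact: (integrableZl _ pi ifc).
  rewrite -[LHS]fineK; last exact: integrable_fin_num ip.
  congr EFin; rewrite [LHS]RintegralZl// RintegralD// Rintegral_cst//=.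
  by rewrite probability_setT/= mulr1.
move=> /lt_le_trans/(_ U); rewrite UE lte_fin => {U UE} key.
have cE := @Rintegral_cauchy_prob R f C S cf _ fS.
have {}cE : pi * \int[@cauchy_prob R]_x f x = \int[leb]_(b in `[(- S)%R, S]) (f b * kerIm 1 b).
  rewrite cE ?mulVKf ?gt_eqF// => x.
  by rewrite ger0_norm//; have /andP[] := f0 x.
move: J1 key; rewrite -{}cE.
move: (\int[cauchy_prob]_x f x) (\int[P n]_w f (Z n w)) => u v J1 key.
move: {IE cvgI} (I) J1 key => J J1 key.
rewrite ltNge; apply/negP => vu.
have q0 : 0 <= S * C by rewrite mulr_ge0// ltW.
have h1 : pi * v <= pi * (u - e) by rewrite ler_wpM2l// ltW.
have h2 : S * C * a <= S * C * e1 by rewrite ler_wpM2l// ltW.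
have h3 : 2 * e1 <= pi * e1 by rewrite ler_wpM2r// ltW.
have h4 : 2 * (S * C * e1) <= pi * (S * C * e1).
  by rewrite ler_wpM2r// mulr_ge0// ltW.
move: J1 key h1; rewrite -e1E !mulrDr.
have -> : 2 * S * C * a = 2 * (S * C * a) by ring.
have h5 : 0 <= S * C * e1 by rewrite mulr_ge0// ltW.
move: h2 h3 h4 h5.
have -> : pi * - (4 * e1 + 4 * (S * C * e1)) = - (4 * (pi * e1)) - 4 * (pi * (S * C * e1)) by ring.
move: (S * C * a) (S * C * e1) (pi * e1) (pi * u) (pi * v) => t1 t2 t3 t4 t5.
move: (pi * t2) => t6; lra.
Qed.

End poisson_weak_limit.

Section weak_limit.
Context {R : realType} (d : nat -> measure_display)
    (W : forall n : nat, measurableType (d n))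
    (P : forall n : nat, probability (W n) R) (Z : forall n, W n -> R).
Arguments Z : clear implicits.
Hypothesis mZ : forall n, measurable_fun setT (Z n).
Hypothesis poisson_cvg : forall a b e : R, 0 < a -> 0 < e -> \forall n \near \oo,
  `|\int[P n]_w kerIm a (Z n w - b) - kerIm (1 + a) b| < e.

(** The function g + C is nonnegative, and the truncations that approximate it from
    below lose little for the Cauchy law, so its lower bound survives. *)
Lemma bounded_limit_lower (g : R -> R) (C e : R) : continuous g ->
  (forall x, `|g x| <= C) -> 0 < e ->
  \forall n \near \oo, \int[@cauchy_prob R]_x g x - e < \int[P n]_w g (Z n w).
Proof.
move=> cg gC e0.
have C0 : 0 <= C by exact: le_trans (gC 0).
have e20 : 0 < e / 2 by rewrite divr_gt0.
have gb x : 0 <= g x + C <= 2 * C.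
  by have := gC x; rewrite ler_norml => /andP[h1 h2]; apply/andP; split; lra.
(* The successor keeps the cutoff scale positive. *)
pose f (m : nat) x := (g x + C) * cutoff m.+1%:R x.
have cgC : continuous (fun x => g x + C).
  by move=> x; apply: cvgD; [exact: cg|exact: cvg_cst].
have cf m : continuous (f m).
  by move=> x; apply: cvgM; [exact: cgC|exact: continuous_cutoff].
have f0 m x : 0 <= f m x <= g x + C.
  have /andP[h1 h2] := gb x.
  by rewrite mulr_ge0 ?cutoff_ge0//= ler_piMr ?cutoff_le1.
have fb m x : 0 <= f m x <= 2 * C.
  have /andP[h1 h2] := f0 m x; have /andP[h3 h4] := gb x.
  by rewrite h1 (le_trans h2).
have bint (d0 : measure_display) (W0 : measurableType d0) (Q : probability W0 R)
    (X : W0 -> R) (k : R -> R) : measurable_fun setT X -> continuous k ->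
    (forall x, `|k x| <= 2 * C) -> Q.-integrable setT (EFin \o (fun w => k (X w))).
  move=> mX ck kb; apply: (@bounded_prob_integrable _ _ _ _ _ (2 * C)) => //.
  by apply: measurableT_comp => //; exact: continuous_measurable_fun.
have gCb x : `|g x + C| <= 2 * C.
  by have /andP[h1 h2] := gb x; rewrite ger0_norm.
have fmb m x : `|f m x| <= 2 * C.
  by have /andP[h1 h2] := fb m x; rewrite ger0_norm.
have gb2 x : `|g x| <= 2 * C by apply: le_trans (gC x) _; lra.
have mid : measurable_fun [set: R] (@id R) by exact: measurable_id.
have addC (d0 : measure_display) (W0 : measurableType d0) (Q : probability W0 R)
    (X : W0 -> R) : measurable_fun setT X ->
    \int[Q]_w (g (X w) + C) = \int[Q]_w g (X w) + C.
  move=> mX; rewrite RintegralD//; last 2 first.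
  - exact: bint.
  - by apply: (@bounded_prob_integrable _ _ _ _ _ C) => // w; rewrite ger0_norm.
  by rewrite Rintegral_cst//= probability_setT/= mulr1.
have fcvg : (\int[@cauchy_prob R]_x (f m x)%:E)%E @[m --> \oo] -->
    (\int[@cauchy_prob R]_x (g x + C)%:E)%E.
  apply: (@dominated_cvg _ _ _ _ _ _ _ _ (fun _ => (2 * C)%:E)) => //.
  - by move=> m; apply/measurable_EFinP; exact: continuous_measurable_fun.
  - move=> x _; apply/fine_cvgP; split; first exact: nearW.
    apply: cvg_near_cst; near=> m; rewrite /= /f cutoff1 ?mulr1//.
    apply: (@le_trans _ _ m%:R); last by rewrite ler_nat.
    by near: m; exact: nbhs_infty_ger.
  - apply: (@bounded_prob_integrable _ _ _ (@cauchy_prob R) (fun _ => 2 * C) (2 * C)) => // x.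
    by rewrite ger0_norm// mulr_ge0.
  - by move=> m x _; rewrite lee_fin.
have [m fm] : exists m, \int[@cauchy_prob R]_x g x + C - e / 2 <
    \int[@cauchy_prob R]_x f m x.
  have EC : (\int[@cauchy_prob R]_x (g x + C)%:E = (\int[@cauchy_prob R]_x g x + C)%:E)%E.
    rewrite -(addC _ _ (@cauchy_prob R) id)// fineK//.
    exact: (integrable_fin_num _ (bint _ _ (@cauchy_prob R) id _ mid cgC gCb)).
  have /filter_ex[m] : \forall m \near \oo,
      ((\int[@cauchy_prob R]_x g x + C - e / 2)%:E < \int[@cauchy_prob R]_x (f m x)%:E)%E.
    move: fcvg; rewrite EC => /(_ [set z | (_ < z)%E]); apply.
    apply: open_nbhs_nbhs; split; first exact: open_ereal_gt_ereal.
    by rewrite /= lte_fin ltrBlDr ltrDl.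
  move=> hm; exists m; rewrite -lte_fin; apply: lt_le_trans hm _.
  rewrite fineK//; exact: (integrable_fin_num _ (bint _ _ (@cauchy_prob R) id _ mid (cf m) (fmb m))).
have S0 : 0 < 2 * m.+1%:R :> R by rewrite mulr_gt0.
have fS x : 2 * m.+1%:R <= `|x| -> f m x = 0 by move=> h; rewrite /f cutoff0 ?mulr0.
have := poisson_limit_lower mZ poisson_cvg (cf m) (fb m) S0 fS e20.
apply: filterS => n hn.
have : \int[P n]_w f m (Z n w) <= \int[P n]_w (g (Z n w) + C).
  apply: le_Rintegral => //.
  - exact: (bint _ _ (P n) (Z n) _ (@mZ n) (cf m) (fmb m)).
  - exact: (bint _ _ (P n) (Z n) _ (@mZ n) cgC gCb).
  - by move=> w _; have /andP[] := f0 m (Z n w).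
rewrite addC// => h; move: fm hn h.
move: (\int[cauchy_prob]_x f m x) (\int[P n]_w f m (Z n w)) => u v.
move: (\int[cauchy_prob]_x g x) (\int[P n]_w g (Z n w)) => s t; lra.
Unshelve. all: by end_near. Qed.

(** A lower bound for g and one for - g give convergence. *)
Theorem poisson_cvg_in_law : cvg_in_law P Z (@cauchy_prob R) (id : R -> R).
Proof.
move=> g cg [C gC]; rewrite unlock.
have mg : measurable_fun setT g by exact: continuous_measurable_fun.
have int0 (d0 : measure_display) (W0 : measurableType d0) (Q : probability W0 R)
    (X : W0 -> R) : measurable_fun setT X -> Q.-integrable setT (EFin \o (fun w => g (X w))).
  move=> mX; apply: (@bounded_prob_integrable _ _ _ _ _ C) => //.
  exact: measurableT_comp.
have iN := int0 _ _ (@cauchy_prob R) id (@measurable_id _ _ _).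
have -> : (\int[@cauchy_prob R]_x ((g \o id) x)%:E = (\int[@cauchy_prob R]_x g x)%:E)%E.
  by rewrite fineK//; exact: integrable_fin_num iN.
apply/fine_cvgP; split.
  by near=> n; exact: integrable_fin_num (int0 _ _ (P n) (Z n) (@mZ n)).
apply/cvgrPdist_lt => e e0.
have cNg : continuous (fun x => -1 * g x).
  by move=> x; apply: cvgM; [exact: cvg_cst|exact: cg].
have gNC x : `|-1 * g x| <= C by rewrite mulN1r normrN.
have h1 := bounded_limit_lower cg gC e0.
have h2 := bounded_limit_lower cNg gNC e0.
near=> n.
have k1 : \int[@cauchy_prob R]_x g x - e < \int[P n]_w g (Z n w) by near: n.
have k2 : \int[@cauchy_prob R]_x (-1 * g x) - e < \int[P n]_w (-1 * g (Z n w)) by near: n.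
change (`|\int[@cauchy_prob R]_x g x - \int[P n]_w g (Z n w)| < e).
move: k2; rewrite !RintegralZl//; last exact: (int0 _ _ (P n) (Z n) (@mZ n)).
move: k1; move: (\int[cauchy_prob]_x g x) (\int[P n]_w g (Z n w)) => s t k1 k2.
by rewrite ltr_norml; apply/andP; split; lra.
Unshelve. all: by end_near. Qed.

End weak_limit.

(** * Power bounds and the theorem *)

Section power_bound.
Context {R : realType}.
Notation leb := (@lebesgue_measure R).

Lemma powR_negative_cvg0 (s : R) : s < 0 -> x `^ s @[x --> +oo] --> 0.
Proof.
move=> s0; apply/cvgrPdist_lt => e e0.
near=> x.
have x1 : expR (ln e / s) < x by near: x; exact: nbhs_pinfty_gt.
have x0 : 0 < x by apply: lt_trans x1; exact: expR_gt0.
rewrite sub0r normrN ger0_norm ?powR_ge0// /powR gt_eqF//.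
rewrite -[ltRHS]lnK ?posrE// ltr_expR -ltr_ndivrMl// mulrC.
by rewrite -[ltLHS]expRK ltr_ln ?posrE ?expR_gt0.
Unshelve. all: by end_near. Qed.

Lemma powR_tail_integral (s : R) : s < 0 ->
  (\int[leb]_(x in `[1%R, +oo[) (x `^ (s - 1))%:E = (- s^-1)%:E)%E.
Proof.
move=> s0.
have dF (x : R) : 0 < x -> is_derive x 1 (fun x => s^-1 * x `^ s) (x `^ (s - 1)).
  move=> x0; have d1 := is_derive1_powR s x0.
  apply: is_derive_eq; by rewrite /GRing.scale/= mulrA mulVf ?mul1r// lt_eqF.
have cF (r : R) (x : R) : 0 < x -> {for x, continuous (fun x => x `^ r)}.
  move=> x0; apply: differentiable_continuous; apply/derivable1_diffP.
  by have [] := is_derive1_powR r x0.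
rewrite (@ge0_continuous_FTC2y _ (fun x => x `^ (s - 1)) (fun x => s^-1 * x `^ s) 1 0)//.
- by rewrite powR1 mulr1 -EFinB sub0r.
- by move=> x x1; exact: powR_ge0.
- apply: continuous_in_subspaceT => x; rewrite inE/= in_itv/= andbT => x1.
  by apply: cF; exact: lt_le_trans x1.
- rewrite -(mulr0 s^-1); apply: cvgM; first exact: cvg_cst.
  exact: powR_negative_cvg0.
- by move=> x x1; have [] := dF x (lt_trans ltr01 x1).
- apply: cvg_at_right_filter; apply: cvgM; first exact: cvg_cst.
  exact: cF.
- move=> x; rewrite in_itv/= andbT => x1; rewrite derive1E.
  by have [_ ->] := dF x (lt_trans ltr01 x1).
Qed.

(** Replacing the exponent by its positive part puts both terms under one power. *)
Lemma powR_bound_le (C alpha x : R) : 0 <= C -> 1 <= x ->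
  C * (1 + x `^ alpha) <= 2 * C * x `^ (Num.max alpha 0).
Proof.
move=> C0 x1; rewrite [2 * C]mulrC -mulrA ler_wpM2l//.
have h1 : 1 <= x `^ (Num.max alpha 0).
  by rewrite -{1}(powRr0 x) ler_powR// le_max lexx orbT.
have h2 : x `^ alpha <= x `^ (Num.max alpha 0) by rewrite ler_powR// le_max lexx.
by move: h1 h2; move: (_ `^ _) (_ `^ _) => u v; lra.
Qed.

Lemma powR_bound_tail_integrable (C alpha : R) : 0 <= C -> alpha < 1 ->
  tail_integrable (fun x => C * (1 + x `^ alpha)).
Proof.
move=> C0 a1.
have mh : measurable_fun [set: R] (fun x => C * (1 + x `^ alpha)).
  apply: measurable_funM; first exact: measurable_cst.
  apply: measurable_funD; first exact: measurable_cst.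
  exact: measurable_powR.
have s0 : Num.max alpha 0 - 1 < 0 by rewrite subr_lt0 gt_max a1 ltr01.
split.
- exact: measurable_funTS.
- by move=> x x1; rewrite mulr_ge0// addr_ge0// powR_ge0.
apply: (@le_lt_trans _ _ ((2 * C)%:E * \int[leb]_(x in `[1%R, +oo[)
   (x `^ (Num.max alpha 0 - 1 - 1))%:E)%E); last first.
  by rewrite powR_tail_integral// -EFinM ltry.
rewrite -ge0_integralZl//; last 3 first.
- by apply/measurable_EFinP/measurable_funTS; exact: measurable_powR.
- by move=> x _; rewrite lee_fin powR_ge0.
- by rewrite lee_fin mulr_ge0.
apply: ge0_le_integral => //=.
- move=> x; rewrite in_itv/= andbT => x1.
  by rewrite lee_fin mulr_ge0 ?invr_ge0 ?sqr_ge0// mulr_ge0// addr_ge0 ?powR_ge0.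
- apply/measurable_EFinP; apply: measurable_funM; first exact: measurable_funTS.
  apply: (measurableT_comp (f := fun x : R => x^-1)); first exact: measurable_invr.
  by apply: measurable_funTS; apply: continuous_measurable_fun; exact: exprn_continuous.
- apply/measurable_EFinP; apply: measurable_funM; first exact: measurable_cst.
  by apply: measurable_funTS; exact: measurable_powR.
- move=> x; rewrite in_itv/= andbT => x1.
  have x0 : 0 < x by exact: lt_le_trans x1.
  rewrite -EFinM lee_fin ler_pdivrMr ?exprn_gt0//.
  rewrite -mulrA -powR_mulrn ?(ltW x0)// -powRD; last by rewrite (gt_eqF x0) implybT.
  have -> : Num.max alpha 0 - 1 - 1 + 2%:R = Num.max alpha 0 by ring.
  exact: powR_bound_le.
Qed.

Lemma powR_bound_sublinear (C alpha : R) : 0 <= C -> alpha < 1 ->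
  C * (1 + x `^ alpha) / x @[x --> +oo] --> 0.
Proof.
move=> C0 a1.
have s0 : Num.max alpha 0 - 1 < 0 by rewrite subr_lt0 gt_max a1 ltr01.
have h : 2 * C * x `^ (Num.max alpha 0 - 1) @[x --> +oo] --> 0.
  rewrite -[X in _ --> X](mulr0 (2 * C)).
  by apply: cvgM; [exact: cvg_cst|exact: powR_negative_cvg0].
apply: (squeeze_cvgr _ (cvg_cst 0) h).
near=> x.
have x1 : 1 <= x by near: x; exact: nbhs_pinfty_ge.
have x0 : 0 < x by exact: lt_le_trans x1.
rewrite divr_ge0 ?(ltW x0) ?mulr_ge0 ?addr_ge0 ?powR_ge0//=.
rewrite powRB; last by rewrite (gt_eqF x0) implybT.
rewrite powRr1 ?(ltW x0)// mulrA ler_pM2r ?invr_gt0//.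
exact: powR_bound_le.
Unshelve. all: by end_near. Qed.

End power_bound.

(** The bound dominates the mean of a nonnegative quantity at x = 1 as soon as
    A n >= 1, hence C >= 0. *)
Lemma power_balance_condition (R : realType)
    (d : nat -> measure_display) (W : forall n : nat, measurableType (d n))
    (P : forall n : nat, probability (W n) R)
    (Mn : forall n : nat, {RV (P n) >-> lfmeasure R})
    (A : nat -> R) (C alpha : R) : A n @[n --> \oo] --> +oo -> alpha < 1 ->
  balance_bound P Mn A (fun x => C * (1 + x `^ alpha)) ->
  balance_condition P Mn A.
Proof.
move=> hA a1 bb.
have C0 : 0 <= C.
  have /filter_ex[n An] : \forall n \near \oo, 1 <= A n by move/cvgryPge : hA; apply.
  have := bb n 1; rewrite lexx An => /(_ isT); rewrite unlock powR1.
  move=> h; have : (0 <= (C * (1 + 1))%:E)%E.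
    by apply: le_trans h; apply: integral_ge0 => w _; rewrite lee_fin.
  by rewrite lee_fin pmulr_lge0.
exists (fun x => C * (1 + x `^ alpha)); split => //.
- exact: powR_bound_tail_integrable.
- exact: powR_bound_sublinear.
Qed.

Lemma reciprocal_integral_le0 (R : realType) (A : R) (mu : lfmeasure R) : A <= 0 ->
  reciprocal_integral A mu = 0.
Proof.
move=> A0; rewrite /reciprocal_integral.
rewrite (_ : [set x : R | 0 < `|x| <= A] = set0) ?Rintegral_set0//.
apply/seteqP; split => x //= /andP[x0 xA].
by have := lt_le_trans x0 (le_trans xA A0); rewrite ltxx.
Qed.

Theorem theorem5p3 (R : realType)
    (d : nat -> measure_display) (W : forall n : nat, measurableType (d n))
    (P : forall n : nat, probability (W n) R)
    (Mn : forall n : nat, {RV (P n) >-> lfmeasure R})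
    (hMn : forall (n : nat) (w : W n), is_weighted_point_measure (Mn n w))
    (A : nat -> R) (hA : A n @[n --> \oo] --> +oo) :
  (forall (d' : measure_display) (W' : measurableType d')
      (P' : probability W' R) (M : {RV P' >-> lfmeasure R}) (K : R),
    (* (i) *)
    (forall w : W', is_weighted_point_measure (M w)) ->
    cvg_in_law P (fun n => Mn n : W n -> lfmeasure R) P' M ->
    stationary P' M ->
    0 < K -> intensity P' M = K%:E ->
    (exists hM : R -> R, tail_integrable hM /\
      forall x : R, 1 <= `|x| ->
        ('E_P'[fun w => (`|counting_function (M w) x - K * x|)%R]
           <= (hM `|x|)%:E)%E) ->
    (* (ii) *)
    limn_esup (fun n => P n [set w | (0 < Mn n w `](- delta)%R, delta[%classic)%E])
      @[delta --> (0 : R)^'+] --> (0 : \bar R)%E ->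
    (* (iii) *)
    balance_condition P Mn A ->
    cvg_in_law P (fun n w => (pi * K)^-1 * reciprocal_integral (A n) (Mn n w))
      (@cauchy_prob R) (id : R -> R))
  /\
  (forall C alpha : R, alpha < 1 ->
    balance_bound P Mn A (fun x => C * (1 + x `^ alpha)) ->
    balance_condition P Mn A).
Proof.
split; last by move=> C alpha; exact: power_balance_condition.
move=> d' W' P' M K wM law stat K0 MK [hM [hMi hMb]] zero_free bal.
have s0 : 0 < pi * K by rewrite mulr_gt0 ?pi_gt0.
have mX n : measurable_fun setT (fun w => reciprocal_integral (A n) (Mn n w)).
  have [A0|A0] := ltP 0 (A n).
    by apply: measurable_reciprocal_integral => // w; exact: hMn.
  by under eq_fun do rewrite reciprocal_integral_le0//; exact: measurable_cst.
apply: poisson_cvg_in_law => [n|a b e a0 e0].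
  by apply: measurable_funM => //; exact: measurable_cst.
have sa0 : 0 < pi * K * a by rewrite mulr_gt0.
have es0 : 0 < e / (pi * K) by rewrite divr_gt0.
have := resolvent_reciprocal_cvg hMn hA wM law stat K0 MK hMi hMb zero_free bal
  (- (pi * K * b)) sa0 es0.
apply: filterS => n.
(* Rescaling by pi K turns the Poisson kernel of width a centred at b into [resIm];
   the limit value then is the Poisson kernel of width 1 + a. *)
have E1 x : kerIm a ((pi * K)^-1 * x - b) =
    pi * K * resIm (pi * K * a) (- (pi * K * b)) x 0.
  move: (pi * K) s0 => s s0.
  have D1 := lor_den_gt0 (s^-1 * x - b) a0.
  rewrite /kerIm /resIm add0r.
  have -> : x - s * b = s * (s^-1 * x - b) by field; rewrite gt_eqF.
  move: (s^-1 * x - b) D1 => t D1; rewrite !exprMn -mulrDr; field.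
  by rewrite !gt_eqF.
have E2 : kerIm (1 + a) b = pi * K * resIm (pi * K * a) (- (pi * K * b)) 0 (pi * K).
  move: (pi * K) s0 => s s0.
  have D1 := lor_den_gt0 b (addr_gt0 ltr01 a0).
  rewrite /kerIm /resIm add0r sqrrN -[X in X + s * a]mulr1 -mulrDr !exprMn -mulrDr.
  by field; rewrite !gt_eqF.
rewrite /=; under [X in _ -> `|X - _| < _]eq_Rintegral do rewrite E1.
rewrite E2 RintegralZl//; last first.
  apply: (@bounded_prob_integrable _ _ _ _ _ (pi * K * a)^-1).
    exact: (measurableT_comp (measurable_resIm_line _ sa0) (mX n)).
  by move=> w; rewrite ger0_norm ?resIm_ge0// resIm_le.
rewrite -mulrBr normrM (gtr0_norm s0) => h.
by rewrite mulrC -ltr_pdivlMr.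
Qed.
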